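(* Let $\Sigma\ne\mathbb{C}$ be a closed, possibly unbounded, subset of $\mathbb{C}$, let $Q$ be a weakly admissible external field on $\Sigma$ (for the mass $1$), and let $\mu_Q$ be the corresponding unit equilibrium measure. Suppose $\sigma=\sigma^+-\sigma^-$ is a signed measure on $\Sigma$ such that i) $\sigma^+(\mathbb{C})-\sigma^-(\mathbb{C})=1$; ii) the measures $\sigma^+$ and $\sigma^-$ have finite energies; iii) $V^{\sigma^+}$ and $V^{\sigma^-}$ are finite on $\operatorname{supp}\sigma$; iv) there exists a constant $C$ such that $V^{\sigma}(z)+Q(z)=C$ q.e. on $\Sigma$. Then $\mu_Q\le\sigma^+$. In particular, the support of $\mu_Q$ is contained in the support of $\sigma^+$.
   Context: $\sigma=\sigma^+-\sigma^-$ is the Jordan decomposition. $V^{\sigma}(z)=-\int\log|z-y|\,d\sigma(y)$ is the logarithmic potential and $I(\sigma)=-\iint\log|x-y|\,d\sigma(x)d\sigma(y)$ the logarithmic energy. ''q.e.'' (quasi-everywhere) means outside of a set of logarithmic capacity $0$. $Q$ is weakly admissible on $\Sigma$ (mass $1$) if: (i) $Q:\Sigma\to(-\infty,+\infty]$ is lower semi-continuous; (ii) $\{x\in\Sigma:Q(x)<+\infty\}$ has positive logarithmic capacity; (iii) if $\Sigma$ is unbounded, $\liminf_{|x|\to\infty,\,x\in\Sigma}(Q(x)-\log|x|)=M$ for some $M\in(-\infty,\infty]$. $\mu_Q$ is the unique probability measure on $\Sigma$ minimizing $\iint\left(\log\frac1{|x-y|}+Q(x)+Q(y)\right)d\tau(x)d\tau(y)$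 among probability measures $\tau$ on $\Sigma$ (existence and uniqueness are known). It is also known that $\mu_Q$ satisfies the Frostman inequalities: for some constant $F_Q\in\mathbb{R}$, $V^{\mu_Q}+Q\ge F_Q$ q.e. on $\Sigma$ and $V^{\mu_Q}+Q\le F_Q$ on $\operatorname{supp}\mu_Q$. *)

(* Defs.v *)
From HB Require Import structures.
From mathcomp Require Import all_boot all_order all_algebra.
From mathcomp Require Import all_classical all_reals all_analysis.

Set Implicit Arguments.
Unset Strict Implicit.
Unset Printing Implicit Defensive.

Import Order.TTheory GRing.Theory Num.Theory.
Import numFieldNormedType.Exports.

Local Open Scope classical_set_scope.
Local Open Scope ring_scope.
Local Open Scope ereal_scope.

(* The complex plane, identified with R * R: the product topology is the usual
   one and the product sigma-algebra is the Borel sigma-algebra.  The norm that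
   the library puts on R * R is the max norm, hence the separate modulus. *)
Notation plane R := (R * R)%type.

Section Potentials.
Context {R : realType}.
Implicit Types (E K S : set (plane R)) (x y z : plane R).

Definition modulus z : R := Num.sqrt (z.1 ^+ 2 + z.2 ^+ 2).

(* log (1 / |x - y|), equal to +oo on the diagonal since lne 0 = -oo. *)
Definition log_kernel x y : \bar R := - lne (modulus (x - y)%R)%:E.

Definition potential (mu : set (plane R) -> \bar R) z : \bar R :=
  \int[mu]_y log_kernel z y.

(* \int f is \int f^+ - \int f^- with oo - oo = -oo in \bar R, so the energy is
   a fin_num exactly when log |x - y| is mu \x mu-integrable. *)
Definition energy (mu : {finite_measure set (plane R) -> \bar R}) : \bar R :=
  \int[mu \x mu]_p log_kernel p.1 p.2.

(* cap E = exp (- inf I(mu)) over Borel probability measures mu whose support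
   is a compact subset of E (the infimum is +oo if there is none). *)
Definition log_capacity E : \bar R :=
  expeR (- ereal_inf [set energy mu | mu in
    [set mu : probability (plane R) R |
      exists K, [/\ compact K, K `<=` E & mu (~` K) = 0]]]).

Definition quasi_everywhere S (P : plane R -> Prop) : Prop :=
  log_capacity [set z | S z /\ ~ P z] = 0.

Definition supp (mu : set (plane R) -> \bar R) : set (plane R) :=
  [set z | forall U, open U -> U z -> 0 < mu U].

(* The filter of neighbourhoods of infinity, |x| --> +oo. *)
Definition at_infinity : set_system (plane R) :=
  [set A | exists M : R, forall x, (M < modulus x)%R -> A x].

(* An external field on S is given by a function on the whole plane whose
   values outside S play no role; in particular lower semicontinuity is that of
   its restriction to S, as points outside S are isolated in subspace S. *)
Definition weakly_admissible S (Q : plane R -> \bar R) : Prop :=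
  [/\ (forall x, S x -> -oo < Q x),
      @lower_semicontinuous (subspace S) R Q,
      0 < log_capacity [set x | S x /\ Q x < +oo] &
      ~ bounded_set S ->
        exists M : \bar R, -oo < M /\
          limf_einf (fun x => Q x - (ln (modulus x))%:E)
            (within S at_infinity) = M].

Definition weighted_energy S (Q : plane R -> \bar R)
    (tau : {finite_measure set (plane R) -> \bar R}) : \bar R :=
  \int[tau \x tau]_(p in S `*` S) (log_kernel p.1 p.2 + Q p.1 + Q p.2).

Definition equilibrium_measure S (Q : plane R -> \bar R)
    (mu : probability (plane R) R) : Prop :=
  mu (~` S) = 0 /\
  forall tau : probability (plane R) R, tau (~` S) = 0 ->
    weighted_energy S Q mu <= weighted_energy S Q tau.

(* V^sigma = V^(sigma^+) - V^(sigma^-); by uniqueness of the Jordan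
   decomposition it does not depend on the Hahn decomposition (P, N). *)
Definition signed_potential (sigma : {charge set (plane R) -> \bar R})
    (P N : set (plane R)) (sigmaPN : hahn_decomposition sigma P N) z : \bar R :=
  potential (jordan_pos sigmaPN) z - potential (jordan_neg sigmaPN) z.

End Potentials.

(* Main.v *)
Require Import Defs.
From HB Require Import structures.
From mathcomp Require Import all_boot all_order all_algebra.
From mathcomp Require Import all_classical all_reals all_analysis.
From mathcomp Require Import measurable_realfun.
From mathcomp Require Import ring lra.
Import Order.TTheory GRing.Theory Num.Theory.
Import numFieldNormedType.Exports.
Local Open Scope classical_set_scope.
Local Open Scope ring_scope.
Local Open Scope ereal_scope.
Set Implicit Arguments.
Unset Strict Implicit.
Unset Printing Implicit Defensive.

(** Write l(x) = log (1 + |x|), and let k(x, y) = l(x) + l(y) - log |x - y| be the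
nonnegative form of the logarithmic kernel, with potentials W a = int k(., y) da(y).
On Sigma the field is Q = q + l - c with q >= 0, by lower semicontinuity and by its
growth at infinity. The weights l cancel in the weighted energy, which becomes the
energy of k plus twice the integral of q (weighted_energyE): only nonnegative
integrands remain, and no logarithmic moment of the equilibrium measure mu is needed.

The first variation of the energy at mu gives F <= W mu + q almost everywhere for
every measure of finite energy, with equality mu-almost everywhere (frostman_ge,
frostman_eq). Measures of finite energy do not charge sets of capacity zero
(capacity0_null), so that W sigma^+ + q = W sigma^- + D almost everywhere on Sigma for
mu and for sigma^+ (ae_quasi_everywhere). Hence, for suitable constants A1 and A2, the
functions u1 = W mu + W sigma^- + A1 and u2 = W sigma^+ + A2 satisfy u2 <= u1
sigma^+-almost everywhere and u1 = u2 mu-almost everywhere, while mu + sigma^- and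
sigma^+ have the same mass.

These relations are propagated with the resolvent R_n = int_0^oo e^(-n s) P_s ds of the
heat semigroup of the plane, whose kernel r_n is called green. By Frullani's integral
the logarithm is a compensated potential of this semigroup, whence
n R_n (W a) + 2 pi U_n a + |a| l = W a + |a| n R_n l, where U_n a = int r_n(., y) da(y)
and |a| is the mass of a (kpot_resolvent). For measures of equal mass the terms in l
cancel. If a submedian function f is dominated by a potential U_l a of finite energy
and is invisible to a, then f = 0 almost everywhere (domination): integrate the
submedian inequality against f. Applied to the positive part of u2 - u1, together with
the recurrence of planar Brownian motion, this extends u2 <= u1 to Lebesgue-almost every
point (logarithmic_domination). Where u1 = u2, hence mu-almost everywhere, the resolvent
identities then give U_n mu + U_n sigma^- <= U_n sigma^+. A second application, to the
positive part of U_n mu - U_n sigma^+, extends U_n mu <= U_n sigma^+ to almost every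
point (U_domination). Since n U_n a tends weakly to a, this yields
int phi dmu <= int phi dsigma^+ for continuous phi with values in [0, 1], and
mu <= sigma^+ by regularity of finite Borel measures of the plane
(le_measure_of_potentials). *)

(** * Truncated differences and iterated integrals *)

(** Truncated differences of possibly infinite functions are only used through this
identity, which allows infinite values. *)
Lemma maxe_subDmine (R : realDomainType) (u v : \bar R) : 0 <= v ->
  maxe (u - v) 0 + mine u v = u.
Proof.
move=> v0; have [uv|vu] := leP u v.
  have [vfin|] := boolP (v \is a fin_num).
    by rewrite max_r ?add0e// leeBlDr// add0e.
  rewrite fin_numE negb_and !negbK => /orP[]/eqP vE.
    by rewrite vE in v0.
  by rewrite vE addeNy max_r ?leNye// add0e.
have vfin : v \is a fin_num by rewrite ge0_fin_numE// (lt_le_trans vu)// leey.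
rewrite max_l; first by rewrite subeK.
by rewrite leeBrDr// add0e ltW.
Qed.

Section tonelli_curried.
Context d1 d2 (T1 : measurableType d1) (T2 : measurableType d2) (R : realType).
Variables (m1 : {sigma_finite_measure set T1 -> \bar R})
          (m2 : {sigma_finite_measure set T2 -> \bar R}).
Variable f : T1 -> T2 -> \bar R.
Hypothesis mf : measurable_fun setT (fun p : T1 * T2 => f p.1 p.2).
Hypothesis f0 : forall x y, 0 <= f x y.

Lemma tonelli : \int[m1]_x \int[m2]_y f x y = \int[m2]_y \int[m1]_x f x y.
Proof. exact: (fubini_tonelli (fun p => f p.1 p.2) mf (fun p => f0 p.1 p.2)). Qed.

Lemma tonelli_prod :
  \int[m1 \x m2]_p f p.1 p.2 = \int[m1]_x \int[m2]_y f x y.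
Proof. exact: (fubini_tonelli1 (fun p => f p.1 p.2) mf (fun p => f0 p.1 p.2)). Qed.

Lemma measurable_integral1 : measurable_fun setT (fun x => \int[m2]_y f x y).
Proof.
exact: (measurable_fun_fubini_tonelli_F (fun p => f p.1 p.2) mf (fun p => f0 p.1 p.2)).
Qed.

Lemma measurable_integral2 : measurable_fun setT (fun y => \int[m1]_x f x y).
Proof.
exact: (measurable_fun_fubini_tonelli_G (fun p => f p.1 p.2) mf (fun p => f0 p.1 p.2)).
Qed.

Lemma measurable_section1 x : measurable_fun setT (f x).
Proof. exact: (measurableT_comp mf (pair1_measurable x)). Qed.

Lemma measurable_section2 y : measurable_fun setT (f ^~ y).
Proof. exact: (measurableT_comp mf (pair2_measurable y)). Qed.

End tonelli_curried.
Arguments tonelli {d1 d2 T1 T2 R m1 m2} f.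
Arguments tonelli_prod {d1 d2 T1 T2 R m1 m2} f.
Arguments measurable_integral1 {d1 d2 T1 T2 R m2} f.
Arguments measurable_integral2 {d1 d2 T1 T2 R m1} f.

(** * Symmetric resolvents and domination principles *)

(** A symmetric resolvent with l R_l 1 = 1, given by its kernel. Only the second
domination principle also uses that the kernels are positive and increase to +oo as
the rate tends to 0. *)
Section Resolvent.
Context d (T : measurableType d) (R : realType).
Variable m : {sigma_finite_measure set T -> \bar R}.
Variable r : R -> T -> T -> \bar R.
Hypothesis r_ge0 : forall l x y, 0 <= r l x y.
Hypothesis r_meas : forall l, measurable_fun setT (fun p : T * T => r l p.1 p.2).
Hypothesis r_sym : forall l x y, r l x y = r l y x.
Hypothesis r_mass : forall l x, (0 < l)%R -> \int[m]_y r l x y = (l^-1)%:E.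
Hypothesis r_resolvent : forall l n x y, (0 < l)%R -> (l < n)%R ->
  r l x y = r n x y + (n - l)%:E * \int[m]_z (r l x z * r n z y).

Definition resolvent l (f : T -> \bar R) x := \int[m]_z (r l x z * f z).
Definition resolvent_potential l (a : set T -> \bar R) x := \int[a]_y r l x y.
Local Notation Rop := resolvent.
Local Notation U := resolvent_potential.

Lemma r_meas1 l x : measurable_fun setT (r l x).
Proof. exact: (measurableT_comp (r_meas l) (pair1_measurable x)). Qed.

Lemma measurable_resolvent_integrand l f :
  measurable_fun setT f -> measurable_fun setT (fun p : T * T => r l p.1 p.2 * f p.2).
Proof.
move=> mf; apply: emeasurable_funM; first exact: r_meas.
exact: (measurableT_comp mf measurable_snd).
Qed.

Lemma measurable_resolvent l f : (forall x, 0 <= f x) ->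
  measurable_fun setT f -> measurable_fun setT (Rop l f).
Proof.
move=> f0 mf.
apply: (measurable_integral1 (fun x z => r l x z * f z)).
  exact: measurable_resolvent_integrand.
by move=> x y; exact: mule_ge0.
Qed.

Lemma resolvent_ge0 l f x : (forall x, 0 <= f x) -> 0 <= Rop l f x.
Proof. by move=> f0; apply: integral_ge0 => z _; exact: mule_ge0. Qed.

Lemma measurable_rM l x f : measurable_fun setT f ->
  measurable_fun setT (fun z => r l x z * f z).
Proof. by move=> mf; apply: emeasurable_funM => //; exact: r_meas1. Qed.

Lemma le_resolvent l f g x : (forall x, 0 <= f x) ->
  measurable_fun setT f -> measurable_fun setT g ->
  (forall x, f x <= g x) -> Rop l f x <= Rop l g x.
Proof.
move=> f0 mf mg fg; apply: ge0_le_integral => //; try exact: measurable_rM.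
- by move=> z _; exact: mule_ge0.
- by move=> z _; exact: lee_pmul.
Qed.

Lemma ae_le_resolvent l f g x : (forall x, 0 <= f x) -> (forall x, 0 <= g x) ->
  measurable_fun setT f -> measurable_fun setT g ->
  {ae m, forall x, f x <= g x} -> Rop l f x <= Rop l g x.
Proof.
move=> f0 g0 mf mg fg; apply: ae_ge0_le_integral => //; try exact: measurable_rM.
- by move=> z _; exact: mule_ge0.
- by move=> z _; exact: mule_ge0.
- by apply: filterS fg => z fgz _; exact: lee_pmul.
Qed.

Lemma resolventD l f g x : (forall x, 0 <= f x) -> (forall x, 0 <= g x) ->
  measurable_fun setT f -> measurable_fun setT g ->
  Rop l (fun z => f z + g z) x = Rop l f x + Rop l g x.
Proof.
move=> f0 g0 mf mg; rewrite /resolvent -ge0_integralD//; first last.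
- exact: measurable_rM.
- by move=> z _; exact: mule_ge0.
- exact: measurable_rM.
- by move=> z _; exact: mule_ge0.
by apply: eq_integral => z _; rewrite ge0_muleDr.
Qed.

Lemma resolventZ l (k : R) f x : (0 <= k)%R -> (forall x, 0 <= f x) ->
  measurable_fun setT f -> Rop l (fun z => k%:E * f z) x = k%:E * Rop l f x.
Proof.
move=> k0 f0 mf; rewrite /resolvent -ge0_integralZl_EFin//; first last.
- exact: measurable_rM.
- by move=> z _; exact: mule_ge0.
by apply: eq_integral => z _; rewrite muleCA.
Qed.

Lemma resolvent_cst l (k : R) x : (0 < l)%R -> (0 <= k)%R ->
  Rop l (fun=> k%:E) x = (k / l)%:E.
Proof.
move=> l0 k0; rewrite /resolvent.
under eq_integral do rewrite muleC.
rewrite ge0_integralZl_EFin//; first by rewrite r_mass// -EFinM.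
exact: r_meas1.
Qed.

Section potential.
Variable a : {finite_measure set T -> \bar R}.

Lemma resolvent_potential_ge0 l x : 0 <= U l a x.
Proof. exact: integral_ge0. Qed.

Lemma measurable_resolvent_potential l : measurable_fun setT (U l a).
Proof.
exact: (measurable_integral1 (r l)).
Qed.

(** Exchanging the order of integration moves the resolvent onto the measure. *)
Lemma integral_resolvent_potential l f : (forall x, 0 <= f x) -> measurable_fun setT f ->
  \int[m]_x (f x * U l a x) = \int[a]_x Rop l f x.
Proof.
move=> f0 mf.
have mfr : measurable_fun setT (fun p : T * T => f p.1 * r l p.1 p.2).
  apply: emeasurable_funM; last exact: r_meas.
  exact: (measurableT_comp mf measurable_fst).
transitivity (\int[m]_x \int[a]_y (f x * r l x y)).
  apply: eq_integral => x _; rewrite ge0_integralZl//; exact: r_meas1.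
rewrite (tonelli (fun x y => f x * r l x y) mfr); last first.
  by move=> x y; exact: mule_ge0.
apply: eq_integral => y _; apply: eq_integral => x _.
by rewrite muleC r_sym.
Qed.

End potential.

Lemma resolvent_swap l n x y :
  \int[m]_z (r l x z * r n z y) = \int[m]_z (r n y z * r l z x).
Proof.
by apply: eq_integral => z _; rewrite muleC r_sym (r_sym l).
Qed.

Lemma r_resolvent' l n x y : (0 < l)%R -> (l < n)%R ->
  r l x y = r n x y + (n - l)%:E * \int[m]_z (r n x z * r l z y).
Proof.
by move=> l0 ln; rewrite r_sym (@r_resolvent l n y x)// r_sym resolvent_swap.
Qed.

Lemma le_r l n x y : (0 < l)%R -> (l <= n)%R -> r n x y <= r l x y.
Proof.
move=> l0; rewrite le_eqVlt => /predU1P[->//|ln].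
rewrite (@r_resolvent l n x y)// leeDl// mule_ge0//.
  by rewrite lee_fin subr_ge0 ltW.
by apply: integral_ge0 => z _; exact: mule_ge0.
Qed.

Lemma resolvent_resolvent n l f x : (forall x, 0 <= f x) -> measurable_fun setT f ->
  Rop n (Rop l f) x = \int[m]_y ((\int[m]_z (r n x z * r l z y)) * f y).
Proof.
move=> f0 mf.
have m3 : measurable_fun setT (fun p : T * T => r n x p.1 * (r l p.1 p.2 * f p.2)).
  apply: emeasurable_funM; last exact: measurable_resolvent_integrand.
  exact: (measurableT_comp (@r_meas1 n x) measurable_fst).
transitivity (\int[m]_z \int[m]_y (r n x z * (r l z y * f y))).
  apply: eq_integral => z _; rewrite ge0_integralZl//.
  - exact: measurable_rM.
  - by move=> y _; exact: mule_ge0.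
rewrite (tonelli (fun z y => r n x z * (r l z y * f y)) m3); last first.
  by move=> z y; rewrite !mule_ge0.
apply: eq_integral => y _; rewrite -ge0_integralZr//.
- by apply: eq_integral => z _; rewrite muleA.
- apply: emeasurable_funM; first exact: r_meas1.
  exact: (measurableT_comp (r_meas l) (pair2_measurable y)).
- by move=> z _; exact: mule_ge0.
Qed.

Lemma measurable_rr n l x : measurable_fun setT (fun y => \int[m]_z (r n x z * r l z y)).
Proof.
apply: (measurable_integral2 (fun z y => r n x z * r l z y)).
  apply: emeasurable_funM; last exact: r_meas.
  exact: (measurableT_comp (@r_meas1 n x) measurable_fst).
by move=> z y; exact: mule_ge0.
Qed.

Lemma rr_ge0 n l x y : 0 <= \int[m]_z (r n x z * r l z y).
Proof. by apply: integral_ge0 => z _; exact: mule_ge0. Qed.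

Lemma resolvent_eq l n f x : (0 < l)%R -> (l < n)%R ->
  (forall x, 0 <= f x) -> measurable_fun setT f ->
  Rop l f x = Rop n f x + (n - l)%:E * Rop n (Rop l f) x.
Proof.
move=> l0 ln f0 mf; have nl0 : (0 <= n - l)%R by rewrite subr_ge0 ltW.
rewrite resolvent_resolvent// -ge0_integralZl_EFin//; first last.
- by apply: emeasurable_funM => //; exact: measurable_rr.
- by move=> y _; rewrite mule_ge0// rr_ge0.
rewrite -ge0_integralD//; first last.
- apply: emeasurable_funM => //; apply: emeasurable_funM => //; exact: measurable_rr.
- by move=> y _; rewrite !mule_ge0// rr_ge0.
- exact: measurable_rM.
- by move=> y _; exact: mule_ge0.
apply: eq_integral => y _; rewrite (@r_resolvent' l n x y)// muleA ge0_muleDl//.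
by rewrite mule_ge0// rr_ge0.
Qed.

Lemma resolventC l n f x : (0 < l)%R -> (l < n)%R ->
  (forall x, 0 <= f x) -> measurable_fun setT f ->
  Rop l f x = Rop n f x + (n - l)%:E * Rop l (Rop n f) x.
Proof.
move=> l0 ln f0 mf; have nl0 : (0 <= n - l)%R by rewrite subr_ge0 ltW.
rewrite resolvent_resolvent// -ge0_integralZl_EFin//; first last.
- by apply: emeasurable_funM => //; exact: measurable_rr.
- by move=> y _; rewrite mule_ge0// rr_ge0.
rewrite -ge0_integralD//; first last.
- apply: emeasurable_funM => //; apply: emeasurable_funM => //; exact: measurable_rr.
- by move=> y _; rewrite !mule_ge0// rr_ge0.
- exact: measurable_rM.
- by move=> y _; exact: mule_ge0.
apply: eq_integral => y _; rewrite (@r_resolvent l n x y)// muleA ge0_muleDl//.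
by rewrite mule_ge0// rr_ge0.
Qed.

Lemma resolvent_potential_eq (a : {finite_measure set T -> \bar R}) l n x :
  (0 < l)%R -> (l < n)%R ->
  U l a x = U n a x + (n - l)%:E * Rop n (U l a) x.
Proof.
move=> l0 ln; have nl0 : (0 <= n - l)%R by rewrite subr_ge0 ltW.
have m3 : measurable_fun setT (fun p : T * T => r n x p.1 * r l p.1 p.2).
  apply: emeasurable_funM; last exact: r_meas.
  exact: (measurableT_comp (@r_meas1 n x) measurable_fst).
have -> : Rop n (U l a) x = \int[a]_y \int[m]_z (r n x z * r l z y).
  rewrite -(tonelli (fun z y => r n x z * r l z y) m3); last first.
    by move=> z y; exact: mule_ge0.
  by apply: eq_integral => z _; rewrite ge0_integralZl//; exact: r_meas1.
rewrite -ge0_integralZl_EFin//; first last.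
- exact: measurable_rr.
- by move=> y _; exact: rr_ge0.
rewrite -ge0_integralD//; first last.
- by apply: emeasurable_funM => //; exact: measurable_rr.
- by move=> y _; rewrite mule_ge0// rr_ge0.
- exact: r_meas1.
by apply: eq_integral => y _; exact: r_resolvent'.
Qed.

(** The resolvent equation writes U l a as this average plus the potential U n a. *)
Lemma resolvent_supermedian (a : {finite_measure set T -> \bar R}) l n x :
  (0 < l)%R -> (l < n)%R -> (n - l)%:E * Rop n (U l a) x <= U l a x.
Proof.
move=> l0 ln; rewrite (@resolvent_potential_eq a l n x)//.
by rewrite leeDr// resolvent_potential_ge0.
Qed.

(** Schur's test: bound 2 f(x) f(y) by f(x)^2 + f(y)^2 and integrate against the
symmetric kernel, whose mass is 1 / l. *)
Lemma resolvent_schur l f : (0 < l)%R -> (forall x, 0 <= f x) -> measurable_fun setT f ->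
  \int[m]_x (f x * Rop l f x) <= (l^-1)%:E * \int[m]_x (f x * f x).
Proof.
move=> l0 f0 mf.
have l10 : (0 <= l^-1)%R by rewrite invr_ge0 ltW.
have mff : measurable_fun setT (fun x => f x * f x) by exact: emeasurable_funM.
have mf1 : measurable_fun setT (fun p : T * T => f p.1).
  exact: (measurableT_comp mf measurable_fst).
have mf2 : measurable_fun setT (fun p : T * T => f p.2).
  exact: (measurableT_comp mf measurable_snd).
pose h1 x y := r l x y * (f x * f x).
pose h2 x y := r l x y * (f y * f y).
pose h3 x y := f x * (r l x y * f y).
have h10 x y : 0 <= h1 x y by rewrite !mule_ge0.
have h20 x y : 0 <= h2 x y by rewrite !mule_ge0.
have h30 x y : 0 <= h3 x y by rewrite !mule_ge0.
have mh1 : measurable_fun setT (fun p : T * T => h1 p.1 p.2).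
  apply: emeasurable_funM; first exact: r_meas.
  exact: emeasurable_funM.
have mh2 : measurable_fun setT (fun p : T * T => h2 p.1 p.2).
  apply: emeasurable_funM; first exact: r_meas.
  exact: emeasurable_funM.
have mh3 : measurable_fun setT (fun p : T * T => h3 p.1 p.2).
  apply: emeasurable_funM => //.
  by apply: emeasurable_funM => //; exact: r_meas.
have H1 : \int[m]_x \int[m]_y h1 x y = (l^-1)%:E * \int[m]_x (f x * f x).
  rewrite -ge0_integralZl_EFin//; last by move=> x _; exact: mule_ge0.
  apply: eq_integral => x _; rewrite /h1 ge0_integralZr//.
  - by rewrite r_mass.
  - exact: r_meas1.
  - exact: mule_ge0.
have H2 : \int[m]_x \int[m]_y h2 x y = (l^-1)%:E * \int[m]_x (f x * f x).
  rewrite -H1; transitivity (\int[m]_y \int[m]_x h2 x y).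
    exact: (tonelli h2 mh2 h20).
  by apply: eq_integral => y _; apply: eq_integral => x _; rewrite /h2 r_sym.
have H3 : \int[m]_x (f x * Rop l f x) = \int[m]_x \int[m]_y h3 x y.
  apply: eq_integral => x _; rewrite ge0_integralZl//; first exact: measurable_rM.
  by move=> y _; exact: mule_ge0.
have h123 x y : h3 x y + h3 x y <= h1 x y + h2 x y.
  rewrite /h1 /h2 /h3 (muleCA (f x)) -!ge0_muleDr ?mule_ge0//.
  apply: lee_wpmul2l => //.
  have := f0 x; have := f0 y.
  case: (f x) (f y) => [u| |] [v| |]//.
  - by rewrite -!EFinM -!EFinD !lee_fin => _ _; have := sqr_ge0 (u - v)%R; lra.
  - by move=> _ _; rewrite mulyy addey// leey.
  - by move=> _ _; rewrite mulyy addye// leey.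
have H : \int[m]_x (f x * Rop l f x) + \int[m]_x (f x * Rop l f x) <=
         (l^-1)%:E * \int[m]_x (f x * f x) + (l^-1)%:E * \int[m]_x (f x * f x).
  rewrite H3 -{1}H1 -H2.
  rewrite -(tonelli_prod h1 mh1 h10) -(tonelli_prod h2 mh2 h20).
  rewrite -(tonelli_prod h3 mh3 h30) -ge0_integralD// -ge0_integralD//.
  apply: ge0_le_integral => //.
  - by move=> p _; rewrite adde_ge0.
  - exact: emeasurable_funD.
  - exact: emeasurable_funD.
move: H.
have : 0 <= \int[m]_x (f x * Rop l f x).
  by apply: integral_ge0 => x _; rewrite mule_ge0// resolvent_ge0.
have : 0 <= (l^-1)%:E * \int[m]_x (f x * f x).
  by rewrite mule_ge0// integral_ge0// => x _; exact: mule_ge0.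
case: (\int[m]_x (f x * Rop l f x)) => [u| |]; case: (_ * _) => [v| |]//=; rewrite ?leey//.
by move=> _ _; rewrite -!EFinD !lee_fin; lra.
Qed.

Section domination.
Variable a : {finite_measure set T -> \bar R}.
Hypothesis a_energy : forall l, (0 < l)%R -> \int[a]_x U l a x < +oo.
Variables (l k : R).
Hypotheses (l0 : (0 < l)%R) (k0 : (0 <= k)%R).
Variable f : T -> \bar R.
Hypothesis f0 : forall x, 0 <= f x.
Hypothesis mf : measurable_fun setT f.
Hypothesis fU : forall x, f x <= k%:E * U l a x.

Let mUa n : measurable_fun setT (U n a) := @measurable_resolvent_potential a n.
Let U0 n x : 0 <= U n a x := @resolvent_potential_ge0 a n x.
Let mkU : measurable_fun setT (fun x => k%:E * U l a x).
Proof. exact: emeasurable_funM. Qed.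

Let le_scaled_resolvent n x : (l < n)%R ->
  (n - l)%:E * Rop n f x <= k%:E * U l a x.
Proof.
move=> ln; have nl0 : (0 <= n - l)%R by rewrite subr_ge0 ltW.
apply: (@le_trans _ _ ((n - l)%:E * Rop n (fun x => k%:E * U l a x) x)).
  by apply: lee_wpmul2l => //; exact: le_resolvent.
by rewrite resolventZ// muleCA lee_wpmul2l//; exact: resolvent_supermedian.
Qed.

Let square_fin : \int[m]_x (f x * f x) < +oo.
Proof.
have l20 : (0 < l / 2)%R by rewrite divr_gt0.
have l2l : (l / 2 < l)%R by lra.
have mfU n : measurable_fun setT (fun x => f x * U n a x) by exact: emeasurable_funM.
apply: (@le_lt_trans _ _ (\int[m]_x (k%:E * (f x * U l a x)))).
  apply: ge0_le_integral => //; first by move=> x _; exact: mule_ge0.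
  - exact: emeasurable_funM.
  - exact: emeasurable_funM.
  - by move=> x _; rewrite muleCA lee_wpmul2l.
rewrite ge0_integralZl_EFin//; last by move=> x _; exact: mule_ge0.
rewrite integral_resolvent_potential// lte_mul_pinfty//.
have kl0 : (0 <= 2 * k / l)%R by rewrite divr_ge0 ?mulr_ge0// ltW.
apply: (@le_lt_trans _ _ (\int[a]_x ((2 * k / l)%:E * U (l / 2) a x))); last first.
  by rewrite ge0_integralZl_EFin ?lte_mul_pinfty//; exact: a_energy.
apply: ge0_le_integral => //.
- by move=> x _; exact: resolvent_ge0.
- exact: measurable_resolvent.
- exact: emeasurable_funM.
- move=> x _.
  apply: (@le_trans _ _ (Rop l (fun x => k%:E * U (l / 2) a x) x)).
    apply: le_resolvent => //; first exact: emeasurable_funM.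
    move=> y; rewrite (le_trans (fU y))// lee_wpmul2l//.
    apply: ge0_le_integral => //; try exact: r_meas1.
    by move=> z _; apply: le_r => //; exact: ltW.
  rewrite resolventZ//.
  have -> : k%:E = (2 * k / l)%:E * (l - l / 2)%:E.
    by rewrite -EFinM; congr _%:E; field; rewrite gt_eqF.
  by rewrite -muleA lee_wpmul2l//; exact: resolvent_supermedian.
Qed.

Hypothesis f_submedian : forall n x, (l < n)%R ->
  f x <= (n - l)%:E * Rop n f x + k%:E * U n a x.

Let square_le n : (l < n)%R ->
  l%:E * \int[m]_x (f x * f x) <= k%:E * \int[a]_x (n%:E * Rop n f x).
Proof.
move=> ln; have n0 : (0 < n)%R by exact: lt_trans ln.
have nl0 : (0 <= n - l)%R by rewrite subr_ge0 ltW.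
have mRf : measurable_fun setT (Rop n f) by exact: measurable_resolvent.
have Rf0 x : 0 <= Rop n f x by exact: resolvent_ge0.
have mfR : measurable_fun setT (fun x => f x * Rop n f x) by exact: emeasurable_funM.
have mfU : measurable_fun setT (fun x => f x * U n a x) by exact: emeasurable_funM.
have fR0 x : 0 <= f x * Rop n f x by exact: mule_ge0.
have fU0 x : 0 <= f x * U n a x by exact: mule_ge0.
rewrite (ge0_integralZl_EFin a)//; last exact: ltW.
have fin2 : \int[m]_x (f x * f x) \is a fin_num.
  by rewrite ge0_fin_numE ?square_fin// integral_ge0// => x _; exact: mule_ge0.
have : \int[m]_x (f x * f x) <=
   (n - l)%:E * \int[m]_x (f x * Rop n f x) + k%:E * \int[a]_x Rop n f x.
  rewrite -integral_resolvent_potential// -!ge0_integralZl_EFin//.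
  rewrite -ge0_integralD//; first last.
  - exact: emeasurable_funM.
  - by move=> x _; rewrite mule_ge0.
  - exact: emeasurable_funM.
  - by move=> x _; rewrite mule_ge0.
  apply: ge0_le_integral => //.
  - by move=> x _; exact: mule_ge0.
  - exact: emeasurable_funM.
  - by apply: emeasurable_funD; exact: emeasurable_funM.
  - move=> x _; rewrite muleCA (muleCA k%:E) -ge0_muleDr ?mule_ge0//.
    by apply: lee_wpmul2l => //; exact: f_submedian.
have := @resolvent_schur n f n0 f0 mf.
have : 0 <= \int[m]_x (f x * Rop n f x) by exact: integral_ge0.
have : 0 <= \int[a]_x Rop n f x by exact: integral_ge0.
rewrite -(fineK fin2); set F := fine _.
case: (\int[a]_x Rop n f x) => [v| |]//.
  case: (\int[m]_x (f x * Rop n f x)) => [u| |]//.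
  rewrite -!EFinM -EFinD !lee_fin => v0 u0 h1 h2.
  have h3 : (n * u <= F)%R by rewrite -ler_pdivlMl.
  have h4 : (n * F <= (n - l) * (n * u) + n * (k * v))%R.
    rewrite mulrCA -mulrDr; exact: (ler_wpM2l (ltW n0) h2).
  have h5 : ((n - l) * (n * u) <= (n - l) * F)%R by exact: ler_wpM2l.
  rewrite (mulrCA k); lra.
case: (\int[m]_x (f x * Rop n f x)) => [u| |]//.
move=> _ u0; move: k0; rewrite le_eqVlt => /predU1P[<-|k1]; last first.
  by move=> _ _; rewrite gt0_muley// gt0_muley// leey.
rewrite !mul0e adde0 -!EFinM !lee_fin => h1 h2.
have h3 : (n * u <= F)%R by rewrite -ler_pdivlMl.
have h4 : (n * F <= (n - l) * (n * u))%R.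
  rewrite mulrCA; exact: (ler_wpM2l (ltW n0) h2).
have h5 : ((n - l) * (n * u) <= (n - l) * F)%R by exact: ler_wpM2l.
lra.
Qed.

(** The estimate behind both domination principles. Integrating the submedian
inequality against f, Schur's test absorbs the term (n - l) R_n f and leaves
l int f^2 dm <= k int n R_n f da. The right-hand side tends to 0 by dominated
convergence as soon as the averages n R_n f vanish in the limit at a-almost every
point, that is, as soon as f is invisible to a. *)
Lemma domination :
  {ae a, forall x, (fun n : nat => n%:R%:E * Rop n%:R f x) @ \oo --> 0} ->
  {ae m, forall x, f x = 0}.
Proof.
move=> f_lim.
have [N lN] : exists N : nat, (2 * l < N%:R)%R.
  exists (Num.truncn (2 * l)).+1; exact: truncnS_gt.
pose h j x := (j + N)%:R%:E * Rop (j + N)%:R f x.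
have Nj j : (2 * l < (j + N)%:R)%R by rewrite (lt_le_trans lN)// ler_nat leq_addl.
have l2l : (l <= 2 * l)%R by have := l0; lra.
have lNj j : (l < (j + N)%:R)%R by exact: le_lt_trans (Nj j).
have hU j x : `|h j x| <= (2 * k)%:E * U l a x.
  rewrite gee0_abs ?mule_ge0 ?resolvent_ge0// /h.
  apply: (@le_trans _ _ (2%:E * (((j + N)%:R - l)%:E * Rop (j + N)%:R f x))).
    rewrite muleA -EFinM lee_wpmul2r ?resolvent_ge0// lee_fin.
    by move: (ltW (Nj j)); set M := _%:R; lra.
  by rewrite EFinM -muleA lee_wpmul2l//; exact: le_scaled_resolvent.
have k20 : (0 <= 2 * k)%R by rewrite mulr_ge0.
have [_ _ /= cvg0] : [/\ a.-integrable setT (cst 0),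
   [sequence (\int[a]_x `|h n x - cst 0 x|)%E]_n @ \oo --> 0 &
   [sequence (\int[a]_x (h n x))%E]_n @ \oo --> \int[a]_x (cst 0 x)].
  apply: (@dominated_convergence _ _ _ _ _ measurableT h (cst 0)
    (fun x => (2 * k)%:E * U l a x)) => //.
  - by move=> j; apply: emeasurable_funM => //; exact: measurable_resolvent.
  - apply: filterS f_lim => x fx _.
    by have := cvg_comp (addn^~ N) (fun n : nat => n%:R%:E * Rop n%:R f x) (cvg_addnr N) fx.
  - apply/integrableP; split; first exact: emeasurable_funM.
    under eq_integral do rewrite gee0_abs ?mule_ge0 ?lee_fin ?mulr_ge0//.
    rewrite ge0_integralZl_EFin// lte_mul_pinfty//.
    exact: a_energy.
  - by apply: aeW => x n _; exact: hU.
have F2 : l%:E * \int[m]_x (f x * f x) <= 0.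
  have : (fun n => k%:E * \int[a]_x h n x) @ \oo --> 0.
    rewrite integral0 in cvg0.
    by rewrite -[X in _ --> X](mule0 k%:E); apply: cvgeZl.
  move=> /[dup] /cvg_lim <-//; move=> /cvgP cv.
  by apply: lime_ge => //; apply: nearW => n; exact: square_le.
have : \int[m]_x `|f x * f x| = 0.
  under eq_integral do rewrite gee0_abs ?mule_ge0//.
  apply/eqP; rewrite eq_le integral_ge0 ?andbT; last by move=> x _; exact: mule_ge0.
  by move: F2; rewrite pmule_rle0// lte_fin.
move/ae_eq_integral_abs => /(_ measurableT (emeasurable_funM mf mf)).
apply: filterS => x /(_ I) /eqP; rewrite mule_eq0 orbb => /eqP; exact.
Qed.
End domination.

Lemma ge0_cvge0 (u : nat -> \bar R) : (forall n, 0 <= u n) ->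
  (forall e : R, (0 < e)%R -> \forall n \near \oo, u n <= e%:E) -> u @ \oo --> 0.
Proof.
move=> u0 ule; apply/fine_cvgP; split.
  by apply: filterS (ule 1%R ltr01) => n un; rewrite ge0_fin_numE// (le_lt_trans un) ?ltry.
apply/cvgrPdist_le => e e0; apply: filterS (ule e e0) => n un /=.
rewrite sub0r normrN ger0_norm ?fine_ge0// -lee_fin fineK//.
by rewrite ge0_fin_numE// (le_lt_trans un) ?ltry.
Qed.

(** What the resolvent sees of lower semicontinuity. *)
Definition approached_from_below (h : T -> \bar R) x := forall c : R, c%:E < h x ->
  \forall n \near \oo, c%:E < n%:R%:E * Rop n%:R h x.

(** The upper counterpart, which holds for potentials although they are in general not
upper semicontinuous. *)
Definition not_exceeded (f : T -> \bar R) x := forall c : R, f x < c%:E ->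
  \forall n \near \oo, n%:R%:E * Rop n%:R f x <= c%:E.

(** The averages of f are at most f(x) in the limit, and those of h at least h(x) = f(x),
so that nothing is left for those of g = f - h. With g = maxe (u - v) 0 and
h = mine u v this shows that g is invisible at a point where u <= v. *)
Lemma scaled_resolvent_cvg0 (f g h : T -> \bar R) x :
  (forall z, 0 <= g z) -> (forall z, 0 <= h z) ->
  measurable_fun setT g -> measurable_fun setT h ->
  (forall z, g z + h z = f z) -> h x = f x -> f x < +oo ->
  approached_from_below h x -> not_exceeded f x ->
  (fun n => n%:R%:E * Rop n%:R g x) @ \oo --> 0.
Proof.
move=> g0 h0 mg mh dhf hfx fxoo hlow fup.
have fx0 : 0 <= f x by rewrite -hfx.
have fxfin : f x \is a fin_num by rewrite ge0_fin_numE.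
apply: ge0_cvge0 => [n|e e0]; first by rewrite mule_ge0// resolvent_ge0.
have e20 : (0 < e / 2)%R by rewrite divr_gt0.
have hlt : ((fine (f x) - e / 2)%R)%:E < h x.
  by rewrite hfx -{2}(fineK fxfin) lte_fin ltrBlDr ltrDl.
have flt : f x < ((fine (f x) + e / 2)%R)%:E.
  by rewrite -{1}(fineK fxfin) lte_fin ltrDl.
apply: filterS2 (hlow _ hlt) (fup _ flt) => n.
have -> : Rop n%:R f x = Rop n%:R g x + Rop n%:R h x.
  rewrite -resolventD//; congr (Rop _ _ _); apply/funext => z; exact/esym.
rewrite (_ : _ * (_ + _) = n%:R%:E * Rop n%:R g x + n%:R%:E * Rop n%:R h x); last first.
  by apply: ge0_muleDr; exact: resolvent_ge0.
have : 0 <= n%:R%:E * Rop n%:R g x by rewrite mule_ge0// resolvent_ge0.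
have : 0 <= n%:R%:E * Rop n%:R h x by rewrite mule_ge0// resolvent_ge0.
case: (n%:R%:E * Rop n%:R g x) => [v| |]//; case: (n%:R%:E * Rop n%:R h x) => [u| |]//.
rewrite -EFinD !lte_fin !lee_fin => _ _ h1 h2; lra.
Qed.

Lemma not_exceeded_potential (a : {finite_measure set T -> \bar R}) l x :
  (0 < l)%R -> not_exceeded (U l a) x.
Proof.
move=> l0 c Uc.
have U0 : 0 <= U l a x by exact: resolvent_potential_ge0.
have Ufin : U l a x \is a fin_num by rewrite ge0_fin_numE// (lt_trans Uc) ?ltry.
move: Uc; rewrite -(fineK Ufin); set u := fine _; rewrite lte_fin => uc.
have u0 : (0 <= u)%R by rewrite fine_ge0.
(* n R_n U_l <= n / (n - l) U_l, and n / (n - l) tends to 1 *)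
pose M := Num.truncn ((c * l) / (c - u) + l).
exists M.+1 => // n /= Mn.
have cu : (0 < c - u)%R by rewrite subr_gt0.
have c0 : (0 < c)%R by exact: le_lt_trans uc.
have nM : (c * l / (c - u) + l < n%:R)%R.
  by rewrite (lt_le_trans (truncnS_gt _))// ler_nat.
have ln : (l < n%:R)%R.
  by rewrite (le_lt_trans _ nM)// lerDr divr_ge0 ?mulr_ge0// ltW.
have nl0 : (0 < n%:R - l)%R by rewrite subr_gt0.
have := @resolvent_supermedian a l n%:R x l0 ln.
have : 0 <= Rop n%:R (U l a) x by apply: resolvent_ge0 => z; exact: resolvent_potential_ge0.
rewrite -(fineK Ufin) -/u; case: (Rop n%:R (U l a) x) => [v| |]//; last first.
  by rewrite gt0_muley// leye_eq.
rewrite -!EFinM !lee_fin => v0 nv.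
have h1 : (c * l < (n%:R - l) * (c - u))%R by rewrite -ltr_pdivrMr// ltrBrDr.
rewrite -(ler_pM2l nl0) mulrCA.
apply: (@le_trans _ _ (n%:R * u)%R); first by rewrite ler_wpM2l.
have h2 : (0 <= l * (c - u))%R by rewrite mulr_ge0// ltW.
lra.
Qed.

(** The domination principle: the positive part of U l a - U l b is submedian,
because U l b is supermedian, and a does not see it. *)
Lemma potential_domination (a b : {finite_measure set T -> \bar R}) l :
  (forall l, (0 < l)%R -> \int[a]_x U l a x < +oo) -> (0 < l)%R ->
  (forall x, approached_from_below (fun z => mine (U l a z) (U l b z)) x) ->
  {ae a, forall x, U l a x <= U l b x} -> {ae m, forall x, U l a x <= U l b x}.
Proof.
move=> a_energy l0 low ab.
pose f x := maxe (U l a x - U l b x) 0.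
have mUa : measurable_fun setT (U l a) by exact: measurable_resolvent_potential.
have mUb : measurable_fun setT (U l b) by exact: measurable_resolvent_potential.
have Ua0 n x : 0 <= U n a x by exact: resolvent_potential_ge0.
have Ub0 n x : 0 <= U n b x by exact: resolvent_potential_ge0.
have mf : measurable_fun setT f.
  by apply: measurable_maxe => //; exact: emeasurable_funB.
have f0 x : 0 <= f x by rewrite le_max lexx orbT.
have mh : measurable_fun setT (fun z => mine (U l a z) (U l b z)).
  exact: measurable_mine.
have h0 x : 0 <= mine (U l a x) (U l b x) by rewrite le_min Ua0 Ub0.
have fh x : f x + mine (U l a x) (U l b x) = U l a x.
  exact: maxe_subDmine.
have fUb x : U l a x <= f x + U l b x.
  rewrite -{1}(fh x) leeD2l// ge_min lexx orbT//.
have key : {ae m, forall x, f x = 0}.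
  apply: (@domination a a_energy l 1) => //.
  - by move=> x; rewrite mul1e -(fh x) leeDl.
  - move=> n x ln; rewrite mul1e.
    have nl0 : (0 <= (n - l)%:E) by rewrite lee_fin subr_ge0 ltW.
    have Ub_fin : f x != 0 -> U l b x \is a fin_num.
      rewrite ge0_fin_numE// => fx; rewrite ltey; apply: contra fx => /eqP Ubx.
      by rewrite /f Ubx addeNy max_r ?leNye.
    have [->|fx] := eqVneq (f x) 0.
      by rewrite adde_ge0// mule_ge0// resolvent_ge0.
    move/Ub_fin: (fx) => Ubx.
    have step : U l a x <= (n - l)%:E * Rop n f x + U l b x + U n a x.
      rewrite (@resolvent_potential_eq a l n x)// addeC leeD2r//.
      apply: (@le_trans _ _ ((n - l)%:E * Rop n (fun z => f z + U l b z) x)).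
        by apply: lee_wpmul2l => //; apply: le_resolvent => //; exact: emeasurable_funD.
      rewrite resolventD// ge0_muleDr ?resolvent_ge0// leeD2l//.
      exact: resolvent_supermedian.
    rewrite addeAC in step.
    have -> : f x = U l a x - U l b x.
      by move: fx; rewrite /f; case: (leP _ 0) => //; rewrite eqxx.
    by rewrite leeBlDr.
  - have : {ae a, forall x, U l a x < +oo}.
      have := @integrable_ae _ _ _ a setT measurableT (U l a).
      case.
        apply/integrableP; split => //; under eq_integral do rewrite gee0_abs//.
        exact: a_energy.
      move=> N [mN aN sub]; exists N; split => // x /= ux; apply: sub => /= /(_ I).
      by rewrite ge0_fin_numE.
    apply: filterS2 ab => x Uab Ufin.
    apply: (@scaled_resolvent_cvg0 (U l a) f (fun z => mine (U l a z) (U l b z))) => //.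
      by rewrite min_l.
    exact: not_exceeded_potential.
apply: filterS key => x fx; have := fUb x; rewrite fx add0e; exact.
Qed.

Section logarithmic_domination.
Variables (a : {finite_measure set T -> \bar R}) (k : R).
Variables (u1 u2 : T -> \bar R) (W : R -> T -> \bar R) (A : T -> R) (B : R -> T -> R).
Hypothesis k0 : (0 <= k)%R.
Hypothesis u10 : forall x, 0 <= u1 x.
Hypothesis u20 : forall x, 0 <= u2 x.
Hypothesis mu1 : measurable_fun setT u1.
Hypothesis mu2 : measurable_fun setT u2.
Hypothesis W0 : forall l x, 0 <= W l x.
Hypothesis u1E : forall l x, (0 < l)%R ->
  l%:E * Rop l u1 x + W l x + (A x)%:E = u1 x + (B l x)%:E.
Hypothesis u2E : forall l x, (0 < l)%R ->
  l%:E * Rop l u2 x + k%:E * U l a x + (A x)%:E = u2 x + (B l x)%:E.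

Let d1 x := maxe (u2 x - u1 x) 0.

Let d10 x : 0 <= d1 x. Proof. by rewrite le_max lexx orbT. Qed.

Let md1 : measurable_fun setT d1.
Proof. by apply: measurable_maxe => //; exact: emeasurable_funB. Qed.

Let d1_min x : d1 x + mine (u2 x) (u1 x) = u2 x.
Proof. exact: maxe_subDmine. Qed.

Let d1_le x : d1 x <= u2 x.
Proof. by rewrite -[leRHS]d1_min leeDl// le_min u10 u20. Qed.

Let Ua0 n x : 0 <= U n a x. Proof. exact: resolvent_potential_ge0. Qed.

Let d1_fin x : d1 x != 0 -> u1 x \is a fin_num /\ d1 x = u2 x - u1 x.
Proof.
move=> dx; have dE : d1 x = u2 x - u1 x.
  by move: dx; rewrite /d1; case: (leP _ 0) => //; rewrite eqxx.
split=> //; rewrite ge0_fin_numE// ltey; apply: contra dx => /eqP u1x.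
by rewrite /d1 u1x addeNy max_r ?leNye.
Qed.

(** The terms A and B are common to u1 and u2 and cancel. *)
Let d1_submedian l x : (0 < l)%R -> d1 x <= l%:E * Rop l d1 x + k%:E * U l a x.
Proof.
move=> l0; have l00 : 0 <= l%:E by rewrite lee_fin ltW.
have rhs0 : 0 <= l%:E * Rop l d1 x + k%:E * U l a x.
  by rewrite adde_ge0// mule_ge0// resolvent_ge0.
have [->//|/d1_fin[u1fin ->]] := eqVneq (d1 x) 0.
rewrite leeBlDr//.
have Ru2 : l%:E * Rop l u2 x <= l%:E * Rop l d1 x + l%:E * Rop l u1 x.
  rewrite -(ge0_muleDr l%:E (resolvent_ge0 l x d10) (resolvent_ge0 l x u10)).
  rewrite -resolventD// lee_wpmul2l// le_resolvent//.
    exact: emeasurable_funD.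
  by move=> z; rewrite -[leLHS]d1_min leeD2l// ge_min lexx orbT.
have Ru1 : l%:E * Rop l u1 x + (A x)%:E <= u1 x + (B l x)%:E.
  by rewrite -u1E// addeAC leeDl.
rewrite -(@leeD2rE _ (B l x)%:E)// -u2E//.
apply: (@le_trans _ _ (l%:E * Rop l d1 x + l%:E * Rop l u1 x + k%:E * U l a x + (A x)%:E)).
  by rewrite leeD2r// leeD2r.
by rewrite -[leLHS]addeA addeACA -[leRHS]addeA leeD2l.
Qed.

Hypothesis a_energy : forall l, (0 < l)%R -> \int[a]_x U l a x < +oo.
Hypothesis d1_lim : {ae a, forall x, (fun n => n%:R%:E * Rop n%:R d1 x) @ \oo --> 0}.

(** The positive part of d1 - l R_l d1 is submedian, dominated by a potential of a, and
invisible to a because d1 is. *)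
Let d1_subharmonic l : (0 < l)%R -> {ae m, forall x, d1 x <= l%:E * Rop l d1 x}.
Proof.
move=> l0; have l00 : 0 <= l%:E by rewrite lee_fin ltW.
pose f x := maxe (d1 x - l%:E * Rop l d1 x) 0.
have mRd n : measurable_fun setT (Rop n d1) by exact: measurable_resolvent.
have Rd0 n x : 0 <= Rop n d1 x by exact: resolvent_ge0.
have lRd0 x : 0 <= l%:E * Rop l d1 x by rewrite mule_ge0.
have mlRd : measurable_fun setT (fun x => l%:E * Rop l d1 x) by exact: emeasurable_funM.
have f0 x : 0 <= f x by rewrite le_max lexx orbT.
have mf : measurable_fun setT f.
  by apply: measurable_maxe => //; apply: emeasurable_funB.
have fd x : f x <= d1 x.
  rewrite -[leRHS](@maxe_subDmine _ (d1 x) (l%:E * Rop l d1 x))// leeDl//.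
  by rewrite le_min d10 lRd0.
have df x : d1 x <= f x + l%:E * Rop l d1 x.
  rewrite -[leLHS](@maxe_subDmine _ (d1 x) (l%:E * Rop l d1 x))// leeD2l//.
  by rewrite ge_min lexx orbT.
have ffin x : f x != 0 -> l%:E * Rop l d1 x \is a fin_num /\ f x = d1 x - l%:E * Rop l d1 x.
  move=> fx; have fE : f x = d1 x - l%:E * Rop l d1 x.
    by move: fx; rewrite /f; case: (leP _ 0) => //; rewrite eqxx.
  split=> //; rewrite ge0_fin_numE// ltey; apply: contra fx => /eqP e.
  by rewrite /f e addeNy max_r ?leNye.
have key : {ae m, forall x, f x = 0}.
  apply: (@domination a a_energy l k) => //.
  - move=> x; have [->|/ffin[lfin ->]] := eqVneq (f x) 0; first by rewrite mule_ge0.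
    by rewrite leeBlDr// addeC; exact: d1_submedian.
  - move=> n x ln; have nl0 : (0 <= (n - l)%:E) by rewrite lee_fin subr_ge0 ltW.
    have n0 : (0 < n)%R by exact: lt_trans ln.
    have [->|/ffin[lfin ->]] := eqVneq (f x) 0.
      by rewrite adde_ge0// mule_ge0// resolvent_ge0.
    rewrite leeBlDr//; apply: (le_trans (d1_submedian x n0)).
    rewrite [leRHS]addeAC leeD2r//.
    have -> : n%:E * Rop n d1 x = (n - l)%:E * Rop n d1 x + l%:E * Rop n d1 x.
      by rewrite -ge0_muleDl// -EFinD subrK.
    have -> : l%:E * Rop l d1 x =
        l%:E * Rop n d1 x + (n - l)%:E * Rop n (fun z => l%:E * Rop l d1 z) x.
      have p1 : 0 <= (n - l)%:E * Rop n (Rop l d1) x by rewrite mule_ge0// resolvent_ge0.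
      rewrite (@resolvent_eq l n d1 x)// (ge0_muleDr _ (Rd0 n x) p1).
      by rewrite muleCA resolventZ// ltW.
    rewrite [leRHS]addeCA [leLHS]addeC leeD2l//.
    have p1 : 0 <= Rop n f x by exact: resolvent_ge0.
    have p2 : 0 <= Rop n (fun z => l%:E * Rop l d1 z) x by exact: resolvent_ge0.
    rewrite -(ge0_muleDr _ p1 p2) -resolventD//.
    by rewrite lee_wpmul2l// le_resolvent//; exact: emeasurable_funD.
  - apply: filterS d1_lim => x dx.
    apply: (squeeze_cvge _ (cvg_cst 0) dx); apply: nearW => n.
    rewrite mule_ge0 ?resolvent_ge0//= lee_wpmul2l// le_resolvent//.
apply: filterS key => x fx; have := df x; rewrite fx add0e; exact.
Qed.

Hypothesis r_recurrent : forall x y, (fun n => r n.+1%:R^-1 x y) @ \oo --> +oo.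
Hypothesis a_neq0 : a setT != 0.
Hypothesis u2_bounded : {ae a, forall x, exists C : R,
  forall n, (n.+1%:R^-1)%:E * Rop n.+1%:R^-1 u2 x <= C%:E}.

Let ae_nonempty (P : T -> Prop) : {ae a, forall x, P x} -> exists x, P x.
Proof.
move=> [N [mN aN sub]]; apply: contrapT => nP; move/eqP: a_neq0; apply.
apply/eqP; rewrite eq_le measure_ge0 andbT -aN le_measure ?inE// => x _.
by apply: sub => /= Px; apply: nP; exists x.
Qed.

(** Let q be the excess of l R_l d1 over d1. Its potentials of small rates are bounded,
because the averages of u2 are, while the kernels increase to +oo by recurrence: q
vanishes. *)
Let d1_harmonic l : (0 < l)%R -> {ae m, forall x, d1 x = l%:E * Rop l d1 x}.
Proof.
move=> l0; have l00 : 0 <= l%:E by rewrite lee_fin ltW.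
pose q x := maxe (l%:E * Rop l d1 x - d1 x) 0.
have mRd n : measurable_fun setT (Rop n d1) by exact: measurable_resolvent.
have Rd0 n x : 0 <= Rop n d1 x by exact: resolvent_ge0.
have lRd0 x : 0 <= l%:E * Rop l d1 x by rewrite mule_ge0.
have mlRd : measurable_fun setT (fun x => l%:E * Rop l d1 x) by exact: emeasurable_funM.
have q0 x : 0 <= q x by rewrite le_max lexx orbT.
have mq : measurable_fun setT q.
  by apply: measurable_maxe => //; apply: emeasurable_funB.
have qd : {ae m, forall x, q x + d1 x = l%:E * Rop l d1 x}.
  apply: filterS (d1_subharmonic l0) => x dx.
  by rewrite -[RHS](@maxe_subDmine _ _ (d1 x))// min_r.
have [x0 [C uC]] := ae_nonempty u2_bounded.
(* for a small rate e, R_e q is controlled by e R_e u2, which stays bounded *)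
have RqC n : (n.+1%:R^-1 < l / 2)%R -> Rop n.+1%:R^-1 q x0 <= (2 * C / l)%:E.
  set e := (n.+1%:R^-1)%R => el.
  have e0 : (0 < e)%R by rewrite invr_gt0.
  have el' : (e < l)%R by lra.
  have le0 : 0 <= (l - e)%:E by rewrite lee_fin subr_ge0 ltW.
  have dC : e%:E * Rop e d1 x0 <= C%:E.
    by apply: le_trans (uC n); rewrite lee_wpmul2l ?lee_fin ?(ltW e0)// le_resolvent.
  have Rdfin : Rop e d1 x0 \is a fin_num.
    rewrite ge0_fin_numE// ltey; apply/eqP => Re.
    by move: dC; rewrite Re gt0_muley// leye_eq.
  have eq1 : Rop e q x0 + Rop e d1 x0 <= l%:E * Rop e (Rop l d1) x0.
    rewrite -resolventD// -resolventZ//; apply: ae_le_resolvent => //.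
    - by move=> x; rewrite adde_ge0.
    - exact: emeasurable_funD.
    - by apply: filterS qd => x ->.
  have eq2 : (l - e)%:E * Rop e (Rop l d1) x0 <= Rop e d1 x0.
    by rewrite (@resolventC e l d1 x0)// leeDr.
  have : (l - e)%:E * (Rop e q x0 + Rop e d1 x0) <= l%:E * Rop e d1 x0.
    apply: (@le_trans _ _ ((l - e)%:E * (l%:E * Rop e (Rop l d1) x0))).
      exact: lee_wpmul2l.
    by rewrite muleCA lee_wpmul2l.
  move: dC; have : 0 <= Rop e q x0 by exact: resolvent_ge0.
  rewrite -(fineK Rdfin); set v := fine _.
  case: (Rop e q x0) => [w| |]//; last first.
    by rewrite addye// gt0_muley ?lte_fin ?subr_gt0// leye_eq.
  rewrite -EFinD -!EFinM !lee_fin => w0 ev h.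
  rewrite ler_pdivlMr//.
  have : (0 <= (l / 2 - e) * w)%R by rewrite mulr_ge0// subr_ge0 ltW.
  lra.
have [N Nl] : exists N : nat, forall n, (N <= n)%N -> (n.+1%:R^-1 < l / 2)%R.
  exists (Num.truncn (2 / l)) => n Nn.
  rewrite -[ltRHS]invrK ltf_pV2 ?posrE ?invr_gt0 ?divr_gt0// invf_div.
  by rewrite (lt_le_trans (truncnS_gt _))// ler_nat.
pose h n z := r (n + N).+1%:R^-1 x0 z * q z.
have mh n : measurable_fun setT (h n).
  by apply: emeasurable_funM => //; exact: r_meas1.
have h0 n z : 0 <= h n z by rewrite mule_ge0.
have ndh z : {homo h ^~ z : n p / (n <= p)%N >-> n <= p}.
  move=> n p np; apply: lee_wpmul2r => //; apply: le_r; first by rewrite invr_gt0.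
  by rewrite lef_pV2 ?posrE// ler_nat ltnS leq_add2r.
have limh z : h ^~ z @ \oo --> +oo * q z.
  have [qz|qz] := eqVneq (q z) 0.
    rewrite qz mule0 (_ : h ^~ z = cst 0); first exact: cvg_cst.
    by apply/funext => n; rewrite /h qz mule0.
  apply: (@cvgeM _ _ _ _ (fun n => r (n + N).+1%:R^-1 x0 z) (cst (q z))).
  - by rewrite mule_def_infty_neq0.
  - exact: (cvg_comp (addn^~ N) (fun n : nat => r n.+1%:R^-1 x0 z) (cvg_addnr N) (@r_recurrent x0 z)).
  - exact: cvg_cst.
have int_oo : \int[m]_z (+oo * q z) < +oo.
  apply: (@le_lt_trans _ _ (2 * C / l)%:E); last exact: ltry.
  rewrite (_ : \int[m]_z (+oo * q z) = \int[m]_z limn (h ^~ z)); last first.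
    by apply: eq_integral => z _; exact/esym/(cvg_lim _ (limh z)).
  apply: (cvge_to_le (cvg_monotone_convergence measurableT mh
    (fun n z _ => h0 n z) (fun z _ => @ndh z))).
  apply: nearW => n.
  by apply: RqC; apply: Nl; exact: leq_addl.
have moo : measurable_fun setT (fun z => +oo * q z) by exact: emeasurable_funM.
have : {ae m, forall z, setT z -> +oo * q z \is a fin_num}.
  apply: integrable_ae => //; apply/integrableP; split=> //.
  by under eq_integral do rewrite gee0_abs ?mule_ge0//.
apply: filterS2 qd => z qdz /(_ I) fz; rewrite -qdz.
have := q0 z; rewrite le_eqVlt => /predU1P[<-|qz]; first by rewrite add0e.
by move: fz; rewrite gt0_mulye.
Qed.

Let resolvent_harmonic l n x : (0 < l)%R -> (l < n)%R ->
  n%:E * Rop n d1 x = l%:E * Rop l d1 x.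
Proof.
move=> l0 ln; have nl0 : 0 <= (n - l)%:E by rewrite lee_fin subr_ge0 ltW.
have n0 : (0 < n)%R by exact: lt_trans ln.
have l00 : 0 <= l%:E by rewrite lee_fin ltW.
have mRd k' : measurable_fun setT (Rop k' d1) by exact: measurable_resolvent.
have Rd0 k' z : 0 <= Rop k' d1 z by exact: resolvent_ge0.
have lRd0 z : 0 <= l%:E * Rop l d1 z by rewrite mule_ge0.
have mlRd : measurable_fun setT (fun x => l%:E * Rop l d1 x) by exact: emeasurable_funM.
have E : Rop n d1 x = Rop n (fun z => l%:E * Rop l d1 z) x.
  apply/eqP; rewrite eq_le !ae_le_resolvent//.
  - by apply: filterS (d1_harmonic l0) => z <-.
  - by apply: filterS (d1_harmonic l0) => z <-.
have p1 : 0 <= (n - l)%:E * Rop n (Rop l d1) x by rewrite mule_ge0// resolvent_ge0.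
rewrite (@resolvent_eq l n d1 x)// (ge0_muleDr _ (Rd0 n x) p1).
rewrite muleCA -(resolventZ n x (ltW l0) (Rd0 l) (mRd l)).
by rewrite -E -ge0_muleDl// -EFinD addrC subrK.
Qed.

Hypothesis r_gt0 : forall l x y, (0 < l)%R -> 0 < r l x y.

(** By recurrence d1 is harmonic for every rate; as its averages tend to 0 at some
point, they vanish there, and d1 with them. *)
Lemma logarithmic_domination : {ae m, forall x, u2 x <= u1 x}.
Proof.
have [x0 dx0] := ae_nonempty d1_lim.
have Rd0 n x : 0 <= Rop n d1 x by exact: resolvent_ge0.
have R10 : Rop 1%R d1 x0 = 0.
  apply/eqP; rewrite eq_le Rd0 andbT; apply: (cvge_to_ge dx0).
  exists 2%N => // n /= n2; rewrite (@resolvent_harmonic 1%R) ?mul1e//.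
  by rewrite ltr1n.
have : \int[m]_z `|r 1%R x0 z * d1 z| = 0.
  by under eq_integral do rewrite gee0_abs ?mule_ge0//.
have mrd : measurable_fun setT (fun z => r 1%R x0 z * d1 z).
  by apply: emeasurable_funM => //; exact: r_meas1.
move/ae_eq_integral_abs => /(_ measurableT mrd).
apply: filterS => x /(_ I) /eqP; rewrite mule_eq0 gt_eqF ?r_gt0//= => /eqP dx.
rewrite -(d1_min x) dx add0e ge_min lexx orbT//.
Qed.

End logarithmic_domination.

End Resolvent.

(** * Gaussian kernels on the line and heat kernel of the plane *)

Section lebesgue_line.
Context {R : realType}.

(** Lebesgue measure lives on a copy of the line whose display is not that of the
factors of the plane; leb1 is its image under this identity. *)
Definition line_copy (x : measurableTypeR R) : R := x.

Lemma measurable_line_copy : measurable_fun setT line_copy.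
Proof. by move=> _ B mB; rewrite setTI. Qed.

Definition leb1 : set R -> \bar R := @lebesgue_measure R.

Let leb10 : leb1 set0 = 0. Proof. exact: measure0. Qed.
Let leb1_ge0 A : 0 <= leb1 A. Proof. exact: measure_ge0. Qed.
Let leb1_sigma_additive : semi_sigma_additive leb1.
Proof. exact: (@measure_semi_sigma_additive _ _ _ (@lebesgue_measure R)). Qed.

HB.instance Definition _ :=
  isMeasure.Build _ R R leb1 leb10 leb1_ge0 leb1_sigma_additive.

Let leb1_sigma_finite : sigma_finite setT leb1.
Proof. exact: (@sigma_finiteT _ _ _ (@lebesgue_measure R)). Qed.

HB.instance Definition _ :=
  @Measure_isSigmaFinite.Build _ _ _ leb1 leb1_sigma_finite.

Lemma ge0_integral_leb1 (D : set R) (f : R -> \bar R) :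
  measurable D -> measurable_fun D f -> (forall x, D x -> 0 <= f x) ->
  \int[leb1]_(x in D) f x = \int[lebesgue_measure]_(x in D) f x.
Proof.
move=> mD mf f0.
have := @ge0_integral_pushforward _ _ _ _ R _ measurable_line_copy (@lebesgue_measure R) D f mD mf.
by apply => x; rewrite inE; exact: f0.
Qed.

Let leb1s : {sigma_finite_measure set R -> \bar R} := leb1.

Definition leb2 : set (plane R) -> \bar R := leb1s \x leb1s.
HB.instance Definition _ := Measure.on leb2.

Let leb2_sigma_finite : sigma_finite setT leb2.
Proof.
have /sigma_finiteP[F [TF ndF Foo]] := sigma_finiteT leb1s.
exists (fun n => F n `*` F n).
  rewrite -setXTT TF predeqE => -[x y]; split.
    move=> [/= [n _ Fnx] [k _ Fky]]; exists (maxn n k) => //; split.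
    - by move: x Fnx; exact/subsetPset/ndF/leq_maxl.
    - by move: y Fky; exact/subsetPset/ndF/leq_maxr.
  by move=> [n _ []/= ? ?]; split; exists n.
move=> k; have [mF Fk] := Foo k; split; first exact: measurableX.
by rewrite /leb2 product_measure1E// lte_mul_pinfty// ge0_fin_numE.
Qed.

HB.instance Definition _ :=
  @Measure_isSigmaFinite.Build _ _ _ leb2 leb2_sigma_finite.

Lemma ge0_integral_leb2 (f : R -> R -> \bar R) :
  measurable_fun setT (fun p : plane R => f p.1 p.2) -> (forall x y, 0 <= f x y) ->
  \int[leb2]_p f p.1 p.2 = \int[leb1]_x \int[leb1]_y f x y.
Proof. exact: (@tonelli_prod _ _ _ _ _ leb1s leb1s). Qed.

End lebesgue_line.

Lemma measurable_invr {R : realType} : measurable_fun setT (@GRing.inv R).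
Proof.
rewrite (_ : @GRing.inv R = fun x => if x < 0 then - ((- x) `^ (-1)) else x `^ (-1))%R.
  apply: measurable_fun_ifT.
  - exact: measurable_fun_ltr.
  - apply: measurableT_comp => //.
    exact: measurableT_comp (measurable_powR (-1)) _.
  - exact: measurable_powR.
apply/funext => x; case: ltP => x0; last by rewrite powR_inv1.
by rewrite powR_inv1 ?oppr_ge0 ?ltW// invrN opprK.
Qed.

Section gaussian.
Context {R : realType}.
Local Open Scope ring_scope.
Implicit Types s t u x y z : R.

(** The centred normal density of variance 2 s, which is the heat kernel of the line. *)
Definition gaussian s u : R := (Num.sqrt (4 * pi * s))^-1 * expR (- (u ^+ 2 / (4 * s))).

Lemma gaussian_normal_pdf s x z : 0 < s ->
  gaussian s (x - z) = normal_pdf x (Num.sqrt (2 * s)) z.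
Proof.
move=> s0; have s20 : 0 < 2 * s by rewrite mulr_gt0.
have sq : Num.sqrt (2 * s) ^+ 2 = 2 * s by rewrite sqr_sqrtr// ltW.
rewrite normal_pdfE; last by rewrite gt_eqF// sqrtr_gt0.
rewrite /normal_peak /normal_fun sq /gaussian; congr (_^-1 * expR _).
- by congr Num.sqrt; rewrite -mulr_natr; ring.
- by rewrite -mulr_natr; field; rewrite gt_eqF.
Qed.

Lemma gaussian_ge0 s u : 0 <= gaussian s u.
Proof. by rewrite mulr_ge0 ?expR_ge0// invr_ge0 sqrtr_ge0. Qed.

Lemma measurable_gaussian_comp d (T : measurableType d) s (f : T -> R) :
  measurable_fun setT f -> measurable_fun setT (fun p => gaussian s (f p)).
Proof.
move=> mf; apply: measurable_funM => //; apply: measurableT_comp => //.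
by apply: measurableT_comp => //; apply: measurable_funM => //; exact: measurable_funX.
Qed.

Lemma integral_normal_pdf_leb1 m s : s != 0 ->
  (\int[leb1]_z (normal_pdf m s z)%:E = 1)%E.
Proof.
move=> s0; rewrite ge0_integral_leb1 ?integral_normal_pdf//.
  apply/measurable_EFinP. exact: measurable_normal_pdf.
by move=> z _; rewrite lee_fin normal_pdf_ge0.
Qed.

Lemma integral_gaussian s x : 0 < s -> (\int[leb1]_z (gaussian s (x - z))%:E = 1)%E.
Proof.
move=> s0; under eq_integral do rewrite gaussian_normal_pdf//.
by rewrite integral_normal_pdf_leb1// gt_eqF// sqrtr_gt0 mulr_gt0.
Qed.

(** Completing the square. *)
Lemma gaussianM s t x y z : 0 < s -> 0 < t ->
  gaussian s (x - z) * gaussian t (z - y) =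
  gaussian (s + t) (x - y) *
  normal_pdf ((t * x + s * y) / (s + t)) (Num.sqrt (2 * (s * t / (s + t)))) z.
Proof.
move=> s0 t0; have st0 : 0 < s + t by rewrite addr_gt0.
have w0 : 0 < s * t / (s + t) by rewrite divr_gt0// mulr_gt0.
rewrite -gaussian_normal_pdf// /gaussian.
rewrite mulrACA [RHS]mulrACA -!expRD -!invfM -!sqrtrM; last 2 first.
- by rewrite !mulr_ge0 ?pi_ge0// ltW.
- by rewrite !mulr_ge0 ?pi_ge0// ltW.
congr ((Num.sqrt _)^-1 * expR _).
- by field; rewrite gt_eqF.
- by field; rewrite !gt_eqF.
Qed.

Lemma gaussian_convolution s t x y : 0 < s -> 0 < t ->
  (\int[leb1]_z (gaussian s (x - z) * gaussian t (z - y))%:E =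
   (gaussian (s + t) (x - y))%:E)%E.
Proof.
move=> s0 t0; under eq_integral do rewrite gaussianM// EFinM.
rewrite ge0_integralZl_EFin//.
- by rewrite integral_normal_pdf_leb1 ?mule1// gt_eqF// sqrtr_gt0 mulr_gt0// divr_gt0 ?mulr_gt0 ?addr_gt0.
- by move=> z _; rewrite lee_fin normal_pdf_ge0.
- apply/measurable_EFinP; exact: measurable_normal_pdf.
- exact: gaussian_ge0.
Qed.

End gaussian.

Section heat_kernel.
Context {R : realType}.
Implicit Types (s t : R) (x y z : plane R).

Definition sqdist x y : R := (x.1 - y.1) ^+ 2 + (x.2 - y.2) ^+ 2.

Lemma sqdist_ge0 x y : (0 <= sqdist x y)%R.
Proof. by rewrite addr_ge0 ?sqr_ge0. Qed.

Lemma sqdistC x y : sqdist x y = sqdist y x.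
Proof. by rewrite /sqdist; ring. Qed.

Lemma sqdist_eq0 x y : (sqdist x y == 0%R) = (x == y).
Proof.
rewrite paddr_eq0 ?sqr_ge0// !sqrf_eq0 !subr_eq0.
by case: x y => [x1 x2] [y1 y2].
Qed.

Lemma measurable_sqdist d (T : measurableType d) (x y : T -> plane R) :
  measurable_fun setT x -> measurable_fun setT y ->
  measurable_fun setT (fun p => sqdist (x p) (y p)).
Proof.
move=> mx my; apply: measurable_funD; apply: measurable_funX; apply: measurable_funB;
  by [exact: measurableT_comp measurable_fst mx | exact: measurableT_comp measurable_fst my
     | exact: measurableT_comp measurable_snd mx | exact: measurableT_comp measurable_snd my].
Qed.

(** The heat kernel; it vanishes for negative times so that time integrals can
be taken over the whole line. *)
Definition heat s x y : R :=
  if (0 < s)%R then ((4 * pi * s)^-1 * expR (- (sqdist x y / (4 * s))))%R else 0%R.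

Lemma heat_ge0 s x y : (0 <= heat s x y)%R.
Proof.
rewrite /heat; case: ifP => // s0.
by rewrite mulr_ge0 ?expR_ge0// invr_ge0 !mulr_ge0 ?pi_ge0// ltW.
Qed.

Lemma heatC s x y : heat s x y = heat s y x.
Proof. by rewrite /heat sqdistC. Qed.

Lemma heat_gaussian s x y : (0 < s)%R ->
  heat s x y = (gaussian s (x.1 - y.1) * gaussian s (x.2 - y.2))%R.
Proof.
move=> s0; rewrite /heat s0 /gaussian mulrACA -expRD -invfM -sqrtrM; last first.
  by rewrite !mulr_ge0 ?pi_ge0// ltW.
rewrite -expr2 sqrtr_sqr ger0_norm; last by rewrite !mulr_ge0 ?pi_ge0// ltW.
by congr (_ * expR _)%R; rewrite /sqdist; field; rewrite gt_eqF.
Qed.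

Lemma measurable_heat d (T : measurableType d) (s : T -> R) (x y : T -> plane R) :
  measurable_fun setT s -> measurable_fun setT x -> measurable_fun setT y ->
  measurable_fun setT (fun p => heat (s p) (x p) (y p)).
Proof.
move=> ms mx my; rewrite /heat; apply: measurable_fun_ifT => //.
  exact: measurable_fun_ltr.
have ms4 : measurable_fun setT (fun p => (4 * s p)^-1)%R.
  apply: (measurableT_comp measurable_invr).
  exact: measurable_funM.
apply: measurable_funM.
  apply: (measurableT_comp measurable_invr).
  exact: measurable_funM.
apply: measurableT_comp => //; apply: measurableT_comp => //.
by apply: measurable_funM => //; exact: measurable_sqdist.
Qed.

Lemma integral_heat s x : (0 < s)%R -> \int[leb2]_y (heat s x y)%:E = 1.
Proof.
move=> s0; under eq_integral do rewrite heat_gaussian//.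
rewrite (@ge0_integral_leb2 _ (fun u v => (gaussian s (x.1 - u) * gaussian s (x.2 - v))%:E)).
- under eq_integral => u _.
    under eq_integral do rewrite EFinM.
    rewrite ge0_integralZl_EFin ?gaussian_ge0//.
    + rewrite integral_gaussian// mule1; over.
    + by move=> v _; rewrite lee_fin gaussian_ge0.
    + by apply/measurable_EFinP/measurable_gaussian_comp; exact: measurable_funB.
  by rewrite integral_gaussian.
- apply/measurable_EFinP; apply: measurable_funM; apply: measurable_gaussian_comp;
   exact: measurable_funB.
- by move=> u v; rewrite lee_fin mulr_ge0 ?gaussian_ge0.
Qed.

Lemma heat_semigroup s t x y : (0 < s)%R -> (0 < t)%R ->
  \int[leb2]_z (heat s x z * heat t z y)%:E = (heat (s + t) x y)%:E.
Proof.
move=> s0 t0; have st0 : (0 < s + t)%R by rewrite addr_gt0.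
pose h (i : R * R -> R) u := (gaussian s (i x - u) * gaussian t (u - i y))%R.
have hge0 i u : (0 <= h i u)%R by rewrite mulr_ge0 ?gaussian_ge0.
have mh i : measurable_fun setT (h i).
  by apply: measurable_funM; apply: measurable_gaussian_comp; exact: measurable_funB.
have int_h i : \int[leb1]_u (h i u)%:E = (gaussian (s + t) (i x - i y))%:E.
  exact: gaussian_convolution.
transitivity (\int[leb2]_z (h fst z.1 * h snd z.2)%:E).
  by apply: eq_integral => z _; rewrite !heat_gaussian// mulrACA.
rewrite (@ge0_integral_leb2 _ (fun u v => (h fst u * h snd v)%:E)).
- under eq_integral => u _.
    under eq_integral do rewrite EFinM.
    rewrite ge0_integralZl_EFin//.
    + rewrite int_h muleC; over.
    + by move=> v _; rewrite lee_fin.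
    + exact/measurable_EFinP.
  rewrite ge0_integralZl_EFin ?gaussian_ge0//.
  + by rewrite int_h heat_gaussian// -EFinM mulrC.
  + by move=> v _; rewrite lee_fin.
  + exact/measurable_EFinP.
- apply/measurable_EFinP; apply: measurable_funM.
    exact: measurableT_comp (mh fst) measurable_fst.
  exact: measurableT_comp (mh snd) measurable_snd.
- by move=> u v; rewrite lee_fin mulr_ge0.
Qed.

End heat_kernel.

(** * The resolvent kernel of the plane *)

Section line_integrals.
Context {R : realType}.
Implicit Types (f : R -> \bar R) (l s t u : R).

Lemma integral_leb1_translate f s : measurable_fun setT f -> (forall t, 0 <= f t) ->
  \int[leb1]_t f (t - s)%R = \int[leb1]_t f t.
Proof.
move=> mf f0; have msub : measurable_fun setT (fun t => t - s)%R by exact: measurable_funB.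
have pushE A : measurable A -> pushforward (@lebesgue_measure R)
    (fun t : measurableTypeR R => (t - s)%R : measurableTypeR R) A = lebesgue_measure A.
  move=> mA; apply/esym/lebesgue_measure_unique => //= _ [[a b]] _ <-.
  rewrite /pushforward/= (_ : _ @^-1` _ = `](a + s)%R, (b + s)%R]%classic); last first.
    by apply/seteqP; split => x /=; rewrite !in_itv/= ltrBrDr lerBlDr.
  rewrite !lebesgue_measure_itv/= !lte_fin ltrD2r.
  by case: ifPn => // _; rewrite -!EFinB; congr _%:E; ring.
rewrite [LHS]ge0_integral_leb1//; last exact: measurableT_comp.
pose sub (t : measurableTypeR R) : R := (t - s)%R.
have msub' : measurable_fun setT sub by exact: msub.
have := @ge0_integral_pushforward _ _ _ _ R sub msub' (@lebesgue_measure R) setT f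
  measurableT mf (fun t _ => f0 t).
rewrite preimage_setT => <-.
by apply: eq_measure_integral => A mA _; exact: pushE.
Qed.

Lemma integral_gt0E f : measurable_fun setT f -> (forall t, (0 < t)%R -> 0 <= f t) ->
  \int[leb1]_s (if (0 < s)%R then f s else 0) =
  \int[lebesgue_measure]_(s in `[0%R, +oo[) f s.
Proof.
move=> mf f0.
have m0 : measurable (`]0%R, +oo[ : set R) by exact: measurable_itv.
transitivity (\int[leb1]_(s in `]0%R, +oo[) f s).
  rewrite [RHS]integral_mkcond; apply: eq_integral => s _.
  by rewrite patchE mem_setE/= in_itv/= andbT.
rewrite ge0_integral_leb1//; last 2 first.
  exact: measurable_funTS.
  by move=> x /=; rewrite in_itv/= andbT => /f0.
rewrite integral_itv_obnd_cbnd//.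
exact: measurable_funTS.
Qed.

Lemma integral_exp l : (0 < l)%R ->
  \int[leb1]_s (if (0 < s)%R then expR (- (l * s)) else 0%R)%:E = (l^-1)%:E.
Proof.
move=> l0; have mexp : measurable_fun setT (fun s => expR (- (l * s))).
  by apply: measurableT_comp => //; apply: measurableT_comp => //; exact: measurable_funM.
under eq_integral do rewrite (fun_if EFin).
rewrite (integral_gt0E (f := fun s => (expR (- (l * s)))%:E)); last 2 first.
  exact/measurable_EFinP.
  by move=> t _; rewrite lee_fin expR_ge0.
have : l%:E * \int[lebesgue_measure]_(s in `[0%R, +oo[) (expR (- (l * s)))%:E = 1.
  rewrite -ge0_integralZl_EFin//; first last.
  - exact: ltW.
  - by apply/measurable_EFinP; apply: measurable_funTS.
  rewrite -(integral_exponential_pdf l0) integral_mkcond; apply: eq_integral => s _.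
  by rewrite /exponential_pdf !patchE mulNr; case: ifP.
have : 0 <= \int[lebesgue_measure]_(s in `[0%R, +oo[) (expR (- (l * s)))%:E.
  by apply: integral_ge0 => t _; rewrite lee_fin expR_ge0.
case: integral => [v| |]//; last by rewrite gt0_muley// lte_fin.
rewrite -EFinM => _ [lv]; congr _%:E.
by apply: (mulfI (lt0r_neq0 l0)); rewrite lv divff// gt_eqF.
Qed.

Lemma integral_exp_interval l u : (0 < l)%R -> (0 < u)%R ->
  l%:E * \int[leb1]_s (if (0 < s)%R && (s < u)%R then expR (l * s) else 0%R)%:E =
  (expR (l * u) - 1)%:E.
Proof.
move=> l0 u0; have mexp : measurable_fun setT (fun s => expR (l * s)).
  by apply: measurableT_comp => //; exact: measurable_funM.
have cexp : continuous (fun s : R^o => expR (l * s) : R^o).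
  move=> z; apply: continuous_comp; last exact: continuous_expR.
  by apply: continuousM => //; exact: cst_continuous.
have cF : continuous (fun s : R => l^-1 * expR (l * s))%R.
  move=> z; apply: cvgM; [exact: cvg_cst|exact: cexp].
rewrite (_ : \int[leb1]_s _ = \int[lebesgue_measure]_(s in `[0%R, u]) (expR (l * s))%:E); last first.
  transitivity (\int[leb1]_(s in `]0%R, u[) (expR (l * s))%:E).
    rewrite [RHS]integral_mkcond; apply: eq_integral => s _.
    by rewrite patchE mem_setE/= in_itv/=; case: ifP.
  rewrite ge0_integral_leb1//; last first.
    by apply/measurable_EFinP; exact: measurable_funTS.
  rewrite -(integral_itv_bndoo true false)//.
  by apply/measurable_EFinP; exact: measurable_funTS.
rewrite (@continuous_FTC2 _ _ (fun s => l^-1 * expR (l * s))%R)//.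
- by rewrite mulr0 expR0 -EFinB -EFinM; congr _%:E; field; rewrite gt_eqF.
- by apply: continuous_subspaceT.
- split.
  + by move=> z _; exact: ex_derive.
  + by apply/cvg_at_right_filter; exact: cF.
  + by apply/cvg_at_left_filter; exact: cF.
- move=> z _; rewrite derive1E.
  have : is_derive z 1%R (fun s : R => l^-1 * expR (l * s))%R (expR (l * z)).
    apply: is_derive_eq; rewrite /GRing.scale/=; field; rewrite gt_eqF//.
  by move=> h; rewrite derive_val.
Qed.
End line_integrals.

Section resolvent_kernel.
Context {R : realType}.
Implicit Types (l n s t u : R) (x y z : plane R).

(** The Laplace transform of the heat kernel, i.e. the kernel of the resolvent
of the Laplacian of the plane. *)
Definition green l x y : \bar R := \int[leb1]_s (expR (- (l * s)) * heat s x y)%:E.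

Lemma expheat_ge0 l s x y : 0 <= (expR (- (l * s)) * heat s x y)%:E.
Proof. by rewrite lee_fin mulr_ge0 ?expR_ge0// heat_ge0. Qed.
Local Hint Resolve expheat_ge0 : core.

Lemma measurable_expheat d (T : measurableType d) l (s : T -> R) (x y : T -> plane R) :
  measurable_fun setT s -> measurable_fun setT x -> measurable_fun setT y ->
  measurable_fun setT (fun p => (expR (- (l * s p)) * heat (s p) (x p) (y p))%:E).
Proof.
move=> ms mx my; apply/measurable_EFinP; apply: measurable_funM; last exact: measurable_heat.
by apply: measurableT_comp => //; apply: measurableT_comp => //; exact: measurable_funM.
Qed.

Lemma green_ge0 l x y : 0 <= green l x y.
Proof. exact: integral_ge0. Qed.

Lemma greenC l x y : green l x y = green l y x.
Proof. by apply: eq_integral => s _; rewrite heatC. Qed.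

Lemma measurable_green l : measurable_fun setT (fun p : plane R * plane R => green l p.1 p.2).
Proof.
apply: (measurable_integral1 (fun (p : plane R * plane R) s =>
  (expR (- (l * s)) * heat s p.1 p.2)%:E)) => //.
apply: (measurable_expheat l (s := snd) (x := fun p => p.1.1) (y := fun p => p.1.2)) => //.
- exact: measurableT_comp measurable_fst measurable_fst.
- exact: measurableT_comp measurable_snd measurable_fst.
Qed.

Lemma integral_green l x : (0 < l)%R -> \int[leb2]_y green l x y = (l^-1)%:E.
Proof.
move=> l0; rewrite (tonelli (fun y s => (expR (- (l * s)) * heat s x y)%:E))//; last first.
  exact: (measurable_expheat l (s := snd) (x := cst x) (y := fst)).
rewrite -integral_exp//; apply: eq_integral => s _.
under eq_integral do rewrite EFinM.
rewrite ge0_integralZl_EFin ?expR_ge0//; first last.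
- by apply/measurable_EFinP; exact: (measurable_heat (s := cst s) (x := cst x) (y := id)).
- by move=> y _; rewrite lee_fin heat_ge0.
case: ifPn => s0; first by rewrite integral_heat// mule1.
under eq_integral do rewrite /heat (negbTE s0).
by rewrite integral0 mule0.
Qed.

(** By the semigroup property, a double Laplace transform of the heat kernel at time
s + t. *)
Lemma green_composition l n x y :
  \int[leb2]_z (green l x z * green n z y) =
  \int[leb1]_s \int[leb1]_t (if (0 < s)%R && (0 < t)%R then
    expR (- (l * s)) * expR (- (n * t)) * heat (s + t) x y else 0)%R%:E.
Proof.
pose f s z := (expR (- (l * s)) * heat s x z)%:E.
pose g t z := (expR (- (n * t)) * heat t z y)%:E.
have f0 s z : 0 <= f s z by exact: expheat_ge0.
have g0 t z : 0 <= g t z by exact: expheat_ge0.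
have mf d (T : measurableType d) (s : T -> R) (z : T -> plane R) :
    measurable_fun setT s -> measurable_fun setT z ->
    measurable_fun setT (fun p => f (s p) (z p)).
  by move=> ms mz; exact: measurable_expheat.
have mg d (T : measurableType d) (s : T -> R) (z : T -> plane R) :
    measurable_fun setT s -> measurable_fun setT z ->
    measurable_fun setT (fun p => g (s p) (z p)).
  by move=> ms mz; exact: measurable_expheat.
have mgreen : measurable_fun setT (fun z => green n z y).
  exact: (measurableT_comp (measurable_green n) (pair2_measurable y)).
transitivity (\int[leb2]_z \int[leb1]_s (f s z * green n z y)).
  apply: eq_integral => z _; rewrite ge0_integralZr//; last exact: green_ge0.
  exact: (mf _ _ id (cst z)).
rewrite (tonelli (fun z s => f s z * green n z y)); first last.
- by move=> z s; rewrite mule_ge0// green_ge0.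
- apply: emeasurable_funM; first exact: (mf _ _ snd fst).
  exact: measurableT_comp mgreen measurable_fst.
apply: eq_integral => s _.
transitivity (\int[leb2]_z \int[leb1]_t (f s z * g t z)).
  apply: eq_integral => z _; rewrite ge0_integralZl//.
  exact: (mg _ _ id (cst z)).
rewrite (tonelli (fun z t => f s z * g t z)); first last.
- by move=> z t; rewrite mule_ge0.
- apply: emeasurable_funM; first exact: (mf _ _ (cst s) fst).
  exact: (mg _ _ snd fst).
apply: eq_integral => t _.
rewrite /f /g; case: ifPn => [/andP[s0 t0]|].
  under eq_integral do rewrite -EFinM mulrACA EFinM.
  rewrite ge0_integralZl_EFin.
  - by rewrite heat_semigroup// -EFinM.
  - exact: measurableT.
  - by move=> z _; rewrite lee_fin mulr_ge0// heat_ge0.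
  - apply/measurable_EFinP; apply: measurable_funM.
      exact: (measurable_heat (s := cst s) (x := cst x) (y := id)).
    exact: (measurable_heat (s := cst t) (x := id) (y := cst y)).
  - by rewrite mulr_ge0 ?expR_ge0.
rewrite negb_and => /orP[] /negbTE st0.
  by under eq_integral do rewrite {1}/heat st0 mulr0 mul0e; rewrite integral0.
by under eq_integral do rewrite (_ : heat t _ _ = 0%R) ?mulr0 ?mule0 ?/heat ?st0//; rewrite integral0.
Qed.

(** Integrating the composition over s at fixed total time u leaves the integral of
expR ((n - l) s) over [0, u], which is the difference of the two Laplace weights
divided by n - l. *)
Lemma green_resolvent l n x y : (0 < l)%R -> (l < n)%R ->
  green l x y = green n x y + (n - l)%:E * \int[leb2]_z (green l x z * green n z y).
Proof.
move=> l0 ln; have nl0 : (0 < n - l)%R by rewrite subr_gt0.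
pose H s t := (if (0 < s)%R && (0 < t)%R then
    expR (- (l * s)) * expR (- (n * t)) * heat (s + t) x y else 0)%R%:E.
have H0 s t : 0 <= H s t.
  by rewrite lee_fin; case: ifP => // _; rewrite !mulr_ge0 ?expR_ge0 ?heat_ge0.
have mH d (T : measurableType d) (s t : T -> R) :
    measurable_fun setT s -> measurable_fun setT t ->
    measurable_fun setT (fun p => H (s p) (t p)).
  move=> ms mt; apply/measurable_EFinP; apply: measurable_fun_ifT => //.
    by apply: measurable_and; exact: measurable_fun_ltr.
  apply: measurable_funM; last first.
    by apply: (measurable_heat (x := cst x) (y := cst y)) => //; exact: measurable_funD.
  by apply: measurable_funM; apply: measurableT_comp => //; apply: measurableT_comp => //;
    exact: measurable_funM.
(* substitute u = s + t, then integrate in s first *)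
have -> : \int[leb2]_z (green l x z * green n z y) = \int[leb1]_u \int[leb1]_s H s (u - s)%R.
  rewrite green_composition; transitivity (\int[leb1]_s \int[leb1]_u H s (u - s)%R).
    apply: eq_integral => s _; apply/esym.
    exact: (@integral_leb1_translate _ (H s) s (mH _ _ (cst s) id _ _) (H0 s)).
  have mHs : measurable_fun setT (fun p : R * R => H p.1 (p.2 - p.1)%R).
    by apply: mH; [exact: measurable_fst|exact: measurable_funB].
  exact: (tonelli (m1 := leb1) (m2 := leb1) (fun s u => H s (u - s)%R) mHs (fun s u => H0 s (u - s)%R)).
have HE u : (n - l)%:E * \int[leb1]_s H s (u - s)%R =
   (expR (- (n * u)) * heat u x y * (expR ((n - l) * u) - 1))%R%:E.
  have [u0|u0] := ltP 0%R u; last first.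
    rewrite (_ : heat u x y = 0%R) ?mulr0 ?mul0r; last by rewrite /heat ltNge u0.
    under eq_integral => s _.
      rewrite /H ifF; first by over.
      by apply/negbTE/negP => /andP[s0 us]; move: u0 s0 us; rewrite subr_gt0; lra.
    by rewrite integral0 mule0.
  transitivity ((n - l)%:E * \int[leb1]_s ((expR (- (n * u)) * heat u x y)%:E *
      (if (0 < s)%R && (s < u)%R then expR ((n - l) * s) else 0)%R%:E)).
    congr (_ * _); apply: eq_integral => s _; rewrite /H subr_gt0 -EFinM; congr _%:E.
    case: ifPn => _; last by rewrite mulr0.
    rewrite (_ : s + (u - s) = u)%R; last by ring.
    rewrite [RHS]mulrAC -!expRD; congr (expR _ * _)%R; ring.
  rewrite ge0_integralZl_EFin//.
  - by rewrite muleCA integral_exp_interval// -EFinM.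
  - by move=> s _; rewrite lee_fin; case: ifP => // _; exact: expR_ge0.
  - apply/measurable_EFinP; apply: measurable_fun_ifT => //.
      by apply: measurable_and; exact: measurable_fun_ltr.
    by apply: measurableT_comp => //; exact: measurable_funM.
  - by rewrite mulr_ge0 ?expR_ge0 ?heat_ge0.
have mHu : measurable_fun setT (fun u => \int[leb1]_s H s (u - s)%R).
  apply: (measurable_integral2 (fun s u => H s (u - s)%R)) => //.
  by apply: mH; [exact: measurable_fst|exact: measurable_funB].
have Hu0 u : 0 <= \int[leb1]_s H s (u - s)%R by exact: integral_ge0.
rewrite -ge0_integralZl_EFin ?(ltW nl0)// -ge0_integralD//; last 3 first.
- exact: (measurable_expheat n (s := id) (x := cst x) (y := cst y)).
- by move=> u _; rewrite mule_ge0// lee_fin ltW.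
- exact: emeasurable_funM.
apply: eq_integral => u _; rewrite HE -EFinD; congr _%:E.
rewrite mulrBr mulr1 addrCA subrr addr0 mulrAC -expRD; congr (expR _ * _)%R; ring.
Qed.

End resolvent_kernel.

Notation Rop := (resolvent (@leb2 _) (@green _)).

Section plane_resolvent.
Context {R : realType}.
Implicit Types (l k : R) (f g : plane R -> \bar R) (x : plane R).

Lemma Rop_ge0 l f x : (forall z, 0 <= f z) -> 0 <= Rop l f x.
Proof. by move=> f0; exact: (@resolvent_ge0 _ _ _ leb2 green green_ge0 l f x f0). Qed.

Lemma Rop_le l f g x : (forall z, 0 <= f z) -> measurable_fun setT f -> measurable_fun setT g ->
  (forall z, f z <= g z) -> Rop l f x <= Rop l g x.
Proof. exact: (@le_resolvent _ _ _ leb2 green green_ge0 measurable_green l f g x). Qed.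

Lemma RopD l f g x : (forall z, 0 <= f z) -> (forall z, 0 <= g z) ->
  measurable_fun setT f -> measurable_fun setT g ->
  Rop l (fun z => f z + g z) x = Rop l f x + Rop l g x.
Proof. exact: (@resolventD _ _ _ leb2 green green_ge0 measurable_green l f g x). Qed.

Lemma RopZ l k f x : (0 <= k)%R -> (forall z, 0 <= f z) ->
  measurable_fun setT f -> Rop l (fun z => k%:E * f z) x = k%:E * Rop l f x.
Proof. exact: (@resolventZ _ _ _ leb2 green green_ge0 measurable_green l k f x). Qed.

Lemma Rop_cst l k x : (0 < l)%R -> (0 <= k)%R ->
  Rop l (fun=> k%:E) x = (k / l)%:E.
Proof. exact: (@resolvent_cst _ _ _ leb2 green green_ge0 measurable_green integral_green). Qed.

End plane_resolvent.

(** * The logarithmic kernel as a time integral *)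

Section frullani.
Context {R : realType}.
Implicit Types (a b s t : R).

Let E t s : R := expR (- (t / (4 * s))).

Let cE t s : (0 < s)%R -> {for s, continuous (E t)}.
Proof.
move=> s0; apply: continuous_comp; last exact: continuous_expR.
apply: (@continuousN _ R^o); apply: cvgM; first exact: cvg_cst.
apply: cvgV; first by rewrite gt_eqF// mulr_gt0.
by apply: cvgM; [exact: cvg_cst|exact: cvg_id].
Qed.

Let mE t : measurable_fun setT (E t).
Proof.
apply: measurableT_comp => //; apply: measurableT_comp => //; apply: measurable_funM => //.
by apply: (measurableT_comp measurable_invr); exact: measurable_funM.
Qed.

(** The antiderivative of the integrand is a multiple of E t itself. *)
Lemma integral_inverse_gamma t : (0 < t)%R ->
  \int[leb1]_s (if (0 < s)%R then (8 * s ^+ 2)^-1 * E t s else 0)%R%:E = ((2 * t)^-1)%:E.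
Proof.
move=> t0; pose f s := ((8 * s ^+ 2)^-1 * E t s)%R.
pose F s := ((2 * t)^-1 * E t s)%R.
have mf : measurable_fun setT f.
  apply: measurable_funM => //; apply: (measurableT_comp measurable_invr).
  by apply: measurable_funM => //; exact: measurable_funX.
have f0 s : (0 <= f s)%R.
  by rewrite mulr_ge0 ?expR_ge0// invr_ge0 mulr_ge0// sqr_ge0.
under eq_integral do rewrite (fun_if EFin).
rewrite (integral_gt0E (f := EFin \o f)); last 2 first.
  exact/measurable_EFinP.
  by move=> s _; rewrite lee_fin.
rewrite -integral_itv_obnd_cbnd; last by apply/measurable_EFinP; exact: measurable_funTS.
pose D n : set (measurableTypeR R) := `[(n.+1%:R^-1)%R, (n.+1%:R)%R]%classic.
have DU : `]0%R, +oo[%classic = \bigcup_n D n :> set (measurableTypeR R).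
  apply/seteqP; split => s /=.
    rewrite in_itv/= andbT => s0.
    exists (maxn (Num.truncn s) (Num.truncn s^-1)) => //; rewrite /D/= in_itv/=.
    apply/andP; split.
      rewrite -[leRHS]invrK lef_pV2 ?posrE ?invr_gt0//.
      by rewrite (le_trans (ltW (truncnS_gt _)))// ler_nat ltnS leq_maxr.
    by rewrite (le_trans (ltW (truncnS_gt _)))// ler_nat ltnS leq_maxl.
  by move=> [n _]; rewrite /D/= !in_itv/= andbT => /andP[+ _]; apply: lt_le_trans.
have FTC n : \int[lebesgue_measure]_(s in D n) (f s)%:E = (F n.+1%:R - F n.+1%:R^-1)%:E.
  have [->|n0] := eqVneq n 0%N.
    rewrite /D invr1 set_itv1 subrr; exact: integral_set1.
  have nn : (n.+1%:R^-1 < n.+1%:R :> R)%R.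
    rewrite (@lt_le_trans _ _ 1%R)// ?ler1n// invf_lt1// ltr1n ltnS lt0n//.
  have pos s : (n.+1%:R^-1 <= s -> 0 < s)%R by apply: lt_le_trans; rewrite invr_gt0.
  rewrite EFinB (@continuous_FTC2 _ f F)//.
  - apply: continuous_in_subspaceT => s; rewrite inE/= in_itv/= => /andP[/pos s0 _].
    apply: cvgM; last exact: cE.
    apply: cvgV; first by rewrite gt_eqF// mulr_gt0// exprn_gt0.
    by apply: cvgM; [exact: cvg_cst|exact: sqr_continuous].
  - have cF s : (0 < s)%R -> {for s, continuous F}.
      by move=> s0; apply: cvgM; [exact: cvg_cst|exact: cE].
    split.
    + move=> s; rewrite in_itv/= => /andP[/ltW/pos s0 _].
      have s40 : (4 * s != 0)%R by rewrite gt_eqF// mulr_gt0.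
      exact: ex_derive.
    + by apply/cvg_at_right_filter/cF; rewrite invr_gt0.
    + by apply/cvg_at_left_filter/cF.
  - move=> s; rewrite in_itv/= => /andP[/ltW/pos s0 _].
    have s40 : (4 * s != 0)%R by rewrite gt_eqF// mulr_gt0.
    rewrite derive1E; have : is_derive s 1%R F (f s).
      apply: is_derive_eq; rewrite /GRing.scale/= /f /E; field.
      by rewrite !gt_eqF.
    by move=> ?; rewrite derive_val.
have ndD : {homo D : n m / (n <= m)%N >-> (n <= m)%O}.
  move=> n m nm; rewrite subsetEset => s; rewrite /D/= !in_itv/= => /andP[s1 s2].
  rewrite (le_trans _ s1)/= ?(le_trans s2) ?ler_nat//.
  by rewrite lef_pV2 ?posrE// ler_nat.
have mD n : measurable (D n) by exact: measurable_itv.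
have := @ge0_nondecreasing_set_cvg_integral _ _ _ D (EFin \o f) (@lebesgue_measure R) ndD mD
  (fun n => measurable_funTS (proj2 (measurable_EFinP setT f) mf)) (fun n s _ => f0 s).
rewrite -DU => cv; suff cv' : (fun n => \int[lebesgue_measure]_(s in D n) (f s)%:E) @ \oo --> ((2 * t)^-1)%:E.
  exact: (cvg_unique (@ereal_hausdorff R) cv cv').
rewrite (_ : (fun n => _) = (fun n => (F n.+1%:R - F n.+1%:R^-1)%:E)); last first.
  by apply/funext => n; exact: FTC.
apply: cvg_EFin; first exact: nearW.
rewrite [X in _ --> X](_ : _ = (2 * t)^-1 * 1 - (2 * t)^-1 * 0)%R; last by rewrite mulr1 mulr0 subr0.
apply: cvgB; apply: cvgM; try exact: cvg_cst.
- rewrite -[X in _ --> X]expR0 -[X in _ --> expR X]oppr0.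
  apply: (cvg_comp _ expR); last exact: continuous_expR.
  apply: cvgN; rewrite -[X in _ --> X](mulr0 (t / 4)%R).
  rewrite (_ : (fun n => _) = (fun n => t / 4 * harmonic n)%R); last first.
    by apply/funext => n; rewrite /harmonic/= invfM mulrA.
  by apply: cvgM; [exact: cvg_cst|exact: cvg_harmonic].
- rewrite (_ : (fun n => _) = (fun n => expR (- (t / 4)) ^+ n.+1)%R); last first.
    apply/funext => n; rewrite -expRM_natl /E; congr expR.
    by rewrite invfM invrK mulrN mulrA mulrC.
  rewrite (cvg_shiftS (fun n => expR (- (t / 4)) ^+ n)%R).
  apply: cvg_expr; rewrite ger0_norm ?expR_ge0// -expR0 ltr_expR.
  by rewrite oppr_lt0 divr_gt0.
Qed.

Lemma integral_leb1_interval a b (f : R -> R) :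
  measurable_fun setT f -> (forall t, (a <= t)%R -> (0 <= f t)%R) ->
  \int[leb1]_t (if (a <= t)%R && (t <= b)%R then f t else 0%R)%:E =
  \int[lebesgue_measure]_(t in `[a, b]) (f t)%:E.
Proof.
move=> mf f0; transitivity (\int[leb1]_(t in `[a, b]) (f t)%:E).
  rewrite [RHS]integral_mkcond; apply: eq_integral => s _.
  by rewrite patchE mem_setE/= in_itv/=; case: ifP.
rewrite ge0_integral_leb1//.
- by apply/measurable_EFinP; exact: measurable_funTS.
- by move=> t /=; rewrite in_itv/= => /andP[/f0]; rewrite lee_fin.
Qed.

(** 2 pi times the heat kernel, as a function of the squared distance a. *)
Definition loggauss s a : R :=
  if (0 < s)%R then ((2 * s)^-1 * expR (- (a / (4 * s))))%R else 0%R.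

Lemma loggauss_ge0 s a : (0 <= loggauss s a)%R.
Proof.
rewrite /loggauss; case: ifP => // s0.
by rewrite mulr_ge0 ?expR_ge0// invr_ge0 mulr_ge0// ltW.
Qed.

Lemma le_loggauss s a b : (a <= b)%R -> (loggauss s b <= loggauss s a)%R.
Proof.
move=> ab; rewrite /loggauss; case: ifP => // s0.
rewrite ler_wpM2l ?invr_ge0 ?mulr_ge0 ?(ltW s0)// ler_expR lerN2 ler_wpM2r//.
by rewrite invr_ge0 mulr_ge0// ltW.
Qed.

Lemma measurable_loggauss d (T : measurableType d) (s : T -> R) (a : T -> R) :
  measurable_fun setT s -> measurable_fun setT a ->
  measurable_fun setT (fun p => loggauss (s p) (a p)).
Proof.
move=> ms ma; apply: measurable_fun_ifT => //; first exact: measurable_fun_ltr.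
apply: measurable_funM.
  by apply: (measurableT_comp measurable_invr); exact: measurable_funM.
apply: measurableT_comp => //; apply: measurableT_comp => //; apply: measurable_funM => //.
by apply: (measurableT_comp measurable_invr); exact: measurable_funM.
Qed.

Lemma loggaussB s a b : (0 < s)%R -> (a < b)%R ->
  (loggauss s a - loggauss s b)%:E =
  \int[lebesgue_measure]_(t in `[a, b]) ((8 * s ^+ 2)^-1 * E t s)%:E.
Proof.
move=> s0 ab; have s40 : (4 * s != 0)%R by rewrite gt_eqF// mulr_gt0.
pose F t := (- ((2 * s)^-1 * E t s))%R.
have cEs : continuous (E ^~ s).
  move=> t; apply: continuous_comp; last exact: continuous_expR.
  apply: (@continuousN _ R^o); apply: cvgM; first exact: cvg_id.
  exact: cvg_cst.
have cF : continuous F by move=> t; apply: cvgN; apply: cvgM; [exact: cvg_cst|exact: cEs].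
rewrite (@continuous_FTC2 _ _ F)//.
- by rewrite /F /loggauss s0 -EFinB opprK addrC.
- by apply: continuous_subspaceT => t; apply: cvgM; [exact: cvg_cst|exact: cEs].
- split.
  + by move=> t _; exact: ex_derive.
  + exact/cvg_at_right_filter/cF.
  + exact/cvg_at_left_filter/cF.
- move=> t _; rewrite derive1E.
  have : is_derive t 1%R F ((8 * s ^+ 2)^-1 * E t s)%R.
    apply: is_derive_eq; rewrite /GRing.scale/= /E; field.
    by rewrite gt_eqF.
  by move=> ?; rewrite derive_val.
Qed.

Lemma integral_inv a b : (0 < a)%R -> (a < b)%R ->
  \int[lebesgue_measure]_(t in `[a, b]) ((2 * t)^-1)%:E = ((ln b - ln a) / 2)%:E.
Proof.
move=> a0 ab; pose F t : R := (ln t / 2)%R.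
have pos t : (a <= t -> 0 < t)%R by exact: lt_le_trans.
have cF t : (0 < t)%R -> {for t, continuous F}.
  by move=> t0; apply: cvgM; [exact: continuous_ln|exact: cvg_cst].
rewrite (@continuous_FTC2 _ _ F)//.
- by rewrite /F -EFinB; congr _%:E; lra.
- apply: continuous_in_subspaceT => t; rewrite inE/= in_itv/= => /andP[/pos t0 _].
  apply: cvgV; first by rewrite gt_eqF// mulr_gt0.
  by apply: cvgM; [exact: cvg_cst|exact: cvg_id].
- split.
  + move=> t; rewrite in_itv/= => /andP[/ltW/pos t0 _].
    by apply: derivableM => //; apply: ex_derive; exact: is_derive1_ln.
  + exact/cvg_at_right_filter/cF.
  + by apply/cvg_at_left_filter/cF; exact: lt_trans ab.
- move=> t; rewrite in_itv/= => /andP[/ltW/pos t0 _]; rewrite derive1E.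
  have dln : is_derive t 1%R (@ln R) (t^-1)%R by exact: is_derive1_ln.
  have : is_derive t 1%R F ((2 * t)^-1)%R.
    apply: is_derive_eq; rewrite /GRing.scale/=; field.
    by rewrite gt_eqF.
  by move=> ?; rewrite derive_val.
Qed.

(** Frullani's integral, obtained by writing the difference as an integral over [a, b]. *)
Lemma frullani a b : (0 < a)%R -> (a <= b)%R ->
  \int[leb1]_s (loggauss s a - loggauss s b)%:E = ((ln b - ln a) / 2)%:E.
Proof.
move=> a0; rewrite le_eqVlt => /predU1P[->|ab].
  by under eq_integral do rewrite subrr; rewrite integral0 subrr mul0r.
pose h t s := (if (a <= t)%R && (t <= b)%R then
  if (0 < s)%R then (8 * s ^+ 2)^-1 * E t s else 0 else 0)%R%:E.
have q0 t s : (0 <= (8 * s ^+ 2)^-1 * E t s)%R.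
  by rewrite mulr_ge0 ?expR_ge0// invr_ge0 mulr_ge0// sqr_ge0.
have h0 t s : 0 <= h t s by rewrite lee_fin; do 2 case: ifP => // _.
have mh : measurable_fun setT (fun p : R * R => h p.1 p.2).
  apply/measurable_EFinP; apply: measurable_fun_ifT => //.
    by apply: measurable_and; exact: measurable_fun_ler.
  apply: measurable_fun_ifT => //; first exact: measurable_fun_ltr.
  apply: measurable_funM.
    apply: (measurableT_comp measurable_invr); apply: measurable_funM => //.
    exact: measurable_funX.
  apply: measurableT_comp => //; apply: measurableT_comp => //; apply: measurable_funM => //.
  by apply: (measurableT_comp measurable_invr); exact: measurable_funM.
transitivity (\int[leb1]_s \int[leb1]_t h t s).
  apply: eq_integral => s _.
  have [s0|s0] := boolP (0 < s)%R; last first.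
    rewrite /loggauss (negbTE s0) subrr -[LHS](integral0 leb1 setT).
    by apply: eq_integral => t _; rewrite /h (negbTE s0) if_same.
  rewrite loggaussB// -integral_leb1_interval//.
  - by apply: eq_integral => t _; rewrite /h s0.
  - apply: measurable_funM => //.
    by apply: measurableT_comp => //; apply: measurableT_comp => //; exact: measurable_funM.
transitivity (\int[leb1]_t \int[leb1]_s h t s).
  exact/esym/(tonelli (m1 := leb1) (m2 := leb1) h mh h0).
rewrite -integral_inv// -(@integral_leb1_interval a b (fun t => (2 * t)^-1)%R).
- apply: eq_integral => t _; rewrite /h; case: ifP => [/andP[ta _]|_]; last by rewrite integral0.
  by rewrite integral_inverse_gamma// (lt_le_trans a0).
- by apply: (measurableT_comp measurable_invr); exact: measurable_funM.
- by move=> t ta; rewrite invr_ge0 mulr_ge0// (le_trans (ltW a0)).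
Qed.

End frullani.

Section logarithmic_laplace.
Context {R : realType}.
Implicit Types (a b e l s : R) (x y z : plane R) (n : nat).

Lemma loggauss_heat s x y : (2 * pi * heat s x y = loggauss s (sqdist x y))%R.
Proof.
rewrite /heat /loggauss; case: ifP => s0; last by rewrite mulr0.
rewrite mulrA; congr (_ * _)%R.
rewrite (_ : 4 * pi * s = 2 * pi * (2 * s))%R; last by ring.
by rewrite invfM mulrA divff ?mul1r// mulf_neq0// gt_eqF// pi_gt0.
Qed.

Lemma mule_def_EFin (c : R) (u : \bar R) : c != 0%R -> c%:E *? u.
Proof.
by case: u => [v| |] c0; [exact: mule_def_fin|exact: mule_def_neq0_infty..].
Qed.

(** Monotone convergence: the weights increase to 1 at positive times. *)
Lemma laplace_cvg (P : R -> \bar R) : measurable_fun setT P -> (forall s, 0 <= P s) ->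
  (forall s, (s <= 0)%R -> P s = 0) ->
  (fun n => \int[leb1]_s ((expR (- (n.+1%:R^-1 * s)))%:E * P s)) @ \oo -->
  \int[leb1]_s P s.
Proof.
move=> mP P0 Pn.
have h0 n s : 0 <= (expR (- (n.+1%:R^-1 * s)))%:E * P s.
  by rewrite mule_ge0// lee_fin expR_ge0.
have mh n : measurable_fun setT (fun s => (expR (- (n.+1%:R^-1 * s)))%:E * P s).
  apply: emeasurable_funM => //; apply/measurable_EFinP.
  by apply: measurableT_comp => //; apply: measurableT_comp => //; exact: measurable_funM.
have ndh s : {homo (fun n => (expR (- (n.+1%:R^-1 * s)))%:E * P s) :
    n m / (n <= m)%N >-> n <= m}.
  move=> n m nm; have [s0|s0] := leP s 0%R; first by rewrite Pn// !mule0.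
  apply: lee_wpmul2r => //; rewrite lee_fin ler_expR lerN2 ler_wpM2r ?(ltW s0)//.
  by rewrite lef_pV2 ?posrE// ler_nat.
have limh s : limn (fun n => (expR (- (n.+1%:R^-1 * s)))%:E * P s) = P s.
  apply/cvg_lim => //; rewrite -[X in _ --> X]mul1e.
  apply: cvgeM; [|idtac|exact: cvg_cst].
    by apply: mule_def_EFin; rewrite oner_eq0.
  apply: cvg_EFin; first exact: nearW.
  rewrite -[X in _ --> X]expR0 -[X in _ --> expR X]oppr0.
  apply: (cvg_comp _ expR); last exact: continuous_expR.
  apply: cvgN; rewrite -[X in _ --> X](mul0r s).
  by apply: cvgM; [exact: cvg_harmonic|exact: cvg_cst].
rewrite (_ : \int[leb1]_s P s =
  \int[leb1]_s limn (fun n => (expR (- (n.+1%:R^-1 * s)))%:E * P s)); last first.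
  by apply: eq_integral => s _; rewrite limh.
exact: (cvg_monotone_convergence measurableT mh (fun n s _ => h0 n s) (fun s _ => @ndh s)).
Qed.

(** 2 pi times the resolvent kernel, as a function of the squared distance a. *)
Definition LG e a : \bar R := \int[leb1]_s (expR (- (e * s)) * loggauss s a)%:E.

Lemma LG_ge0 e a : 0 <= LG e a.
Proof.
by apply: integral_ge0 => s _; rewrite lee_fin mulr_ge0 ?expR_ge0 ?loggauss_ge0.
Qed.

Lemma measurable_exploggauss d (T : measurableType d) e (s a : T -> R) :
  measurable_fun setT s -> measurable_fun setT a ->
  measurable_fun setT (fun p => (expR (- (e * s p)) * loggauss (s p) (a p))%:E).
Proof.
move=> ms ma; apply/measurable_EFinP; apply: measurable_funM; last exact: measurable_loggauss.
by apply: measurableT_comp => //; apply: measurableT_comp => //; exact: measurable_funM.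
Qed.

Lemma LG_green e x y : LG e (sqdist x y) = (2 * pi)%:E * green e x y.
Proof.
rewrite -ge0_integralZl_EFin//.
- by apply: eq_integral => s _; rewrite -EFinM mulrCA loggauss_heat.
- by move=> s _; exact: expheat_ge0.
- exact: (measurable_expheat e (s := id) (x := cst x) (y := cst y)).
- by rewrite mulr_ge0// pi_ge0.
Qed.

Lemma le_LG e a b : (a <= b)%R -> LG e b <= LG e a.
Proof.
move=> ab; apply: ge0_le_integral => //.
- by move=> s _; rewrite lee_fin mulr_ge0 ?expR_ge0 ?loggauss_ge0.
- exact: (measurable_exploggauss e (s := id) (a := cst b)).
- exact: (measurable_exploggauss e (s := id) (a := cst a)).
- by move=> s _; rewrite lee_fin ler_wpM2l ?expR_ge0// le_loggauss.
Qed.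

Lemma expR_le_inv (u : R) : (0 < u)%R -> (expR (- u) <= u^-1)%R.
Proof.
move=> u0; rewrite expRN lef_pV2 ?posrE ?expR_gt0//.
by rewrite (le_trans _ (expR_ge1Dx u))// lerDr.
Qed.

Lemma LG_le e a : (0 < e)%R -> (0 < a)%R -> LG e a <= (2 / (e * a))%:E.
Proof.
move=> e0 a0.
pose h s := (2 / a * (if (0 < s)%R then expR (- (e * s)) else 0))%R.
have mexp : measurable_fun setT (fun s => if (0 < s)%R then expR (- (e * s)) else 0%R).
  apply: measurable_fun_ifT => //; first exact: measurable_fun_ltr.
  by apply: measurableT_comp => //; apply: measurableT_comp => //; exact: measurable_funM.
apply: (@le_trans _ _ (\int[leb1]_s (h s)%:E)).
  apply: ge0_le_integral => //.
  - by move=> s _; rewrite lee_fin mulr_ge0 ?expR_ge0 ?loggauss_ge0.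
  - exact: (measurable_exploggauss e (s := id) (a := cst a)).
  - by apply/measurable_EFinP; exact: measurable_funM.
  - move=> s _; rewrite lee_fin /h /loggauss; case: ifPn => s0; last by rewrite !mulr0.
    rewrite mulrC ler_wpM2r ?expR_ge0//.
    apply: (@le_trans _ _ ((2 * s)^-1 * (a / (4 * s))^-1)%R).
      rewrite ler_wpM2l ?invr_ge0 ?mulr_ge0 ?(ltW s0)//.
      by apply: expR_le_inv; rewrite divr_gt0// mulr_gt0.
    by rewrite le_eqVlt; apply/orP; left; apply/eqP; field; rewrite !gt_eqF.
rewrite /h; under eq_integral do rewrite EFinM.
rewrite ge0_integralZl_EFin//.
- rewrite integral_exp// -EFinM lee_fin le_eqVlt; apply/orP; left; apply/eqP.
  by field; rewrite !gt_eqF.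
- by move=> s _; rewrite lee_fin; case: ifP => // _; exact: expR_ge0.
- exact/measurable_EFinP.
- by rewrite divr_ge0// ltW.
Qed.

Lemma LG_fin e a : (0 < e)%R -> (0 < a)%R -> LG e a \is a fin_num.
Proof.
by move=> e0 a0; rewrite ge0_fin_numE ?LG_ge0// (le_lt_trans (LG_le e0 a0)) ?ltry.
Qed.

(** The positive and negative parts of LG e a - LG e 1, as integrals. Unlike LG they
stay finite as e tends to 0, where Frullani's integral turns them into the parts of
- ln a / 2. *)
Definition LGpos e a : \bar R :=
  \int[leb1]_s (expR (- (e * s)) * Num.max (loggauss s a - loggauss s 1) 0)%:E.
Definition LGneg e a : \bar R :=
  \int[leb1]_s (expR (- (e * s)) * Num.max (loggauss s 1 - loggauss s a) 0)%:E.

Lemma measurable_explogmax d (T : measurableType d) e (s a b : T -> R) :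
  measurable_fun setT s -> measurable_fun setT a -> measurable_fun setT b ->
  measurable_fun setT (fun p => (expR (- (e * s p)) *
    Num.max (loggauss (s p) (a p) - loggauss (s p) (b p)) 0)%:E).
Proof.
move=> ms ma mb; apply/measurable_EFinP; apply: measurable_funM.
  by apply: measurableT_comp => //; apply: measurableT_comp => //; exact: measurable_funM.
by apply: measurable_maxr => //; apply: measurable_funB; exact: measurable_loggauss.
Qed.

Lemma explogmax_ge0 e s a b :
  0 <= (expR (- (e * s)) * Num.max (loggauss s a - loggauss s b) 0)%:E.
Proof. by rewrite lee_fin mulr_ge0 ?expR_ge0// le_max lexx orbT. Qed.

Lemma LGpos_ge0 e a : 0 <= LGpos e a.
Proof. by apply: integral_ge0 => s _; exact: explogmax_ge0. Qed.

Lemma LGneg_ge0 e a : 0 <= LGneg e a.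
Proof. by apply: integral_ge0 => s _; exact: explogmax_ge0. Qed.

Lemma LG_pos_neg e a : LG e a + LGneg e a = LG e 1 + LGpos e a.
Proof.
have g0 s b : 0 <= (expR (- (e * s)) * loggauss s b)%:E.
  by rewrite lee_fin mulr_ge0 ?expR_ge0 ?loggauss_ge0.
have mg b := @measurable_exploggauss _ _ e id (cst b) (@measurable_id _ _ setT) (@measurable_cst _ _ _ _ setT b).
have mm b c := @measurable_explogmax _ _ e id (cst b) (cst c) (@measurable_id _ _ setT)
  (@measurable_cst _ _ _ _ setT b) (@measurable_cst _ _ _ _ setT c).
have D b c c' := esym (@ge0_integralD _ _ _ (@leb1 R) setT measurableT _ _
  (fun s _ => g0 s b) (mg b) (fun s _ => explogmax_ge0 e s c c') (mm c c')).
transitivity (\int[leb1]_s ((expR (- (e * s)) * loggauss s a)%:E +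
    (expR (- (e * s)) * Num.max (loggauss s 1 - loggauss s a) 0)%:E)); first exact: D.
apply: (@etrans _ _ (\int[leb1]_s ((expR (- (e * s)) * loggauss s 1)%:E +
    (expR (- (e * s)) * Num.max (loggauss s a - loggauss s 1) 0)%:E))); last exact/esym/D.
apply: eq_integral => s _; rewrite -!EFinD -!mulrDr; congr (_ * _)%:E.
by rewrite !maxEle; case: ifPn; case: ifPn; rewrite -?ltNge; lra.
Qed.

Lemma LGneg_le e a : (0 <= e)%R -> LGneg e a <= LGneg 0 a.
Proof.
move=> e0; apply: ge0_le_integral => //.
- by move=> s _; exact: explogmax_ge0.
- exact: (measurable_explogmax e (s := id) (a := cst 1%R) (b := cst a)).
- exact: (measurable_explogmax 0 (s := id) (a := cst 1%R) (b := cst a)).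
- move=> s _; rewrite lee_fin mul0r oppr0 expR0 mul1r.
  have [s0|s0] := ltP 0%R s; last first.
    by rewrite /loggauss ltNge s0/= subrr maxxx mulr0.
  rewrite ler_piMl// ?le_max ?lexx ?orbT// -expR0 ler_expR oppr_le0.
  by rewrite mulr_ge0// ltW.
Qed.

Lemma LGneg0E a : (1 <= a)%R -> LGneg 0 a = (ln a / 2)%:E.
Proof.
move=> a1; rewrite /LGneg.
transitivity (\int[leb1]_s (loggauss s 1 - loggauss s a)%:E).
  apply: eq_integral => s _; rewrite mul0r oppr0 expR0 mul1r max_l//.
  by rewrite subr_ge0 le_loggauss.
by rewrite frullani// ln1 subr0.
Qed.

Lemma LGneg_eq0 e a : (a <= 1)%R -> LGneg e a = 0.
Proof.
move=> a1; rewrite /LGneg; under eq_integral => s _.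
  by rewrite max_r ?subr_le0 ?le_loggauss// mulr0; over.
by rewrite integral0.
Qed.

Lemma LGpos_eq0 e a : (1 <= a)%R -> LGpos e a = 0.
Proof.
move=> a1; rewrite /LGpos; under eq_integral => s _.
  by rewrite max_r ?subr_le0 ?le_loggauss// mulr0; over.
by rewrite integral0.
Qed.

Lemma LGpos0E a : (0 < a)%R -> (a <= 1)%R -> LGpos 0 a = (- ln a / 2)%:E.
Proof.
move=> a0 a1; rewrite /LGpos.
transitivity (\int[leb1]_s (loggauss s a - loggauss s 1)%:E).
  apply: eq_integral => s _; rewrite mul0r oppr0 expR0 mul1r max_l//.
  by rewrite subr_ge0 le_loggauss.
by rewrite frullani// ln1 sub0r.
Qed.

Lemma le_LGpos e a b : (a <= b)%R -> LGpos e b <= LGpos e a.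
Proof.
move=> ab; apply: ge0_le_integral => //.
- by move=> s _; exact: explogmax_ge0.
- exact: (measurable_explogmax e (s := id) (a := cst b) (b := cst 1%R)).
- exact: (measurable_explogmax e (s := id) (a := cst a) (b := cst 1%R)).
- move=> s _; rewrite lee_fin ler_wpM2l ?expR_ge0//.
  by rewrite ge_max !le_max lexx orbT andbT lerB ?le_loggauss.
Qed.

Lemma LGpos00 : LGpos 0 0 = +oo.
Proof.
apply/eqyP => A A0.
have e0 : (0 < expR (- (2 * A)) :> R)%R by exact: expR_gt0.
have e1 : (expR (- (2 * A)) <= 1 :> R)%R.
  by rewrite -[leRHS]expR0 ler_expR oppr_le0 mulr_ge0// ltW.
apply: (le_trans _ (le_LGpos 0 (ltW e0))).
by rewrite LGpos0E// expRK opprK lee_fin mulrAC divff// mul1r.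
Qed.

(** LG e 1 grows only like log (1 / e): compare the values at squared distances 1 and a,
where LG e a <= 2 / (e a), with a of order 1 / d. *)
Lemma LG1_cvg0 : (fun n => (n.+1%:R^-1)%:E * LG n.+1%:R^-1 1) @ \oo --> 0.
Proof.
apply: ge0_cvge0 => [n|d d0]; first by rewrite mule_ge0 ?LG_ge0// lee_fin invr_ge0.
pose a := (1 + 4 / d)%R.
have a0 : (0 < a)%R by rewrite addr_gt0// divr_gt0.
have a1 : (1 <= a)%R by rewrite lerDl divr_ge0// ltW.
have lna : (0 <= ln a)%R by rewrite ln_ge0.
exists (Num.truncn (ln a / d)) => // n /= Nn.
set e := (n.+1%:R^-1)%R.
have e0 : (0 < e)%R by rewrite invr_gt0.
have eln : (e * ln a <= d)%R.
  rewrite /e mulrC ler_pdivrMr// mulrC -ler_pdivrMr//.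
  by rewrite (le_trans (ltW (truncnS_gt _)))// ler_nat.
have : LG e 1 <= (2 / (e * a) + ln a / 2)%:E.
  apply: (@le_trans _ _ (LG e 1 + LGpos e a)); first by rewrite leeDl// LGpos_ge0.
  rewrite -LG_pos_neg EFinD leeD ?LG_le// (le_trans (LGneg_le _ (ltW e0)))// LGneg0E//.
rewrite -(fineK (LG_fin e0 ltr01)) -EFinM !lee_fin => LG1.
apply: (le_trans (ler_wpM2l (ltW e0) LG1)).
have -> : (e * (2 / (e * a) + ln a / 2) = 2 / a + e * ln a / 2)%R.
  by field; rewrite !gt_eqF.
have : (2 / a <= d / 2)%R.
  rewrite ler_pdivrMr//.
  have -> : (d / 2 * a = d / 2 + 2)%R by rewrite /a; field; rewrite gt_eqF.
  by rewrite lerDr divr_ge0// ltW.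
lra.
Qed.

End logarithmic_laplace.

(** * Recurrence and the resolvent of the logarithm *)

Section resolvent_of_logarithm.
Context {R : realType}.
Implicit Types (a b e l s : R) (x y z : plane R) (n : nat).

(** Frullani's integral between a1 and a1 exp (2 A) is already A. *)
Lemma integral_loggauss_oo a : \int[leb1]_s (loggauss s a)%:E = +oo.
Proof.
apply/eqyP => A A0.
pose a1 := (Num.max a 0 + 1)%R.
have m0 : (0 <= Num.max a 0)%R by rewrite le_max lexx orbT.
have a10 : (0 < a1)%R by rewrite ltr_wpDl.
have aa1 : (a <= a1)%R by rewrite (@le_trans _ _ (Num.max a 0)%R)// ?le_max ?lexx// lerDl.
have eA : (1 <= expR (2 * A))%R by rewrite -[leLHS]expR0 ler_expR mulr_ge0// ltW.
have a1b : (a1 <= a1 * expR (2 * A))%R by rewrite ler_peMr// ltW.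
have ml c : measurable_fun setT (fun s => loggauss s c).
  exact: (measurable_loggauss (s := id) (a := cst c)).
apply: (@le_trans _ _ (\int[leb1]_s (loggauss s a1 - loggauss s (a1 * expR (2 * A)))%:E)).
  rewrite frullani// lnM ?posrE ?expR_gt0// expRK addrAC subrr add0r.
  by rewrite lee_fin mulrAC divff// mul1r.
apply: ge0_le_integral => //.
- by move=> s _; rewrite lee_fin subr_ge0 le_loggauss.
- by apply/measurable_EFinP; exact: measurable_funB.
- exact/measurable_EFinP.
- move=> s _; rewrite lee_fin (le_trans _ (le_loggauss s aa1))// gerBl.
  exact: loggauss_ge0.
Qed.

(** Planar Brownian motion is recurrent. *)
Lemma green_recurrent x y : (fun n => green n.+1%:R^-1 x y) @ \oo --> +oo.
Proof.
have mheat : measurable_fun setT (fun s => (heat s x y)%:E).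
  by apply/measurable_EFinP; exact: (measurable_heat (s := id) (x := cst x) (y := cst y)).
have -> : +oo = \int[leb1]_s (heat s x y)%:E.
  have : (2 * pi)%:E * \int[leb1]_s (heat s x y)%:E = +oo.
    rewrite -ge0_integralZl_EFin//.
    - rewrite -(integral_loggauss_oo (sqdist x y)); apply: eq_integral => s _.
      by rewrite -EFinM loggauss_heat.
    - by move=> s _; rewrite lee_fin heat_ge0.
    - by rewrite mulr_ge0// pi_ge0.
  have : 0 <= \int[leb1]_s (heat s x y)%:E.
    by apply: integral_ge0 => s _; rewrite lee_fin heat_ge0.
  by case: integral.
rewrite (_ : (fun n => _) = (fun n => \int[leb1]_s
    ((expR (- (n.+1%:R^-1 * s)))%:E * (heat s x y)%:E))); last first.
  by apply/funext => n; apply: eq_integral => s _; rewrite EFinM.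
apply: laplace_cvg mheat _ _.
- by move=> s; rewrite lee_fin heat_ge0.
- by move=> s s0; rewrite /heat ltNge s0.
Qed.

Lemma measurable_sqdistl y : measurable_fun setT (sqdist ^~ y).
Proof. exact: (measurable_sqdist (x := id) (y := cst y)). Qed.

(** Once the resolvent is moved inside the time integral, the rate only enters through
the Laplace weight, and monotone convergence applies. *)
Lemma cvg_resolvent_laplace l (a b : plane R -> R) x :
  measurable_fun setT a -> measurable_fun setT b ->
  (fun n => Rop l (fun z => \int[leb1]_s (expR (- (n.+1%:R^-1 * s)) *
       Num.max (loggauss s (a z) - loggauss s (b z)) 0)%:E) x) @ \oo -->
  Rop l (fun z => \int[leb1]_s (expR (- (0 * s)) *
       Num.max (loggauss s (a z) - loggauss s (b z)) 0)%:E) x.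
Proof.
move=> ma mb; pose M s z : R := (Num.max (loggauss s (a z) - loggauss s (b z)) 0)%R.
have M0 s z : (0 <= M s z)%R by rewrite le_max lexx orbT.
have gM0 s z : 0 <= green l x z * (M s z)%:E by rewrite mule_ge0 ?green_ge0// lee_fin.
have mgl : measurable_fun setT (green l x).
  exact: (measurableT_comp (measurable_green l) (pair1_measurable x)).
have mM d (T : measurableType d) (s : T -> R) (z : T -> plane R) :
    measurable_fun setT s -> measurable_fun setT z ->
    measurable_fun setT (fun p => M (s p) (z p)).
  move=> ms mz; apply: measurable_maxr => //; apply: measurable_funB;
    by apply: measurable_loggauss => //; exact: measurableT_comp.
have mgM d (T : measurableType d) (s : T -> R) (z : T -> plane R) :
    measurable_fun setT s -> measurable_fun setT z ->
    measurable_fun setT (fun p => green l x (z p) * (M (s p) (z p))%:E).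
  move=> ms mz; apply: emeasurable_funM; first exact: measurableT_comp.
  by apply/measurable_EFinP; exact: mM.
pose P s := \int[leb2]_z (green l x z * (M s z)%:E).
have mP : measurable_fun setT P.
  apply: (measurable_integral1 (fun s z => green l x z * (M s z)%:E) _ gM0).
  exact: (mgM _ _ fst snd).
have P0 s : 0 <= P s by exact: integral_ge0.
have swap e : Rop l (fun z => \int[leb1]_s (expR (- (e * s)) * M s z)%:E) x =
    \int[leb1]_s ((expR (- (e * s)))%:E * P s).
  have mexp : measurable_fun setT (fun s => (expR (- (e * s)))%:E).
    apply/measurable_EFinP; apply: measurableT_comp => //.
    by apply: measurableT_comp => //; exact: measurable_funM.
  pose h z s := (expR (- (e * s)))%:E * (green l x z * (M s z)%:E).
  have h0 z s : 0 <= h z s by rewrite mule_ge0// lee_fin expR_ge0.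
  have mh : measurable_fun setT (fun p : plane R * R => h p.1 p.2).
    apply: emeasurable_funM; first exact: measurableT_comp mexp measurable_snd.
    exact: (mgM _ _ snd fst).
  transitivity (\int[leb2]_z \int[leb1]_s h z s).
    apply: eq_integral => z _; rewrite -ge0_integralZl//.
    - by apply: eq_integral => s _; rewrite /h EFinM muleCA.
    - by apply/measurable_EFinP; apply: measurable_funM; [exact/measurable_EFinP|exact: (mM _ _ id (cst z))].
    - by move=> s _; rewrite lee_fin mulr_ge0 ?expR_ge0.
    - exact: green_ge0.
  transitivity (\int[leb1]_s \int[leb2]_z h z s).
    exact: (tonelli (m1 := leb2) (m2 := leb1) h mh h0).
  apply: eq_integral => s _; rewrite ge0_integralZl_EFin ?expR_ge0//.
  exact: (mgM _ _ (cst s) id).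
have Pn s : (s <= 0)%R -> P s = 0.
  move=> s0; rewrite /P; under eq_integral do
    rewrite /M /loggauss ltNge s0/= subrr maxxx mule0.
  by rewrite integral0.
rewrite swap; have -> : \int[leb1]_s ((expR (- (0 * s)))%:E * P s) = \int[leb1]_s P s.
  by apply: eq_integral => s _; rewrite mul0r oppr0 expR0 mul1e.
rewrite (_ : (fun n => _) = (fun n => \int[leb1]_s ((expR (- (n.+1%:R^-1 * s)))%:E * P s))).
  exact: laplace_cvg.
by apply/funext => n; exact: swap.
Qed.

Lemma cvg_LGpos a : (fun n => LGpos n.+1%:R^-1 a) @ \oo --> LGpos 0 a.
Proof.
pose M s := (Num.max (loggauss s a - loggauss s 1) 0)%:E.
have -> : LGpos 0 a = \int[leb1]_s M s.
  by apply: eq_integral => s _; rewrite mul0r oppr0 expR0 mul1r.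
apply: laplace_cvg.
- apply/measurable_EFinP; apply: measurable_maxr => //; apply: measurable_funB.
    exact: (measurable_loggauss (s := id) (a := cst a)).
  exact: (measurable_loggauss (s := id) (a := cst 1%R)).
- by move=> s; rewrite lee_fin le_max lexx orbT.
- by move=> s s0; rewrite /M /loggauss ltNge s0/= subrr maxxx.
Qed.

Lemma cvg_LGneg a : (fun n => LGneg n.+1%:R^-1 a) @ \oo --> LGneg 0 a.
Proof.
pose M s := (Num.max (loggauss s 1 - loggauss s a) 0)%:E.
have -> : LGneg 0 a = \int[leb1]_s M s.
  by apply: eq_integral => s _; rewrite mul0r oppr0 expR0 mul1r.
apply: laplace_cvg.
- apply/measurable_EFinP; apply: measurable_maxr => //; apply: measurable_funB.
    exact: (measurable_loggauss (s := id) (a := cst 1%R)).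
  exact: (measurable_loggauss (s := id) (a := cst a)).
- by move=> s; rewrite lee_fin le_max lexx orbT.
- by move=> s s0; rewrite /M /loggauss ltNge s0/= subrr maxxx.
Qed.

Lemma measurable_LGpos e y : measurable_fun setT (fun z => LGpos e (sqdist z y)).
Proof.
apply: (measurable_integral1 (fun z s => (expR (- (e * s)) *
   Num.max (loggauss s (sqdist z y) - loggauss s 1) 0)%:E)).
  apply: (measurable_explogmax e (s := snd) (b := cst 1%R)) => //.
  exact: measurableT_comp (measurable_sqdistl y) measurable_fst.
by move=> z s; exact: explogmax_ge0.
Qed.

Lemma measurable_LGneg e y : measurable_fun setT (fun z => LGneg e (sqdist z y)).
Proof.
apply: (measurable_integral1 (fun z s => (expR (- (e * s)) *
   Num.max (loggauss s 1 - loggauss s (sqdist z y)) 0)%:E)).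
  apply: (measurable_explogmax e (s := snd) (a := cst 1%R)) => //.
  exact: measurableT_comp (measurable_sqdistl y) measurable_fst.
by move=> z s; exact: explogmax_ge0.
Qed.

Lemma measurable_greenr e y : measurable_fun setT (fun z => green e z y).
Proof. exact: (measurableT_comp (measurable_green e) (pair2_measurable y)). Qed.

End resolvent_of_logarithm.

Section logarithmic_identity.
Context {R : realType}.
Implicit Types (a b e l s : R) (x y z : plane R) (n : nat).

Lemma resolvent_balance l (f g p : plane R -> \bar R) (c : R) x : (0 < l)%R -> (0 <= c)%R ->
  (forall z, 0 <= f z) -> (forall z, 0 <= g z) -> (forall z, 0 <= p z) ->
  measurable_fun setT f -> measurable_fun setT g -> measurable_fun setT p ->
  (forall z, f z + g z = c%:E + p z) ->
  Rop l f x + Rop l g x = (c / l)%:E + Rop l p x.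
Proof.
move=> l0 c0 f0 g0 p0 mf mg mp fg.
have <- : Rop l (fun=> c%:E) x = (c / l)%:E.
  exact: Rop_cst.
have D1 := RopD l x f0 g0 mf mg.
have D2 := RopD l x (fun=> c0 : 0 <= c%:E) p0 (measurable_cst _) mp.
by rewrite -D1 -D2 (funext fg).
Qed.

(** Only the real constants are cancelled; the other terms may be infinite. *)
Lemma balance_algebra (l e c : R) (G Gl P N RG RP RN : \bar R) :
  (0 < e)%R -> (e < l)%R -> 0 <= Gl -> 0 <= P -> 0 <= N -> 0 <= RG -> 0 <= RP -> 0 <= RN ->
  G + N = c%:E + P -> G = Gl + (l - e)%:E * RG -> RG + RN = (c / l)%:E + RP ->
  P + (l - e)%:E * RN + (e / l)%:E * c%:E = Gl + N + (l - e)%:E * RP.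
Proof.
move=> e0 el Gl0 P0 N0 RG0 RP0 RN0 main GE RA.
have l0 : (0 < l)%R by exact: lt_trans el.
have le0 : 0 <= (l - e)%:E by rewrite lee_fin subr_ge0 ltW.
have kfin : (c * ((l - e) / l))%:E \is a fin_num by [].
have E1 : (l - e)%:E * RG + (l - e)%:E * RN = (c * ((l - e) / l))%:E + (l - e)%:E * RP.
  rewrite -(ge0_muleDr _ RG0 RN0) RA (muleDr (x := (l - e)%:E) isT (fin_num_adde_defr RP (erefl : (c / l)%:E \is a fin_num))).
  by rewrite -EFinM; congr (_%:E + _); rewrite mulrCA mulrA.
have E2 : P + (l - e)%:E * RN + (e / l)%:E * c%:E + (c * ((l - e) / l))%:E =
          c%:E + P + (l - e)%:E * RN.
  rewrite -[LHS]addeA -EFinM -EFinD [LHS]addeC -[RHS]addeA; congr (_%:E + _).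
  by field; rewrite gt_eqF.
have E3 : Gl + N + (l - e)%:E * RP + (c * ((l - e) / l))%:E = c%:E + P + (l - e)%:E * RN.
  rewrite -main GE -[LHS]addeA [X in _ + X]addeC -E1.
  by rewrite addeACA addeA.
by rewrite -[LHS](addeK _ kfin) -[RHS](addeK _ kfin) E2 E3.
Qed.

(** The resolvent equation between two rates, after subtraction of the value
at distance 1. *)
Lemma log_resolvent_approx e l x y : (0 < e)%R -> (e < l)%R ->
  LGpos e (sqdist x y) + (l - e)%:E * Rop l (fun z => LGneg e (sqdist z y)) x +
    (e / l)%:E * LG e 1 =
  LG l (sqdist x y) + LGneg e (sqdist x y) +
    (l - e)%:E * Rop l (fun z => LGpos e (sqdist z y)) x.
Proof.
move=> e0 el; have l0 : (0 < l)%R by exact: lt_trans el.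
have le0 : 0 <= (l - e)%:E by rewrite lee_fin subr_ge0 ltW.
have C0 : (0 <= fine (LG e 1))%R by rewrite fine_ge0// LG_ge0.
have pi20 : (0 <= 2 * pi :> R)%R by rewrite mulr_ge0// pi_ge0.
have Cfin : LG e 1 \is a fin_num by exact: LG_fin.
rewrite -(fineK Cfin); set C := fine _ in C0 *.
have RP0 : 0 <= Rop l (fun z => LGpos e (sqdist z y)) x.
  exact: (Rop_ge0 l x (fun z => LGpos_ge0 _ _)).
have RN0 : 0 <= Rop l (fun z => LGneg e (sqdist z y)) x.
  exact: (Rop_ge0 l x (fun z => LGneg_ge0 _ _)).
have RG0 : 0 <= Rop l (fun z => LG e (sqdist z y)) x.
  exact: (Rop_ge0 l x (fun z => LG_ge0 _ _)).
have mLG : measurable_fun setT (fun z => LG e (sqdist z y)).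
  under eq_fun do rewrite LG_green.
  by apply: emeasurable_funM => //; exact: measurable_greenr.
have resG : LG e (sqdist x y) =
    LG l (sqdist x y) + (l - e)%:E * Rop l (fun z => LG e (sqdist z y)) x.
  have -> : Rop l (fun z => LG e (sqdist z y)) x =
      (2 * pi)%:E * \int[leb2]_z (green l x z * green e z y).
    rewrite -(@RopZ _ l _ (fun z => green e z y))//.
    - by congr (Rop l _ x); apply/funext => z; exact: LG_green.
    - by move=> z; exact: green_ge0.
    - exact: measurable_greenr.
  have I0 : 0 <= \int[leb2]_z (green l x z * green e z y).
    by apply: integral_ge0 => z _; rewrite mule_ge0 ?green_ge0.
  have I1 : 0 <= (l - e)%:E * \int[leb2]_z (green l x z * green e z y) by rewrite mule_ge0.
  rewrite !LG_green (@r_resolvent' _ _ _ leb2 green greenC green_resolvent e l x y)//.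
  by rewrite (ge0_muleDr _ (green_ge0 l x y) I1) muleCA.
have RA : Rop l (fun z => LG e (sqdist z y)) x + Rop l (fun z => LGneg e (sqdist z y)) x =
    (C / l)%:E + Rop l (fun z => LGpos e (sqdist z y)) x.
  refine (@resolvent_balance l _ _ _ C x l0 C0 (fun z => LG_ge0 _ _) (fun z => LGneg_ge0 _ _)
    (fun z => LGpos_ge0 _ _) mLG (@measurable_LGneg _ e y) (@measurable_LGpos _ e y) _).
  by move=> z; rewrite LG_pos_neg -(fineK Cfin).
have PN := LG_pos_neg e (sqdist x y); rewrite -(fineK Cfin) in PN.
exact: (@balance_algebra l e C _ _ _ _ _ _ _ e0 el (LG_ge0 _ _) (LGpos_ge0 _ _)
  (LGneg_ge0 _ _) RG0 RP0 RN0 PN resG RA).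
Qed.

End logarithmic_identity.

Section logarithmic_kernel.
Context {R : realType}.
Implicit Types (a b e l s : R) (x y z : plane R) (n : nat).

(** log_pos and log_neg are the positive and negative parts of log (1 / |x - y|). *)
Definition log_pos x y : \bar R := LGpos 0 (sqdist x y).
Definition log_neg x y : \bar R := LGneg 0 (sqdist x y).

Lemma log_pos_ge0 x y : 0 <= log_pos x y. Proof. exact: LGpos_ge0. Qed.

Lemma log_posC x y : log_pos x y = log_pos y x.
Proof. by rewrite /log_pos sqdistC. Qed.

Lemma measurable_log_pos :
  measurable_fun setT (fun p : plane R * plane R => log_pos p.1 p.2).
Proof.
apply: (measurable_integral1 (fun (p : plane R * plane R) s => (expR (- (0 * s)) *
   Num.max (loggauss s (sqdist p.1 p.2) - loggauss s 1) 0)%:E)).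
  apply: (measurable_explogmax 0 (s := snd) (b := cst 1%R)) => //.
  apply: (measurable_sqdist (x := fun p => p.1.1) (y := fun p => p.1.2)).
  - exact: measurableT_comp measurable_fst measurable_fst.
  - exact: measurableT_comp measurable_snd measurable_fst.
by move=> z s; exact: explogmax_ge0.
Qed.

Lemma limit_balance (P N A B C : nat -> \bar R) (g p n a b : \bar R) :
  0 <= g -> 0 <= p -> 0 <= n -> 0 <= a -> 0 <= b ->
  P @ \oo --> p -> N @ \oo --> n -> A @ \oo --> a -> B @ \oo --> b -> C @ \oo --> 0 ->
  (\forall i \near \oo, P i + A i + C i = g + N i + B i) -> p + a = g + n + b.
Proof.
move=> g0 p0 n0 a0 b0 cP cN cA cB cC E.
have cL : (fun i => P i + A i + C i) @ \oo --> p + a.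
  rewrite -[X in _ --> X]adde0; apply: cvgeD => //.
    exact: fin_num_adde_defl.
  by apply: cvgeD => //; rewrite ge0_adde_def ?inE.
have cR : (fun i => g + N i + B i) @ \oo --> g + n + b.
  apply: cvgeD => //; first by rewrite ge0_adde_def ?inE ?adde_ge0.
  by apply: cvgeD => //; [rewrite ge0_adde_def ?inE|exact: cvg_cst].
apply: (cvg_unique (@ereal_hausdorff R) cL).
by apply: cvg_trans cR; apply: near_eq_cvg; apply: filterS E => i ->.
Qed.

(** The limit of the resolvent equation when one of the rates vanishes. *)
Lemma log_resolvent_identity l x y : (0 < l)%R ->
  log_pos x y + l%:E * Rop l (log_neg ^~ y) x =
  LG l (sqdist x y) + log_neg x y + l%:E * Rop l (log_pos ^~ y) x.
Proof.
move=> l0; pose e n := (n.+1%:R^-1)%R : R.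
have e0 n : (0 < e n)%R by rewrite invr_gt0.
have el : \forall n \near \oo, (e n < l)%R.
  exists (Num.truncn l^-1) => // n /= Nn.
  rewrite -[ltRHS]invrK ltf_pV2 ?posrE ?invr_gt0//.
  by rewrite (lt_le_trans (truncnS_gt _))// ler_nat.
have cl : (fun n => (l - e n)%:E) @ \oo --> l%:E.
  apply: cvg_EFin; first exact: nearW.
  rewrite -[X in _ --> X]subr0; apply: cvgB; first exact: cvg_cst.
  exact: cvg_harmonic.
have cR (F : R -> R -> \bar R) : (fun n => Rop l (fun z => F (e n) (sqdist z y)) x) @ \oo -->
      Rop l (fun z => F 0%R (sqdist z y)) x ->
    (fun n => (l - e n)%:E * Rop l (fun z => F (e n) (sqdist z y)) x) @ \oo -->
      l%:E * Rop l (fun z => F 0%R (sqdist z y)) x.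
  by move=> cF; apply: cvgeM => //; apply: mule_def_EFin; rewrite gt_eqF.
have cneg := cR LGneg (@cvg_resolvent_laplace R l (cst 1%R) (sqdist ^~ y) x
  (measurable_cst _) (measurable_sqdistl y)).
have cpos := cR LGpos (@cvg_resolvent_laplace R l (sqdist ^~ y) (cst 1%R) x
  (measurable_sqdistl y) (measurable_cst _)).
have R0 (F : R -> R -> \bar R) c : (forall e a, 0 <= F e a) -> (0 <= c)%R ->
    0 <= c%:E * Rop l (fun z => F 0%R (sqdist z y)) x.
  move=> F0 c0; rewrite mule_ge0//.
  exact: (Rop_ge0 l x (fun z => F0 _ _)).
have Rneg0 := R0 LGneg l LGneg_ge0 (ltW l0).
have Rpos0 := R0 LGpos l LGpos_ge0 (ltW l0).
have cC : (fun n => (e n / l)%:E * LG (e n) 1) @ \oo --> 0.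
  rewrite (_ : (fun n => _) = (fun n => (l^-1)%:E * ((e n)%:E * LG (e n) 1))); last first.
    by apply/funext => n; rewrite muleA -EFinM mulrC.
  by rewrite -[X in _ --> X](mule0 (l^-1)%:E); apply: cvgeZl => //; exact: LG1_cvg0.
apply: (@limit_balance (fun n => LGpos (e n) (sqdist x y)) (fun n => LGneg (e n) (sqdist x y))
  (fun n => (l - e n)%:E * Rop l (fun z => LGneg (e n) (sqdist z y)) x)
  (fun n => (l - e n)%:E * Rop l (fun z => LGpos (e n) (sqdist z y)) x)
  (fun n => (e n / l)%:E * LG (e n) 1) _ _ _ _ _ (LG_ge0 _ _) (LGpos_ge0 _ _) (LGneg_ge0 _ _)
  Rneg0 Rpos0 (@cvg_LGpos _ _) (@cvg_LGneg _ _) cneg cpos cC).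
by apply: filterS el => n en; exact: log_resolvent_approx.
Qed.

End logarithmic_kernel.

(** * The nonnegative logarithmic kernel *)

Section moments.
Context {R : realType}.
Implicit Types (a b e l s : R) (x y z : plane R) (n : nat).

(** A zero would make the heat kernel vanish at almost every time, and with it the
kernels of all rates, against recurrence. *)
Lemma green_gt0 l x y : (0 < l)%R -> 0 < green l x y.
Proof.
move=> l0; rewrite lt_neqAle green_ge0 andbT eq_sym; apply/eqP => gl0.
pose g s := (expR (- (l * s)) * heat s x y)%:E.
have mg e : measurable_fun setT (fun s => (expR (- (e * s)) * heat s x y)%:E).
  exact: (measurable_expheat e (s := id) (x := cst x) (y := cst y)).
have : \int[leb1]_s `|g s| = 0.
  by rewrite -[RHS]gl0; apply: eq_integral => s _; rewrite gee0_abs// expheat_ge0.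
move/ae_eq_integral_abs => /(_ measurableT (mg l)) g0.
have green0 n : green n.+1%:R^-1 x y = 0.
  rewrite -(integral0 leb1 setT); apply: ae_eq_integral => //.
  apply: filterS g0 => s /= h /h [] /eqP.
  by rewrite mulf_eq0 gt_eqF ?expR_gt0//= => /eqP ->; rewrite mulr0.
have := @green_recurrent R x y.
rewrite (_ : (fun n => _) = cst 0); last by apply/funext => n; exact: green0.
by move/(cvg_lim (@ereal_hausdorff R)); rewrite lim_cst.
Qed.

(** Half of the exponent absorbs the squared distance, at the cost of doubling the
time. *)
Lemma sqdist_heat_le s x y : (sqdist x y * heat s x y <= 16 * s * heat (2 * s) x y)%R.
Proof.
have [s0|s0] := ltP 0%R s; last first.
  by rewrite /heat pmulr_rgt0// ltNge s0/= !mulr0.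
have s20 : (0 < 2 * s)%R by rewrite mulr_gt0.
rewrite /heat s0 s20; set D := sqdist x y.
have D0 : (0 <= D)%R by exact: sqdist_ge0.
have pi0 : (0 < pi :> R)%R by exact: pi_gt0.
have h : (D * expR (- (D / (8 * s))) <= 8 * s)%R.
  have [->|D1] := eqVneq D 0%R; first by rewrite mul0r mulr_ge0// ltW.
  have Dp : (0 < D)%R by rewrite lt_neqAle eq_sym D1.
  have u0 : (0 < D / (8 * s))%R by rewrite divr_gt0// mulr_gt0.
  apply: (le_trans (ler_wpM2l D0 (expR_le_inv u0))).
  by rewrite le_eqVlt; apply/orP; left; apply/eqP; field; rewrite !gt_eqF.
have -> : expR (- (D / (4 * s))) = (expR (- (D / (8 * s))) * expR (- (D / (8 * s))))%R.
  by rewrite -expRD; congr expR; field; rewrite gt_eqF.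
have -> : (4 * (2 * s) = 8 * s)%R by ring.
have := expR_ge0 (- (D / (8 * s)))%R; set E := expR _ in h * => E0.
move: (pi : R) pi0 => p p0.
rewrite [leLHS](_ : _ = (4 * p * s)^-1 * E * (D * E))%R; last by ring.
rewrite [leRHS](_ : _ = (4 * p * s)^-1 * E * (8 * s))%R; last first.
  by field; rewrite !gt_eqF.
by rewrite ler_wpM2l// mulr_ge0// invr_ge0 !mulr_ge0// ltW.
Qed.

Lemma second_moment l x : (0 < l)%R ->
  Rop l (fun z => (sqdist x z)%:E) x <= (64 / (l * l))%:E.
Proof.
move=> l0; pose h s z := (32 / l)%:E * (expR (- (l / 2 * s)) * heat (2 * s) x z)%:E.
have l320 : (0 <= 32 / l)%R by rewrite divr_ge0// ltW.
have m2 : measurable_fun setT (fun s : R => 2 * s)%R by exact: measurable_funM.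
have mexp : measurable_fun setT (fun s : R => expR (- (l / 2 * s))).
  by apply: measurableT_comp => //; apply: measurableT_comp => //; exact: measurable_funM.
have h0 s z : 0 <= h s z by rewrite mule_ge0// lee_fin mulr_ge0 ?expR_ge0 ?heat_ge0.
have mh : measurable_fun setT (fun p : plane R * R => h p.2 p.1).
  apply: emeasurable_funM => //; apply/measurable_EFinP; apply: measurable_funM.
    exact: measurableT_comp mexp measurable_snd.
  apply: (measurable_heat (s := fun p : plane R * R => (2 * p.2)%R) (x := cst x) (y := fst)) => //.
  exact: measurableT_comp m2 measurable_snd.
apply: (@le_trans _ _ (\int[leb2]_z \int[leb1]_s h s z)).
  apply: ge0_le_integral => //.
  - by move=> z _; rewrite mule_ge0 ?green_ge0// lee_fin sqdist_ge0.
  - apply: emeasurable_funM.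
      exact: (measurableT_comp (measurable_green l) (pair1_measurable x)).
    by apply/measurable_EFinP; exact: (measurable_sqdist (x := cst x) (y := id)).
  - by apply: (measurable_integral1 (fun z s => h s z)).
  - move=> z _; rewrite -ge0_integralZr//; first last.
    + by rewrite lee_fin sqdist_ge0.
    + by move=> s _; exact: expheat_ge0.
    + exact: (measurable_expheat l (s := id) (x := cst x) (y := cst z)).
    apply: ge0_le_integral => //.
    + by move=> s _; rewrite mule_ge0 ?expheat_ge0// lee_fin sqdist_ge0.
    + apply: emeasurable_funM => //.
      exact: (measurable_expheat l (s := id) (x := cst x) (y := cst z)).
    + exact: (measurable_section1 (f := fun z s => h s z) mh z).
    + move=> s _; rewrite /h -!EFinM lee_fin -[leLHS]mulrA (mulrC (heat s x z)).
      apply: (le_trans (ler_wpM2l (expR_ge0 _) (sqdist_heat_le s x z))).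
      have [s0|s0] := ltP 0%R s; last first.
        by rewrite [heat (2 * s) x z]/heat pmulr_rgt0// ltNge s0/= !mulr0.
      have -> : expR (- (l * s)) = (expR (- (l / 2 * s)) * expR (- (l / 2 * s)))%R.
        by rewrite -expRD; congr expR; lra.
      have hs : (s * expR (- (l / 2 * s)) <= 2 / l)%R.
        have u0 : (0 < l / 2 * s)%R by rewrite mulr_gt0// divr_gt0.
        apply: (le_trans (ler_wpM2l (ltW s0) (expR_le_inv u0))).
        by rewrite le_eqVlt; apply/orP; left; apply/eqP; field; rewrite !gt_eqF.
      move: hs; have := expR_ge0 (- (l / 2 * s))%R; set E := expR _ => E0 hs.
      rewrite [leLHS](_ : _ = 16 * E * heat (2 * s) x z * (s * E))%R; last by ring.
      rewrite [leRHS](_ : _ = 16 * E * heat (2 * s) x z * (2 / l))%R; last by ring.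
      by rewrite ler_wpM2l// !mulr_ge0// heat_ge0.
have -> : \int[leb2]_z \int[leb1]_s h s z = \int[leb1]_s \int[leb2]_z h s z.
  exact: (tonelli (m1 := leb2) (m2 := leb1) (fun z s => h s z) mh (fun z s => h0 s z)).
have hE s : \int[leb2]_z h s z =
    (32 / l)%:E * (if (0 < s)%R then expR (- (l / 2 * s)) else 0%R)%:E.
  have mheat : measurable_fun setT (fun z => heat (2 * s) x z).
    exact: (measurable_heat (s := cst (2 * s)%R) (x := cst x) (y := id)).
  rewrite ge0_integralZl_EFin//; first last.
  - by apply/measurable_EFinP; exact: measurable_funM.
  - by move=> z _; rewrite lee_fin mulr_ge0 ?expR_ge0 ?heat_ge0.
  congr (_ * _); under eq_integral do rewrite EFinM.
  rewrite ge0_integralZl_EFin ?expR_ge0//; first last.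
  - exact/measurable_EFinP.
  - by move=> z _; rewrite lee_fin heat_ge0.
  case: ifPn => s0; first by rewrite integral_heat ?mulr_gt0// mule1.
  under eq_integral do rewrite /heat pmulr_rgt0// (negbTE s0).
  by rewrite integral0 mule0.
under eq_integral do rewrite hE.
rewrite ge0_integralZl_EFin//; first last.
- by apply/measurable_EFinP; apply: measurable_fun_ifT => //; exact: measurable_fun_ltr.
- by move=> s _; rewrite lee_fin; case: ifP => // _; exact: expR_ge0.
rewrite integral_exp ?divr_gt0// -EFinM lee_fin le_eqVlt; apply/orP; left; apply/eqP.
by field; rewrite gt_eqF.
Qed.

End moments.

Section kernel.
Context {R : realType}.
Implicit Types (a b e l s : R) (x y z : plane R) (n : nat).

Lemma modulus_ge0 x : (0 <= modulus x)%R.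
Proof. exact: sqrtr_ge0. Qed.

Lemma modulus_sqdist x y : (modulus (x - y) ^+ 2 = sqdist x y)%R.
Proof. by rewrite sqr_sqrtr// addr_ge0// sqr_ge0. Qed.

Lemma sqdist_lt x y e : (0 <= e)%R -> (modulus (x - y) < e)%R = (sqdist x y < e ^+ 2)%R.
Proof.
by move=> e0; rewrite -modulus_sqdist ltr_pXn2r// ?nnegrE// modulus_ge0.
Qed.

Lemma sqdist_le x y e : (0 <= e)%R -> (modulus (x - y) <= e)%R = (sqdist x y <= e ^+ 2)%R.
Proof.
by move=> e0; rewrite -modulus_sqdist ler_pXn2r// ?nnegrE// modulus_ge0.
Qed.

Lemma modulusN x : modulus (- x)%R = modulus x.
Proof. by rewrite /modulus/= !sqrrN. Qed.

Lemma modulusD x y : (modulus (x + y) <= modulus x + modulus y)%R.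
Proof.
have h : (0 <= modulus x + modulus y)%R by rewrite addr_ge0 ?modulus_ge0.
rewrite -(@ler_pXn2r _ 2)// ?nnegrE ?modulus_ge0// sqrrD.
have X := modulus_sqdist x 0%R; have Y := modulus_sqdist y 0%R.
rewrite subr0 in X; rewrite subr0 in Y; rewrite X Y.
have -> : (modulus (x + y) ^+ 2 = sqdist (x + y)%R 0%R)%R.
  by rewrite -modulus_sqdist subr0.
have CS : (x.1 * y.1 + x.2 * y.2 <= modulus x * modulus y)%R.
  have xy0 : (0 <= modulus x * modulus y)%R by rewrite mulr_ge0 ?modulus_ge0.
  have [neg|pos] := leP (x.1 * y.1 + x.2 * y.2)%R 0%R; first exact: le_trans xy0.
  rewrite -(@ler_pXn2r _ 2)// ?nnegrE// ?(ltW pos)// exprMn X Y /sqdist/= !subr0.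
  rewrite -subr_ge0.
  rewrite (_ : _ - _ = (x.1 * y.2 - x.2 * y.1) ^+ 2)%R; first exact: sqr_ge0.
  by ring.
rewrite /sqdist/= !subr0 -mulr_natr.
move: CS; set M := (modulus x * modulus y)%R => CS.
rewrite -subr_ge0 [X in (0 <= X)%R](_ : _ = 2 * (M - (x.1 * y.1 + x.2 * y.2)))%R.
  by rewrite mulr_ge0// subr_ge0.
by ring.
Qed.

Definition logmod x : R := ln (1 + modulus x).

(** The positive part of log |x - y|. *)
Definition far x y : R := (ln (Num.max (sqdist x y) 1) / 2)%R.

(** The logarithmic kernel made nonnegative by a function of x plus a function
of y. *)
Definition kern x y : \bar R := log_pos x y + (logmod x + logmod y - far x y)%:E.

Lemma logmod_ge0 x : (0 <= logmod x)%R.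
Proof. by rewrite ln_ge0// lerDl modulus_ge0. Qed.

Lemma farC x y : far x y = far y x.
Proof. by rewrite /far sqdistC. Qed.

Lemma far_ge0 x y : (0 <= far x y)%R.
Proof. by rewrite divr_ge0// ln_ge0// le_max lexx orbT. Qed.

Lemma log_negE x y : log_neg x y = (far x y)%:E.
Proof.
rewrite /log_neg /far; have [D1|D1] := leP (sqdist x y) 1%R.
  by rewrite LGneg_eq0// ln1 mul0r.
by rewrite LGneg0E// ltW.
Qed.

Lemma farE x y : (1 <= sqdist x y)%R -> far x y = ln (modulus (x - y)%R).
Proof.
move=> D1; rewrite /far max_l// -modulus_sqdist expr2 lnM.
- by lra.
- rewrite posrE lt_neqAle modulus_ge0 andbT eq_sym.
  by apply: contraTneq D1 => m0; rewrite -modulus_sqdist m0 expr0n/= -ltNge ltr01.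
- rewrite posrE lt_neqAle modulus_ge0 andbT eq_sym.
  by apply: contraTneq D1 => m0; rewrite -modulus_sqdist m0 expr0n/= -ltNge ltr01.
Qed.

Lemma log_kernelE x y : log_kernel x y = log_pos x y - (far x y)%:E.
Proof.
rewrite /log_kernel /log_pos; have [xy|xy] := eqVneq x y.
  rewrite xy (_ : sqdist y y = 0%R); last by apply/eqP; rewrite sqdist_eq0.
  rewrite LGpos00 subrr le0_lneNy//=.
  by rewrite lee_fin /modulus/= expr0n/= addr0 sqrtr0.
have D0 : (0 < sqdist x y)%R by rewrite lt_neqAle sqdist_ge0 andbT eq_sym sqdist_eq0.
have m0 : (0 < modulus (x - y))%R.
  rewrite lt_neqAle modulus_ge0 andbT eq_sym; apply: contraTneq D0 => m0.
  by rewrite -modulus_sqdist m0 expr0n/= ltxx.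
rewrite lne_EFin//; have [D1|D1] := leP (sqdist x y) 1%R.
  rewrite LGpos0E// /far max_r// ln1 mul0r sube0 -EFinN; congr _%:E.
  by rewrite -modulus_sqdist expr2 lnM ?posrE//; lra.
by rewrite LGpos_eq0 ?(ltW D1)// farE ?(ltW D1)// sub0e.
Qed.

Lemma logmod_shift x z : (logmod z <= logmod x + ln (1 + modulus (z - x)))%R.
Proof.
rewrite /logmod -lnM ?posrE ?ltr_wpDr ?modulus_ge0//.
rewrite ler_ln ?posrE ?mulr_gt0 ?ltr_wpDr ?modulus_ge0//.
have := modulusD x (z - x)%R; rewrite addrC subrK.
have := mulr_ge0 (modulus_ge0 x) (modulus_ge0 (z - x)%R).
move: (modulus x) (modulus z) (modulus (z - x)%R) => u v w; lra.
Qed.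

(** |x - y| <= (1 + |x|) (1 + |y|). *)
Lemma far_le x y : (far x y <= logmod x + logmod y)%R.
Proof.
have [D1|D1] := leP (sqdist x y) 1%R.
  by rewrite /far max_r// ln1 mul0r addr_ge0 ?logmod_ge0.
rewrite farE ?(ltW D1)// /logmod -lnM ?posrE ?ltr_wpDr ?modulus_ge0//.
have m0 : (0 < modulus (x - y))%R.
  rewrite lt_neqAle modulus_ge0 andbT eq_sym; apply: contraTneq D1 => m0.
  by rewrite -modulus_sqdist m0 expr0n/= -leNgt ler01.
rewrite ler_ln ?posrE ?mulr_gt0 ?ltr_wpDr ?modulus_ge0//.
have := modulusD x (- y)%R; rewrite modulusN.
have := mulr_ge0 (modulus_ge0 x) (modulus_ge0 y).
move: (modulus x) (modulus y) (modulus (x - y)%R) => u v w; lra.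
Qed.

(** 1 + |z - x| is at most twice the maximum of 1 and |z - x|. *)
Lemma logmod_le_far x z : (logmod z <= logmod x + ln 2 + far z x)%R.
Proof.
apply: (le_trans (logmod_shift x z)); rewrite -addrA lerD2l.
have [D1|D1] := leP (sqdist z x) 1%R.
  rewrite /far max_r// ln1 mul0r addr0 ler_ln ?posrE ?ltr_wpDr ?modulus_ge0//.
  by rewrite -natr1 addrC lerD2r sqdist_le// expr1n.
have m1 : (1 <= modulus (z - x))%R.
  by rewrite leNgt sqdist_lt// expr1n -leNgt ltW.
rewrite farE ?(ltW D1)// -lnM ?posrE ?(lt_le_trans ltr01)//.
rewrite ler_ln ?posrE ?mulr_gt0 ?ltr_wpDr ?modulus_ge0//; last exact: lt_le_trans m1.
  by rewrite mulr2n mulrDl mul1r lerD2r.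
by rewrite ler1n.
Qed.

Lemma kern_ge0 x y : 0 <= kern x y.
Proof. by rewrite adde_ge0 ?log_pos_ge0// lee_fin subr_ge0 far_le. Qed.

Lemma kernC x y : kern x y = kern y x.
Proof. by rewrite /kern log_posC farC (addrC (logmod x)). Qed.

Lemma kernE x y : kern x y = log_kernel x y + (logmod x + logmod y)%:E.
Proof. by rewrite log_kernelE -addeA; congr (_ + _); rewrite addrC. Qed.

Lemma measurable_modulus : measurable_fun setT (@modulus R).
Proof.
apply: measurableT_comp; first exact: (continuous_measurable_fun (@sqrt_continuous R)).
by apply: measurable_funD; apply: measurable_funX; [exact: measurable_fst|exact: measurable_snd].
Qed.

Lemma measurable_logmod : measurable_fun setT logmod.
Proof.
apply: measurableT_comp; first exact: measurable_ln.
by apply: measurable_funD => //; exact: measurable_modulus.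
Qed.

Lemma measurable_far : measurable_fun setT (fun p : plane R * plane R => far p.1 p.2).
Proof.
apply: measurable_funM => //; apply: measurableT_comp; first exact: measurable_ln.
by apply: measurable_maxr => //; exact: measurable_sqdist.
Qed.

Lemma measurable_kern : measurable_fun setT (fun p : plane R * plane R => kern p.1 p.2).
Proof.
apply: emeasurable_funD; first exact: measurable_log_pos.
apply/measurable_EFinP; apply: measurable_funB; last exact: measurable_far.
apply: measurable_funD; first exact: measurableT_comp measurable_logmod measurable_fst.
exact: measurableT_comp measurable_logmod measurable_snd.
Qed.

End kernel.

Section kernel_resolvent.
Context {R : realType}.
Implicit Types (a b e l s : R) (x y z : plane R) (n : nat).

(** With t = |z - x|, log (1 + t) <= t <= d + t^2 / d. *)
Lemma logmod_le_sqdist x z d : (0 < d)%R ->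
  (logmod z <= logmod x + d + d^-1 * sqdist x z)%R.
Proof.
move=> d0; apply: (le_trans (logmod_shift x z)); rewrite -addrA lerD2l.
have m0 := modulus_ge0 (z - x)%R.
apply: (@le_trans _ _ (modulus (z - x)%R)).
  by apply: le_ln1Dx; rewrite (lt_le_trans _ m0)// ltrN10.
rewrite sqdistC -modulus_sqdist; move: (modulus _) m0 => t t0.
have [td|/ltW dt] := leP t d.
  by rewrite (le_trans td)// lerDl mulr_ge0 ?sqr_ge0// invr_ge0 ltW.
apply: (@le_trans _ _ (d^-1 * t ^+ 2)%R); last by rewrite lerDr ltW.
by rewrite expr2 mulrA ler_peMl// ler_pdivlMl// mulr1.
Qed.

Lemma resolvent_logmod_le l x d : (0 < l)%R -> (0 < d)%R ->
  l%:E * Rop l (fun z => (logmod z)%:E) x <= (logmod x + d + 64 / (l * d))%:E.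
Proof.
move=> l0 d0; have l00 : 0 <= l%:E by rewrite lee_fin ltW.
have c0 : (0 <= logmod x + d)%R by rewrite addr_ge0 ?logmod_ge0// ltW.
have d10 : (0 <= d^-1)%R by rewrite invr_ge0 ltW.
have mlog : measurable_fun setT (fun z => (logmod z)%:E).
  by apply/measurable_EFinP; exact: measurable_logmod.
have msq : measurable_fun setT (fun z => (sqdist x z)%:E).
  by apply/measurable_EFinP; exact: (measurable_sqdist (x := cst x) (y := id)).
have sq0 z : 0 <= (sqdist x z)%:E by rewrite lee_fin sqdist_ge0.
have H : Rop l (fun z => (logmod z)%:E) x <=
    ((logmod x + d) / l)%:E + (d^-1)%:E * Rop l (fun z => (sqdist x z)%:E) x.
  rewrite -(Rop_cst x l0 c0) -(RopZ l x d10 sq0 msq) -RopD//; last 2 first.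
  - by move=> z; rewrite mule_ge0.
  - exact: emeasurable_funM.
  apply: Rop_le => //.
  - by move=> z; rewrite lee_fin logmod_ge0.
  - by apply: emeasurable_funD => //; exact: emeasurable_funM.
  - by move=> z; rewrite -EFinM -EFinD lee_fin logmod_le_sqdist.
apply: (le_trans (lee_wpmul2l l00 H)).
apply: (@le_trans _ _ (l%:E * (((logmod x + d) / l)%:E + (d^-1)%:E * (64 / (l * l))%:E))).
  by apply: lee_wpmul2l => //; rewrite leeD2l// lee_wpmul2l//; exact: second_moment.
change (l * ((logmod x + d) / l + d^-1 * (64 / (l * l))) <= logmod x + d + 64 / (l * d))%R.
rewrite le_eqVlt; apply/orP; left; apply/eqP.
by field; rewrite !gt_eqF.
Qed.

Definition meanlog l x : R := fine (l%:E * Rop l (fun z => (logmod z)%:E) x).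

Lemma meanlogE l x : (0 < l)%R -> (meanlog l x)%:E = l%:E * Rop l (fun z => (logmod z)%:E) x.
Proof.
move=> l0; rewrite fineK// ge0_fin_numE.
  by apply: (le_lt_trans (resolvent_logmod_le x l0 ltr01)); exact: ltry.
rewrite mule_ge0 ?lee_fin ?(ltW l0)//; apply: Rop_ge0 => z.
by rewrite lee_fin logmod_ge0.
Qed.

Lemma meanlog_ge0 l x : (0 < l)%R -> (0 <= meanlog l x)%R.
Proof.
move=> l0; rewrite fine_ge0// mule_ge0 ?lee_fin ?(ltW l0)//; apply: Rop_ge0 => z.
by rewrite lee_fin logmod_ge0.
Qed.

Lemma meanlog_le l x d : (0 < l)%R -> (0 < d)%R ->
  (meanlog l x <= logmod x + d + 64 / (l * d))%R.
Proof. by move=> l0 d0; rewrite -lee_fin meanlogE//; exact: resolvent_logmod_le. Qed.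

Lemma measurable_kernl y : measurable_fun setT (kern ^~ y).
Proof. exact: (measurable_section2 (f := kern) measurable_kern y). Qed.

Lemma measurable_farl y : measurable_fun setT (fun z => (far z y)%:E).
Proof.
apply/measurable_EFinP.
exact: (measurableT_comp measurable_far (pair2_measurable y)).
Qed.

Lemma measurable_log_posl y : measurable_fun setT (log_pos ^~ y).
Proof. exact: (measurable_section2 (f := log_pos) measurable_log_pos y). Qed.

Lemma log_resolvent_far l x y : (0 < l)%R ->
  log_pos x y + l%:E * Rop l (fun z => (far z y)%:E) x =
  LG l (sqdist x y) + (far x y)%:E + l%:E * Rop l (log_pos ^~ y) x.
Proof.
move=> l0; rewrite -(funext (fun z => log_negE z y)) -log_negE.
exact: log_resolvent_identity.
Qed.

Lemma resolvent_far_fin l x y : (0 < l)%R ->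
  l%:E * Rop l (fun z => (far z y)%:E) x \is a fin_num.
Proof.
move=> l0; have l00 : 0 <= l%:E by rewrite lee_fin ltW.
have mlog : measurable_fun setT (fun z => (logmod z)%:E).
  by apply/measurable_EFinP; exact: measurable_logmod.
have logm0 z : 0 <= (logmod z)%:E by rewrite lee_fin logmod_ge0.
have far0 z : 0 <= (far z y)%:E by rewrite lee_fin far_ge0.
have ly0 := logm0 y.
rewrite ge0_fin_numE; last by rewrite mule_ge0// Rop_ge0.
apply: (@le_lt_trans _ _ (l%:E * (Rop l (fun z => (logmod z)%:E) x + (logmod y / l)%:E))).
  apply: lee_wpmul2l => //; rewrite -(Rop_cst x l0 (logmod_ge0 y)) -RopD//.
  apply: Rop_le => //; first exact: measurable_farl.
    exact: emeasurable_funD.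
  by move=> z; rewrite -EFinD lee_fin far_le.
rewrite ge0_muleDr ?Rop_ge0// ?lee_fin ?divr_ge0 ?logmod_ge0 ?(ltW l0)//.
by rewrite -meanlogE// -EFinM -EFinD ltry.
Qed.

Lemma kern_algebra (K P G p : \bar R) (F f m lx ly : R) :
  0 <= K -> 0 <= P -> 0 <= G -> 0 <= p ->
  K + F%:E = P + (m%:E + ly%:E) -> p + F%:E = G + f%:E + P ->
  K + G + lx%:E = p + (lx + ly - f)%:E + m%:E.
Proof.
case: P => [P| |]//; last first.
  by move=> K0 _ G0 p0; case: K K0 => [K| |]//; case: p p0 => [p| |]//; case: G G0.
case: K => [K| |]// _ _; case: G => [G| |]//; case: p => [p| |]// _ _.
by rewrite -!EFinD => -[A] [B]; congr _%:E; lra.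
Qed.

(** The difference k - l R_l k for k = kern ^~ y is 2 pi times the resolvent kernel
with pole y, up to a correction that does not depend on y. *)
Lemma kern_resolvent l x y : (0 < l)%R ->
  l%:E * Rop l (kern ^~ y) x + LG l (sqdist x y) + (logmod x)%:E =
  kern x y + (meanlog l x)%:E.
Proof.
move=> l0; have l00 : 0 <= l%:E by rewrite lee_fin ltW.
have mlog : measurable_fun setT (fun z => (logmod z)%:E).
  by apply/measurable_EFinP; exact: measurable_logmod.
have logm0 z : 0 <= (logmod z)%:E by rewrite lee_fin logmod_ge0.
have far0 z : 0 <= (far z y)%:E by rewrite lee_fin far_ge0.
have mfar := measurable_farl y.
have mpos := measurable_log_posl y.
have mker := measurable_kernl y.
have pos0 z : 0 <= log_pos z y := log_pos_ge0 z y.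
have ker0 z : 0 <= kern z y := kern_ge0 z y.
have C0 : 0 <= (logmod y)%:E by [].
(* adding the far part avoids a subtraction of averages that may be infinite *)
have A : Rop l (kern ^~ y) x + Rop l (fun z => (far z y)%:E) x =
   Rop l (log_pos ^~ y) x + (Rop l (fun z => (logmod z)%:E) x + (logmod y / l)%:E).
  rewrite -(Rop_cst x l0 (logmod_ge0 y)).
  have E1 : Rop l (fun z => (logmod z)%:E) x + Rop l (fun=> (logmod y)%:E) x =
      Rop l (fun z => (logmod z)%:E + (logmod y)%:E) x by exact/esym/RopD.
  have E2 : Rop l (log_pos ^~ y) x + Rop l (fun z => (logmod z)%:E + (logmod y)%:E) x =
      Rop l (fun z => log_pos z y + ((logmod z)%:E + (logmod y)%:E)) x.
    apply/esym/RopD => //; first by move=> z; rewrite adde_ge0.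
    exact: emeasurable_funD.
  have E3 : Rop l (kern ^~ y) x + Rop l (fun z => (far z y)%:E) x =
      Rop l (fun z => kern z y + (far z y)%:E) x by exact/esym/RopD.
  rewrite E1 E2 E3; congr (Rop l _ x); apply/funext => z.
  by rewrite /kern -addeA -EFinD subrK EFinD.
have B : log_pos x y + l%:E * Rop l (fun z => (far z y)%:E) x =
    LG l (sqdist x y) + (far x y)%:E + l%:E * Rop l (log_pos ^~ y) x.
  exact: log_resolvent_far.
have Rfar_fin := resolvent_far_fin x y l0.
have A' : l%:E * Rop l (kern ^~ y) x + l%:E * Rop l (fun z => (far z y)%:E) x =
    l%:E * Rop l (log_pos ^~ y) x + ((meanlog l x)%:E + (logmod y)%:E).
  have -> : (logmod y)%:E = l%:E * (logmod y / l)%:E.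
    by rewrite -EFinM mulrCA divff ?mulr1// gt_eqF.
  have yl0 : 0 <= (logmod y / l)%:E by rewrite lee_fin divr_ge0 ?logmod_ge0// ltW.
  rewrite meanlogE// -(ge0_muleDr _ (Rop_ge0 _ _ logm0) yl0).
  rewrite -(ge0_muleDr _ (Rop_ge0 _ _ ker0) (Rop_ge0 _ _ far0)) A.
  by rewrite (ge0_muleDr _ (Rop_ge0 _ _ pos0) (adde_ge0 (Rop_ge0 _ _ logm0) yl0)).
move: A' B; rewrite -(fineK Rfar_fin).
have K0 := mule_ge0 l00 (Rop_ge0 l x ker0).
have P0 := mule_ge0 l00 (Rop_ge0 l x pos0).
exact: (kern_algebra (logmod x) K0 P0 (LG_ge0 _ _) (log_pos_ge0 _ _)).
Qed.

Lemma small_rate_algebra (K K0 G G0 k k0 : \bar R) (c lx ly m : R) :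
  0 <= K -> 0 <= k -> 0 <= G -> 0 <= k0 -> G0 \is a fin_num -> K0 \is a fin_num ->
  K + G + lx%:E = k + m%:E -> K0 + G0 + lx%:E = k0 + m%:E ->
  G0 <= G + (lx + ly)%:E -> K0 <= c%:E -> K <= k + (lx + ly + c)%:E.
Proof.
case: k => [k| |]//; last by move=> *; rewrite addye// leey.
case: K => [K| |]//; last by case: G.
case: G => [G| |]//; case: G0 => [G0| |]//; case: K0 => [K0| |]//; case: k0 => [k0| |]//.
rewrite -!EFinD !lee_fin => _ _ _ k00 _ _ [A] [B] h1 h2; lra.
Qed.

Lemma LG9_gt0 : (0 < fine (LG (1%R : R) 9%R))%R.
Proof.
have pi20 : (0 < 2 * pi :> R)%R by rewrite mulr_gt0// pi_gt0.
rewrite -lte_fin fineK; last exact: (LG_fin (R := R)).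
have -> : LG (1%R : R) 9%R = LG 1%R (@sqdist R (0%R, 0%R) (3%R, 0%R)).
  by congr (LG _ _); rewrite /sqdist/=; ring.
by rewrite LG_green mule_gt0// ?lte_fin//; exact: green_gt0.
Qed.

(** On the annulus 1 <= |z - x| <= 3 all kernels e r_e, with e > 0, are bounded by one
multiple of r_1. *)
Lemma scaled_resolvent_annulus e (f : plane R -> \bar R) x : (0 < e)%R ->
  (forall z, 0 <= f z) -> measurable_fun setT f ->
  (forall z, f z != 0 -> (1 <= sqdist x z <= 9)%R) ->
  e%:E * Rop e f x <= (2 / fine (LG (1%R : R) 9%R))%:E * Rop 1%R f x.
Proof.
move=> e0 f0 mf fann; have e00 : 0 <= e%:E by rewrite lee_fin ltW.
have pi20 : (0 < 2 * pi :> R)%R by rewrite mulr_gt0// pi_gt0.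
have LG9fin : LG (1%R : R) 9%R \is a fin_num by exact: (LG_fin (R := R)).
have := LG9_gt0; set c9 := fine _ => c90.
have c920 : (0 <= 2 / c9)%R by rewrite divr_ge0// ltW.
have gf0 a c z : (0 <= c)%R -> 0 <= green a x z * (c%:E * f z).
  by move=> c0; rewrite mule_ge0 ?green_ge0// mule_ge0.
have mgf a c : measurable_fun setT (fun z => green a x z * (c%:E * f z)).
  apply: emeasurable_funM; last exact: emeasurable_funM.
  exact: (measurableT_comp (measurable_green a) (pair1_measurable x)).
rewrite -(RopZ e x (ltW e0) f0 mf) -(RopZ 1%R x c920 f0 mf).
apply: (@ge0_le_integral _ _ _ leb2 setT measurableT _ _ (fun z _ => gf0 e e z (ltW e0)) (mgf e e) (mgf 1%R _)).
move=> z _; have [->|/fann/andP[l1 l9]] := eqVneq (f z) 0; first by rewrite !mule0.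
rewrite !muleA lee_wpmul2r// -(@lee_pmul2l _ (2 * pi)%:E)// ?lte_fin//.
rewrite !muleA -!LG_green muleC [leRHS]muleC.
apply: (@le_trans _ _ 2%:E).
  apply: (@le_trans _ _ (e%:E * (2 / (e * sqdist x z))%:E)).
    by rewrite lee_wpmul2l// LG_le// (lt_le_trans ltr01).
  have d0 : (0 < sqdist x z)%R by exact: lt_le_trans l1.
  rewrite -EFinM lee_fin [leLHS](_ : _ = 2 / sqdist x z)%R; last by field; rewrite !gt_eqF.
  by rewrite ler_pdivrMr// ler_peMr.
apply: (@le_trans _ _ ((2 / c9)%:E * LG (1%R : R) 9%R)).
  by rewrite -(fineK LG9fin) -EFinM lee_fin -/c9 divfK// gt_eqF.
by apply: lee_wpmul2l; [rewrite lee_fin|exact: le_LG].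
Qed.

(** As the rate vanishes the mean of the kernel grows at a speed that does not
depend on the pole; it is measured at an auxiliary pole at distance 2. *)
Lemma kern_small_rate x : exists C : R, forall n y,
  (n.+1%:R^-1)%:E * Rop n.+1%:R^-1 (kern ^~ y) x <=
  kern x y + (logmod x + logmod y + C)%:E.
Proof.
pose y0 : plane R := ((x.1 + 2)%R, x.2).
have D4 : sqdist x y0 = 4%R by rewrite /sqdist/=; ring.
have m2 : modulus (x - y0)%R = 2%R.
  apply/eqP; rewrite -(@eqrXn2 _ 2)// ?modulus_ge0//; apply/eqP.
  by rewrite modulus_sqdist D4; ring.
pose c9 := fine (LG (1%R : R) 9%R).
have c90 : (0 < c9)%R := LG9_gt0.
have pos0 z : 0 <= log_pos z y0 := log_pos_ge0 z y0.
have mpos := measurable_log_posl y0.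
have R1fin : Rop 1%R (log_pos ^~ y0) x \is a fin_num.
  rewrite ge0_fin_numE ?Rop_ge0//.
  have := log_resolvent_far x y0 ltr01; rewrite !mul1e => E.
  apply: (@le_lt_trans _ _ (log_pos x y0 + Rop 1%R (fun z => (far z y0)%:E) x)).
    by rewrite E leeDr// adde_ge0 ?LG_ge0// lee_fin far_ge0.
  have -> : log_pos x y0 = 0 by rewrite /log_pos LGpos_eq0// D4 ler1n.
  rewrite add0e -ge0_fin_numE.
    by have := resolvent_far_fin x y0 ltr01; rewrite mul1e.
  by apply: Rop_ge0 => z; rewrite lee_fin far_ge0.
pose c0 := (2 * logmod y0 + ln 2)%R.
have c00 : (0 <= c0)%R by rewrite addr_ge0 ?mulr_ge0 ?logmod_ge0// ln_ge0// ler1n.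
have kern_le z : kern z y0 <= log_pos z y0 + c0%:E.
  rewrite /kern leeD2l// lee_fin /c0.
  by have := logmod_le_far y0 z; lra.
have ker0 z : 0 <= kern z y0 := kern_ge0 z y0.
have K0 n : (n.+1%:R^-1)%:E * Rop n.+1%:R^-1 (kern ^~ y0) x <=
    (2 / c9 * fine (Rop 1%R (log_pos ^~ y0) x) + c0)%:E.
  set e := (n.+1%:R^-1)%R; have e0 : (0 < e)%R by rewrite invr_gt0.
  have e00 : 0 <= e%:E by rewrite lee_fin ltW.
  have c920 : (0 <= 2 / c9)%R by rewrite divr_ge0// ltW.
  have key : e%:E * Rop e (log_pos ^~ y0) x <= (2 / c9)%:E * Rop 1%R (log_pos ^~ y0) x.
    apply: scaled_resolvent_annulus => // z posz.
    have D1 : (sqdist z y0 < 1)%R.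
      by rewrite ltNge; apply: contra posz => D1; apply/eqP; exact: LGpos_eq0.
    have mz : (modulus (z - y0) <= 1)%R by rewrite sqdist_le// expr1n ltW.
    apply/andP; split.
      rewrite leNgt -[ltRHS](expr1n _ 2) -sqdist_lt//; apply/negP => xz.
      have := modulusD (x - z)%R (z - y0)%R; rewrite addrA subrK m2.
      by move: (modulus _) (modulus _) xz mz => u v; lra.
    have -> : (9 = 3 ^+ 2 :> R)%R by ring.
    rewrite -sqdist_le//.
    have := modulusD (x - y0)%R (y0 - z)%R; rewrite addrA subrK m2.
    rewrite -(modulusN (y0 - z)%R) opprB.
    by move: (modulus _) (modulus _) mz => u v; lra.
  apply: (@le_trans _ _ (e%:E * Rop e (fun z => log_pos z y0 + c0%:E) x)).
    apply: lee_wpmul2l => //; apply: Rop_le => //; first exact: measurable_kernl.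
    exact: emeasurable_funD.
  rewrite (@RopD _ e _ (fun=> c0%:E) x pos0 (fun=> c00) mpos (measurable_cst _)) Rop_cst//.
  have ce0 : 0 <= (c0 / e)%:E by rewrite lee_fin divr_ge0// ltW.
  rewrite (ge0_muleDr _ (Rop_ge0 _ _ pos0) ce0) -EFinM mulrCA divff ?mulr1 ?gt_eqF//.
  apply: (le_trans (leeD2r _ key)).
  move: R1fin; move: (Rop 1%R (log_pos ^~ y0) x) => W Wfin.
  by rewrite -[W in leLHS](fineK Wfin) -EFinM -EFinD.
exists (2 / c9 * fine (Rop 1%R (log_pos ^~ y0) x) + c0)%R => n y.
set e := (n.+1%:R^-1)%R; have e0 : (0 < e)%R by rewrite invr_gt0.
have e00 : 0 <= e%:E by rewrite lee_fin ltW.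
have nn y' : 0 <= e%:E * Rop e (kern ^~ y') x.
  by rewrite mule_ge0// Rop_ge0// => z; exact: kern_ge0.
apply: (@small_rate_algebra _ (e%:E * Rop e (kern ^~ y0) x) (LG e (sqdist x y))
   (LG e (sqdist x y0)) (kern x y) (kern x y0) _ (logmod x) (logmod y) (meanlog e x)) => //.
- exact: kern_ge0.
- exact: LG_ge0.
- by rewrite D4; apply: LG_fin.
- by rewrite ge0_fin_numE// (le_lt_trans (K0 n)) ?ltry.
- exact: kern_resolvent.
- exact: kern_resolvent.
- have D14 : (1 <= sqdist x y0)%R by rewrite D4 ler1n.
  apply: (le_trans (le_LG e D14)).
  apply: (@le_trans _ _ (LG e 1 + LGpos e (sqdist x y))); first by rewrite leeDl// LGpos_ge0.
  rewrite -LG_pos_neg; apply: leeD2l; apply: (le_trans (LGneg_le _ (ltW e0))).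
  by rewrite -/(log_neg x y) log_negE lee_fin far_le.
- exact: K0.
Qed.

End kernel_resolvent.

(** * Lower semicontinuity *)

Section lower_semicontinuity.
Context {R : realType}.
Implicit Types (c e l s : R) (x y z : plane R) (h f g : plane R -> \bar R).

Lemma real_between (a b : \bar R) : a < b -> exists c : R, a < c%:E /\ c%:E < b.
Proof.
case: a b => [a| |] [b| |]//; rewrite ?lte_fin => ab.
- by exists ((a + b) / 2)%R; rewrite !lte_fin; split; lra.
- by exists (a + 1)%R; rewrite ltry lte_fin; split => //; lra.
- by exists (b - 1)%R; rewrite ltNyr lte_fin; split => //; lra.
- by exists 0%R; rewrite ltry ltNyr.
Qed.

Lemma le_limn_einf (t : \bar R) (u : nat -> \bar R) :
  (forall c, c%:E < t -> \forall n \near \oo, c%:E < u n) -> t <= limn_einf u.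
Proof.
move=> ut; rewrite leNgt; apply/negP => /real_between[c [Lc ct]].
have [N _ Nu] := ut _ ct.
have : c%:E <= limn_einf u.
  rewrite limn_einf_lim; apply: lime_ge; first exact: is_cvg_einfs.
  exists N => // n /= Nn; apply: le_ereal_inf_tmp => _ [m /= nm <-].
  by apply/ltW/Nu; exact: leq_trans nm.
by rewrite leNgt Lc.
Qed.

Lemma limn_einf_le (t : \bar R) (u : nat -> \bar R) :
  (forall n, u n <= t) -> limn_einf u <= t.
Proof.
move=> ut; rewrite limn_einf_lim; apply: lime_le; first exact: is_cvg_einfs.
by apply: nearW => n; apply: le_trans (ut n); apply: ereal_inf_lbound; exists n => /=.
Qed.

(** The pointwise form of lower_semicontinuous. *)
Definition lsc h x := forall c : R, c%:E < h x -> \forall z \near x, c%:E < h z.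

Lemma lsc_seq h x (z : nat -> plane R) : lsc h x -> z @ \oo --> x ->
  h x <= limn_einf (h \o z).
Proof. by move=> hx zx; apply: le_limn_einf => c /hx; exact: zx. Qed.

Lemma seq_lsc h x : (forall z : nat -> plane R, z @ \oo --> x -> h x <= limn_einf (h \o z)) ->
  lsc h x.
Proof.
move=> hseq c chx; apply: contrapT => nn.
have H n : exists z, ball x (n.+1%:R^-1)%R z /\ h z <= c%:E.
  apply: contrapT => nz; apply: nn; apply/nbhs_ballP.
  exists (n.+1%:R^-1)%R; first by rewrite /= invr_gt0.
  by move=> z bz /=; rewrite ltNge; apply/negP => hz; apply: nz; exists z.
have [z Hz] := choice H.
have zx : z @ \oo --> x.
  apply/cvg_ballP => e e0; near=> n.
  apply: (@le_ball _ _ _ (n.+1%:R^-1)%R); last exact: (Hz n).1.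
  rewrite ltW//; near: n; exact: (near_infty_natSinv_lt (PosNum e0)).
have := hseq z zx; rewrite leNgt => /negP; apply.
by apply: le_lt_trans chx; apply: limn_einf_le => n; exact: (Hz n).2.
Unshelve. all: by end_near.
Qed.

Lemma lscD f g x : (forall z, 0 <= f z) -> (forall z, 0 <= g z) ->
  lsc f x -> lsc g x -> lsc (fun z => f z + g z) x.
Proof.
rewrite /lsc => f0 g0 + + c.
case: (f x) (f0 x) => [u| |]//= u0 lf; last first.
  by move=> _ _; apply: filterS (lf c (ltry _)) => z cz; rewrite (lt_le_trans cz)// leeDl.
case: (g x) (g0 x) => [v| |]//= v0 lg; last first.
  by move=> _; apply: filterS (lg c (ltry _)) => z cz; rewrite (lt_le_trans cz)// leeDr.
rewrite -EFinD lte_fin => cuv; pose e := ((u + v - c) / 2)%R.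
have ue : (u - e)%:E < u%:E by rewrite lte_fin /e; lra.
have ve : (v - e)%:E < v%:E by rewrite lte_fin /e; lra.
apply: filterS2 (lf _ ue) (lg _ ve) => z fz gz.
have -> : c = ((u - e) + (v - e))%R by rewrite /e; lra.
by rewrite EFinD lteD.
Qed.

Lemma lsc_min f g x : lsc f x -> lsc g x -> lsc (fun z => mine (f z) (g z)) x.
Proof.
move=> lf lg c; rewrite lt_min => /andP[cf cg].
by apply: filterS2 (lf c cf) (lg c cg) => z cfz cgz; rewrite lt_min cfz cgz.
Qed.

Lemma lsc_EFin (g : plane R -> R) x : {for x, continuous g} -> lsc (fun z => (g z)%:E) x.
Proof.
move=> cg c; rewrite lte_fin => cgx; apply: filterS (cvgr_gt _ cg c cgx) => z.
by rewrite lte_fin.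
Qed.

(** Fatou's lemma along the sequences that converge to x. *)
Lemma lsc_integral d (T : measurableType d) (a : {measure set T -> \bar R})
    (f : plane R -> T -> \bar R) x : (forall z t, 0 <= f z t) ->
  (forall z, measurable_fun setT (f z)) -> (forall t, lsc (f ^~ t) x) ->
  lsc (fun z => \int[a]_t f z t) x.
Proof.
move=> f0 mf lf; apply: seq_lsc => z zx.
have F := fatou a measurableT (fun n => mf (z n)) (fun n t _ => f0 (z n) t).
apply: le_trans F; apply: ge0_le_integral => //.
- apply: (measurableT_comp (f := -%E) (g := fun t => limn_esup (fun n => - f (z n) t))) => //.
  by apply: measurable_fun_limn_esup => n; exact: measurableT_comp.
- by move=> t _; exact: (lsc_seq (lf t) zx).
Qed.

Lemma continuous_sqdist y : continuous (sqdist ^~ y).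
Proof.
move=> x; apply: cvgD; (apply: cvgM; (apply: cvgB; [|exact: cvg_cst]));
  by [exact: cvg_fst|exact: cvg_snd].
Qed.

Lemma lsc_green l y x : lsc (fun z => green l z y) x.
Proof.
apply: lsc_integral.
- by move=> z s; exact: expheat_ge0.
- by move=> z; exact: (measurable_expheat l (s := id) (x := cst z) (y := cst y)).
move=> s; apply: lsc_EFin; apply: cvgM; first exact: cvg_cst.
rewrite /heat; case: (0 < s)%R; last exact: cvg_cst.
apply: cvgM; first exact: cvg_cst.
apply: continuous_comp; last exact: continuous_expR.
apply: (@continuousN _ R^o); apply: cvgM; last exact: cvg_cst.
exact: continuous_sqdist.
Qed.

Lemma continuous_loggauss s y x : {for x, continuous (fun z => loggauss s (sqdist z y))}.
Proof.
rewrite /loggauss; case: (0 < s)%R; last exact: cvg_cst.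
apply: cvgM; first exact: cvg_cst.
apply: continuous_comp; last exact: continuous_expR.
apply: (@continuousN _ R^o); apply: cvgM; last exact: cvg_cst.
exact: continuous_sqdist.
Qed.

Lemma lsc_log_pos y x : lsc (fun z => log_pos z y) x.
Proof.
apply: lsc_integral.
- by move=> z s; exact: explogmax_ge0.
- move=> z.
  exact: (measurable_explogmax 0 (s := id) (a := cst (sqdist z y)) (b := cst 1%R)).
move=> s; apply: lsc_EFin; apply: cvgM; first exact: cvg_cst.
apply: (@continuous_max R (plane R)); last exact: cvg_cst.
by apply: cvgB; [exact: continuous_loggauss|exact: cvg_cst].
Qed.

Lemma continuous_logmod : continuous (@logmod R).
Proof.
move=> x; apply: continuous_comp.
  apply: cvgD; first exact: cvg_cst.
  apply: (@continuous_comp _ _ _ (fun z : plane R => z.1 ^+ 2 + z.2 ^+ 2)%R Num.sqrt);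
    last exact: sqrt_continuous.
  by apply: cvgD; (apply: cvgM; by [exact: cvg_fst|exact: cvg_snd]).
by apply: continuous_ln; rewrite ltr_wpDr// modulus_ge0.
Qed.

Lemma continuous_far y : continuous (far ^~ y).
Proof.
move=> x; apply: cvgM; last exact: cvg_cst.
apply: (@continuous_comp _ _ _ (fun z : plane R => Num.max (sqdist z y) 1%R) (@ln R)).
  apply: (@continuous_max R (plane R)); last exact: cvg_cst.
  exact: continuous_sqdist.
by apply: continuous_ln; rewrite lt_max ltr01 orbT.
Qed.

Lemma lsc_kern y x : lsc (fun z => kern z y) x.
Proof.
apply: lscD.
- by move=> z; exact: log_pos_ge0.
- by move=> z; rewrite lee_fin subr_ge0 far_le.
- exact: lsc_log_pos.
- apply: lsc_EFin; apply: cvgB; last exact: continuous_far.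
  by apply: cvgD; [exact: continuous_logmod|exact: cvg_cst].
Qed.

End lower_semicontinuity.

(** * Potentials of measures *)

Section kernel_potential.
Context {R : realType}.
Implicit Types (c e l s : R) (x y z : plane R).
Implicit Types a b : {finite_measure set (plane R) -> \bar R}.
Local Notation U := (@resolvent_potential _ (plane R) R (@green R)).

(** By the second moment, the mass of the resolvent concentrates at the point as the
rate grows. *)
Lemma lsc_approached (h : plane R -> \bar R) x : (forall z, 0 <= h z) ->
  measurable_fun setT h -> lsc h x -> approached_from_below (@leb2 R) (@green R) h x.
Proof.
move=> h0 mh lh c ch.
have [c0|c0] := ltP c 0%R.
  apply: nearW => n; apply: (@lt_le_trans _ _ 0); first by rewrite lte_fin.
  by apply: mule_ge0; [rewrite lee_fin|exact: Rop_ge0].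
have [c' [cc' c'h]] := real_between ch; rewrite lte_fin in cc'.
have c'0 : (0 < c')%R by exact: le_lt_trans cc'.
have /nbhs_ballP[d /= d0 dh] := lh c' c'h.
have ineq z : c'%:E <= h z + (c' / d ^+ 2)%:E * (sqdist x z)%:E.
  have k0 : (0 <= c' / d ^+ 2)%R by rewrite divr_ge0 ?sqr_ge0// ltW.
  have sq0 : 0 <= (c' / d ^+ 2)%:E * (sqdist x z)%:E.
    by rewrite -EFinM lee_fin mulr_ge0// sqdist_ge0.
  have [near|far] := ltP (sqdist x z) (d ^+ 2)%R.
    apply: (@le_trans _ _ (h z)); last by rewrite leeDl.
    apply/ltW/dh; rewrite /ball/= /ball/=; split => /=.
      rewrite /ball/= -(@ltr_pXn2r _ 2)// ?nnegrE// ?(ltW d0)//.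
      by rewrite real_normK ?num_real// (le_lt_trans _ near)// lerDl sqr_ge0.
    rewrite /ball/= -(@ltr_pXn2r _ 2)// ?nnegrE// ?(ltW d0)//.
    by rewrite real_normK ?num_real// (le_lt_trans _ near)// lerDr sqr_ge0.
  apply: (@le_trans _ _ ((c' / d ^+ 2)%:E * (sqdist x z)%:E)); last by rewrite leeDr.
  by rewrite -EFinM lee_fin mulrAC ler_pdivlMr ?exprn_gt0// ler_wpM2l// ltW.
(* by second_moment the averages of c' / d^2 * sqdist are below c' - c beyond M *)
pose M := (64 * (c' / d ^+ 2) / (c' - c))%R.
have k0 : (0 <= c' / d ^+ 2)%R by rewrite divr_ge0 ?sqr_ge0// ltW.
exists (Num.truncn M).+1 => // n /= Mn.
have nM : (M < n%:R)%R by rewrite (lt_le_trans (truncnS_gt _))// ler_nat.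
have cc0 : (0 < c' - c)%R by rewrite subr_gt0.
have n0 : (0 < n%:R :> R)%R.
  apply: le_lt_trans nM; apply: divr_ge0; last exact: ltW.
  exact: mulr_ge0.
have msq : measurable_fun setT (fun z => (sqdist x z)%:E).
  by apply/measurable_EFinP; exact: (measurable_sqdist (x := cst x) (y := id)).
have sq0 z : 0 <= (sqdist x z)%:E by rewrite lee_fin sqdist_ge0.
have n00 : 0 <= n%:R%:E :> \bar R by rewrite lee_fin.
have H : (c' / n%:R)%:E <= Rop n%:R h x + (c' / d ^+ 2)%:E * (64 / (n%:R * n%:R))%:E.
  rewrite -(Rop_cst x n0 (ltW c'0)).
  apply: (@le_trans _ _ (Rop n%:R (fun z => h z + (c' / d ^+ 2)%:E * (sqdist x z)%:E) x)).
    apply: Rop_le => //; first by move=> z; rewrite lee_fin ltW.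
    by apply: emeasurable_funD => //; exact: emeasurable_funM.
  rewrite RopD//; last 2 first.
  - by move=> z; rewrite mule_ge0.
  - exact: emeasurable_funM.
  by rewrite RopZ// leeD2l// lee_wpmul2l//; exact: second_moment.
move: H; have := Rop_ge0 n%:R x h0; case: (Rop n%:R h x) => [v| |]//; last first.
  by move=> _ _; rewrite gt0_muley ?lte_fin// ltry.
rewrite -!EFinM -EFinD !lee_fin lte_fin => v0 H.
have H2 : (c' <= n%:R * v + (c' / d ^+ 2) * 64 / n%:R)%R.
  have := ler_wpM2l (ltW n0) H; rewrite mulrCA divff ?gt_eqF// mulr1.
  rewrite mulrDr => /le_trans; apply; rewrite lerD2l le_eqVlt; apply/orP; left; apply/eqP.
  by field; rewrite !gt_eqF.
have H3 : ((c' / d ^+ 2) * 64 / n%:R < c' - c)%R.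
  by rewrite ltr_pdivrMr// [ltLHS]mulrC [ltRHS]mulrC -ltr_pdivrMr.
lra.
Qed.

Definition kpot (a : set (plane R) -> \bar R) x := \int[a]_y kern x y.

Lemma kpot_ge0 a x : 0 <= kpot a x.
Proof. by apply: integral_ge0 => y _; exact: kern_ge0. Qed.

Lemma measurable_kernr x : measurable_fun setT (kern x).
Proof. exact: (measurable_section1 (f := kern) measurable_kern x). Qed.

Lemma measurable_kpot a : measurable_fun setT (kpot a).
Proof. exact: (measurable_integral1 (m2 := a) kern measurable_kern kern_ge0). Qed.

Lemma lsc_kpot a x : lsc (kpot a) x.
Proof.
apply: lsc_integral => [z y|z|y]; [exact: kern_ge0|exact: measurable_kernr|exact: lsc_kern].
Qed.

Lemma resolvent_kpot l a x : Rop l (kpot a) x = \int[a]_y Rop l (kern ^~ y) x.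
Proof.
have mgx : measurable_fun setT (green l x).
  exact: (measurableT_comp (measurable_green l) (pair1_measurable x)).
have mh : measurable_fun setT (fun p : plane R * plane R => green l x p.1 * kern p.1 p.2).
  apply: emeasurable_funM; last exact: measurable_kern.
  exact: measurableT_comp mgx measurable_fst.
have h0 z y : 0 <= green l x z * kern z y by exact: mule_ge0 (green_ge0 _ _ _) (kern_ge0 _ _).
transitivity (\int[leb2]_z \int[a]_y (green l x z * kern z y)).
  apply: eq_integral => z _; apply/esym/ge0_integralZl.
  - exact: measurableT.
  - exact: measurable_kernr.
  - by move=> y _; exact: kern_ge0.
  - exact: green_ge0.
exact: (tonelli (m1 := leb2) (m2 := a) (fun z y => green l x z * kern z y) mh h0).
Qed.

Lemma measurable_resolvent_kern l x : measurable_fun setT (fun y => Rop l (kern ^~ y) x).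
Proof.
apply: (measurable_integral2 (m1 := leb2) (fun z y => green l x z * kern z y)).
  apply: emeasurable_funM; last exact: measurable_kern.
  apply: measurableT_comp _ measurable_fst.
  exact: (measurableT_comp (measurable_green l) (pair1_measurable x)).
by move=> z y; exact: mule_ge0 (green_ge0 _ _ _) (kern_ge0 _ _).
Qed.

Definition mass a : R := fine (a setT).

Lemma massE a : (mass a)%:E = a setT.
Proof. by rewrite fineK// fin_num_measure. Qed.

Lemma mass_ge0 a : (0 <= mass a)%R.
Proof. by rewrite fine_ge0. Qed.

Lemma integral_cst_mass a c : (0 <= c)%R -> \int[a]_y c%:E = (mass a * c)%:E.
Proof. by move=> c0; rewrite integral_cst// EFinM massE muleC. Qed.

(** The identity that logarithmic_domination requires, obtained by integrating
kern_resolvent: the correction terms depend on the measure through its mass only. *)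
Lemma kpot_resolvent l a x : (0 < l)%R ->
  l%:E * Rop l (kpot a) x + (2 * pi)%:E * U l a x + (mass a * logmod x)%:E =
  kpot a x + (mass a * meanlog l x)%:E.
Proof.
move=> l0; have pi20 : (0 <= 2 * pi :> R)%R by rewrite mulr_ge0// pi_ge0.
have mRk := measurable_resolvent_kern l x.
have Rk0 y : 0 <= Rop l (kern ^~ y) x by apply: Rop_ge0 => z; exact: kern_ge0.
have mgx : measurable_fun setT (green l x).
  exact: (measurableT_comp (measurable_green l) (pair1_measurable x)).
have mk := measurable_kernr x.
rewrite -(integral_cst_mass a (logmod_ge0 x)) -(integral_cst_mass a (meanlog_ge0 x l0)).
have E1 : l%:E * Rop l (kpot a) x = \int[a]_y (l%:E * Rop l (kern ^~ y) x).
  rewrite resolvent_kpot; apply/esym/ge0_integralZl_EFin.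
  - exact: measurableT.
  - by move=> y _; exact: Rk0.
  - exact: mRk.
  - exact: ltW.
have E2 : (2 * pi)%:E * U l a x = \int[a]_y LG l (sqdist x y).
  transitivity (\int[a]_y ((2 * pi)%:E * green l x y)).
    apply/esym/ge0_integralZl_EFin.
    - exact: measurableT.
    - by move=> y _; exact: green_ge0.
    - exact: mgx.
    - exact: pi20.
  by apply: eq_integral => y _; rewrite LG_green.
have mLG : measurable_fun setT (fun y => LG l (sqdist x y)).
  by under eq_fun do rewrite LG_green; exact: emeasurable_funM.
have lRk0 y : 0 <= l%:E * Rop l (kern ^~ y) x.
  by apply: mule_ge0; [rewrite lee_fin ltW|exact: Rk0].
have mlRk : measurable_fun setT (fun y => l%:E * Rop l (kern ^~ y) x).
  exact: emeasurable_funM.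
have lx0 : 0 <= (logmod x)%:E by rewrite lee_fin logmod_ge0.
have ml0 : 0 <= (meanlog l x)%:E by rewrite lee_fin meanlog_ge0.
have mcst (c : R) : measurable_fun (setT : set (plane R)) (fun=> c%:E) by exact: measurable_cst.
rewrite E1 E2.
have D1 : \int[a]_y (l%:E * Rop l (kern ^~ y) x + LG l (sqdist x y)) =
  \int[a]_y (l%:E * Rop l (kern ^~ y) x) + \int[a]_y LG l (sqdist x y).
  exact: (ge0_integralD a measurableT (fun y _ => lRk0 y) mlRk (fun y _ => LG_ge0 _ _) mLG).
have D2 : \int[a]_y (l%:E * Rop l (kern ^~ y) x + LG l (sqdist x y) + (logmod x)%:E) =
  \int[a]_y (l%:E * Rop l (kern ^~ y) x + LG l (sqdist x y)) + \int[a]_y (logmod x)%:E.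
  exact: (ge0_integralD a measurableT (fun y _ => adde_ge0 (lRk0 y) (LG_ge0 _ _))
    (emeasurable_funD mlRk mLG) (fun y _ => lx0) (mcst _)).
have D3 : \int[a]_y (kern x y + (meanlog l x)%:E) = kpot a x + \int[a]_y (meanlog l x)%:E.
  exact: (ge0_integralD a measurableT (fun y _ => kern_ge0 x y) mk (fun y _ => ml0) (mcst _)).
by rewrite -D1 -D2 -D3; apply: eq_integral => y _; exact: kern_resolvent.
Qed.

End kernel_potential.

Section comparison_of_potentials.
Context {R : realType}.
Implicit Types (c e l s : R) (x y z : plane R).
Implicit Types a b : {finite_measure set (plane R) -> \bar R}.
Local Notation U := (@resolvent_potential _ (plane R) R (@green R)).

Let U_ge0 l a x : 0 <= U l a x.
Proof. exact: (@resolvent_potential_ge0 _ _ _ green green_ge0 a l x). Qed.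

Let mU l a : measurable_fun setT (U l a).
Proof. exact: (@measurable_resolvent_potential _ _ _ green green_ge0 measurable_green a l). Qed.

Let pi20 : (0 < 2 * pi :> R)%R. Proof. by rewrite mulr_gt0// pi_gt0. Qed.

Lemma kpot_cst_resolvent a l c x : (0 < l)%R -> (0 <= c)%R ->
  l%:E * Rop l (fun z => kpot a z + c%:E) x + (2 * pi)%:E * U l a x +
    (mass a * logmod x)%:E = kpot a x + c%:E + (mass a * meanlog l x)%:E.
Proof.
move=> l0 c0.
rewrite (RopD l x (kpot_ge0 a) (fun=> c0 : 0 <= c%:E) (measurable_kpot a) (measurable_cst _)).
have cl0 : 0 <= (c / l)%:E by rewrite lee_fin divr_ge0// ltW.
rewrite Rop_cst// (ge0_muleDr _ (Rop_ge0 l x (kpot_ge0 a)) cl0).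
have -> : l%:E * (c / l)%:E = c%:E by rewrite -EFinM mulrCA divff ?mulr1// gt_eqF.
rewrite -[RHS]addeAC -kpot_resolvent// [RHS]addeAC; congr (_ + _).
exact: addeAC.
Qed.

Lemma U_le_kpot a l x : (0 < l)%R ->
  (2 * pi)%:E * U l a x <= kpot a x + (mass a * (1 + 64 / l))%:E.
Proof.
move=> l0; have E := kpot_resolvent a x l0.
have m0 := mass_ge0 a.
have R0 : 0 <= l%:E * Rop l (kpot a) x.
  by apply: mule_ge0; [rewrite lee_fin ltW|exact: Rop_ge0 (kpot_ge0 a)].
have ml : (mass a * meanlog l x <= mass a * logmod x + mass a * (1 + 64 / l))%R.
  by rewrite -mulrDr ler_wpM2l// addrA -[X in (64 / X)%R]mulr1 meanlog_le.
rewrite -(@leeD2rE _ (mass a * logmod x)%:E)//.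
apply: (@le_trans _ _ (kpot a x + (mass a * meanlog l x)%:E)).
  by rewrite -E; apply: leeD2r; rewrite leeDr.
by rewrite -[leRHS]addeA; apply: leeD2l; rewrite -EFinD lee_fin addrC.
Qed.

Lemma integral_U_lty a : \int[a]_x kpot a x < +oo ->
  forall l, (0 < l)%R -> \int[a]_x U l a x < +oo.
Proof.
move=> koo l l0; have : (2 * pi)%:E * \int[a]_x U l a x < +oo.
  rewrite -ge0_integralZl_EFin ?(ltW pi20)//.
  apply: (@le_lt_trans _ _ (\int[a]_x (kpot a x + (mass a * (1 + 64 / l))%:E))).
    apply: ge0_le_integral => //.
    - by move=> x _; apply: mule_ge0 => //; rewrite lee_fin ltW.
    - exact: emeasurable_funM.
    - by apply: emeasurable_funD => //; exact: measurable_kpot.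
    - by move=> x _; exact: U_le_kpot.
  have k0 : (0 <= mass a * (1 + 64 / l))%R.
    by rewrite mulr_ge0 ?mass_ge0// addr_ge0// divr_ge0// ltW.
  rewrite ge0_integralD//; last 2 first.
  - by move=> x _; exact: kpot_ge0.
  - exact: measurable_kpot.
  by rewrite integral_cst_mass// lte_add_pinfty// ltry.
have : 0 <= \int[a]_x U l a x by exact: integral_ge0.
by case: integral => [v| |]//; rewrite ?ltry// gt0_muley// lte_fin.
Qed.

(** By kpot_resolvent, the averages of kpot a exceed kpot a by at most
mass a (meanlog n x - logmod x), which vanishes at large rates by meanlog_le. *)
Lemma not_exceeded_kpot a c x : (0 <= c)%R ->
  not_exceeded (@leb2 R) (@green R) (fun z => kpot a z + c%:E) x.
Proof.
move=> c0 C uC; have u0 : 0 <= kpot a x + c%:E by rewrite adde_ge0// kpot_ge0.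
have ufin : kpot a x + c%:E \is a fin_num by rewrite ge0_fin_numE// (lt_trans uC) ?ltry.
move: uC; rewrite -(fineK ufin) lte_fin; set u := fine _ => uC.
pose m := (mass a + 1)%R; have m0 : (0 < m)%R by rewrite ltr_wpDl// mass_ge0.
have Cu : (0 < C - u)%R by rewrite subr_gt0.
(* d and M each leave half of the gap C - u to one term of meanlog_le *)
pose d := ((C - u) / (2 * m))%R; have d0 : (0 < d)%R by rewrite divr_gt0// mulr_gt0.
pose M := (64 * m / d / ((C - u) / 2))%R.
have M0 : (0 <= M)%R by rewrite /M !divr_ge0 ?mulr_ge0 ?(ltW m0) ?(ltW d0) ?(ltW Cu).
exists (Num.truncn M).+1 => // n /= Mn.
have nM : (M < n%:R)%R by rewrite (lt_le_trans (truncnS_gt _))// ler_nat.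
have n0 : (0 < n%:R :> R)%R by exact: le_lt_trans nM.
have E := kpot_cst_resolvent a x n0 c0.
have U0 : 0 <= (2 * pi)%:E * U n%:R a x by apply: mule_ge0 => //; rewrite lee_fin ltW.
rewrite -(@leeD2rE _ (mass a * logmod x)%:E)//.
apply: (@le_trans _ _ (kpot a x + c%:E + (mass a * meanlog n%:R x)%:E)).
  by rewrite -E; apply: leeD2r; rewrite leeDl.
rewrite -(fineK ufin) -!EFinD lee_fin -/u.
have ml := meanlog_le x n0 d0.
have h1 : (mass a * meanlog n%:R x <= mass a * logmod x + mass a * (d + 64 / (n%:R * d)))%R.
  by rewrite -mulrDr ler_wpM2l ?mass_ge0// addrA.
have h2 : (mass a * (d + 64 / (n%:R * d)) <= m * (d + 64 / (n%:R * d)))%R.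
  rewrite ler_wpM2r ?lerDl//.
  by rewrite addr_ge0 ?(ltW d0)// divr_ge0// mulr_ge0 ?(ltW n0) ?(ltW d0).
have h3 : (m * d = (C - u) / 2)%R by rewrite /d; field; rewrite gt_eqF.
have h4 : (m * (64 / (n%:R * d)) <= (C - u) / 2)%R.
  have -> : (m * (64 / (n%:R * d)) = (64 * m / d) / n%:R)%R by field; rewrite !gt_eqF.
  by rewrite ler_pdivrMr// [leRHS]mulrC -ler_pdivrMr ?divr_gt0//; exact: ltW.
move: h2; rewrite mulrDr [X in (_ <= X)%R]mulrDr => h2.
move: h1; rewrite mulrDr => h1; lra.
Qed.

(** Integrate kern_small_rate; the logarithmic moment of a enters here. *)
Lemma kpot_small_rate a c x : (0 <= c)%R -> \int[a]_y (logmod y)%:E < +oo ->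
  kpot a x < +oo -> exists C : R, forall n,
  (n.+1%:R^-1)%:E * Rop n.+1%:R^-1 (fun z => kpot a z + c%:E) x <= C%:E.
Proof.
move=> c0 loo koo; have [C HC] := kern_small_rate x.
have kfin : kpot a x \is a fin_num by rewrite ge0_fin_numE// kpot_ge0.
have l0 : 0 <= \int[a]_y (logmod y)%:E.
  by apply: integral_ge0 => y _; rewrite lee_fin logmod_ge0.
have lfin : \int[a]_y (logmod y)%:E \is a fin_num by rewrite ge0_fin_numE.
pose D := (logmod x + Num.max C 0)%R.
have D0 : (0 <= D)%R by rewrite addr_ge0 ?logmod_ge0// le_max lexx orbT.
exists (fine (kpot a x) + (fine (\int[a]_y (logmod y)%:E) + mass a * D) + c)%R => n.
set e := (n.+1%:R^-1)%R; have e0 : (0 < e)%R by rewrite invr_gt0.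
rewrite (RopD e x (kpot_ge0 a) (fun=> c0 : 0 <= c%:E) (measurable_kpot a) (measurable_cst _)).
have ce0 : 0 <= (c / e)%:E by rewrite lee_fin divr_ge0// ltW.
rewrite Rop_cst// (ge0_muleDr _ (Rop_ge0 e x (kpot_ge0 a)) ce0).
have -> : e%:E * (c / e)%:E = c%:E by rewrite -EFinM mulrCA divff ?mulr1// gt_eqF.
rewrite !EFinD !fineK//; apply: leeD2r.
have Rk0 y : 0 <= Rop e (kern ^~ y) x by apply: Rop_ge0 => z; exact: kern_ge0.
have mlog : measurable_fun setT (fun z : plane R => (logmod z)%:E).
  by apply/measurable_EFinP; exact: measurable_logmod.
have logm0 (z : plane R) : 0 <= (logmod z)%:E by rewrite lee_fin logmod_ge0.
have D00 : 0 <= D%:E by rewrite lee_fin.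
rewrite resolvent_kpot -ge0_integralZl_EFin ?(ltW e0)//; last exact: measurable_resolvent_kern.
rewrite -integral_cst_mass//.
have <- : \int[a]_y ((logmod y)%:E + D%:E) = \int[a]_y (logmod y)%:E + \int[a]_y D%:E.
  exact: (ge0_integralD a measurableT (fun y _ => logm0 y) mlog (fun y _ => D00) (measurable_cst _)).
have <- : \int[a]_y (kern x y + ((logmod y)%:E + D%:E)) =
    kpot a x + \int[a]_y ((logmod y)%:E + D%:E).
  exact: (ge0_integralD a measurableT (fun y _ => kern_ge0 x y) (measurable_kernr x)
    (fun y _ => adde_ge0 (logm0 y) D00) (emeasurable_funD mlog (measurable_cst _))).
apply: ge0_le_integral => //.
- by move=> y _; apply: mule_ge0; [rewrite lee_fin ltW|exact: Rk0].
- by apply: emeasurable_funM => //; exact: measurable_resolvent_kern.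
- apply: emeasurable_funD; first exact: measurable_kernr.
  exact: emeasurable_funD.
- move=> y _; apply: (le_trans (HC n y)); apply: leeD2l; rewrite -EFinD lee_fin /D.
  by rewrite [leRHS]addrCA addrA lerD2l le_max lexx.
Qed.

End comparison_of_potentials.

(** * Domination for the potentials of two charges *)

Section comparison_of_measures.
Context {R : realType}.
Implicit Types (c e l s : R) (x y z : plane R).
Local Notation U := (@resolvent_potential _ (plane R) R (@green R)).

Let U_ge0 l (a : {finite_measure set (plane R) -> \bar R}) x : 0 <= U l a x.
Proof. exact: (@resolvent_potential_ge0 _ _ _ green green_ge0 a l x). Qed.

Let mU l (a : {finite_measure set (plane R) -> \bar R}) : measurable_fun setT (U l a).
Proof. exact: (@measurable_resolvent_potential _ _ _ green green_ge0 measurable_green a l). Qed.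

Let pi20 : (0 < 2 * pi :> R)%R. Proof. by rewrite mulr_gt0// pi_gt0. Qed.

Lemma lsc_U l (a : {finite_measure set (plane R) -> \bar R}) x : lsc (U l a) x.
Proof.
apply: lsc_integral => [z y|z|y]; [exact: green_ge0| |exact: lsc_green].
exact: (measurableT_comp (measurable_green l) (pair1_measurable z)).
Qed.

Lemma equal_values_algebra (U1 U2 W R1 R2 u : \bar R) (A B k : R) : (0 < k)%R ->
  0 <= U1 -> 0 <= U2 -> 0 <= W -> 0 <= R1 -> 0 <= R2 ->
  u \is a fin_num -> R2 <= R1 -> R1 + (k%:E * U1 + W) + A%:E = u + B%:E ->
  R2 + k%:E * U2 + A%:E = u + B%:E -> U1 <= U2.
Proof.
move=> k0 U10 U20 W0 R10 R20 ufin.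
case: U2 U20 => [U2| |]//; last by move=> *; rewrite leey.
move=> U20; case: U1 U10 => [U1| |]//; last first.
  move=> _ _; rewrite gt0_muley// addye; last by case: W W0.
  by case: R1 R10 => [R1| |]//; case: u ufin.
case: u ufin => [u| |]//; case: W W0 => [W| |]//; last by case: R1 R10.
case: R1 R10 => [R1| |]//; case: R2 R20 => [R2| |]//.
rewrite -!EFinD !lee_fin => r20 r10 w0 _ u10 r [E1] [E2].
have : (k * U1 <= k * U2)%R by lra.
by rewrite ler_pM2l.
Qed.

Variables mu sm sp : {finite_measure set (plane R) -> \bar R}.
Variables A1 A2 : R.
Hypotheses (A10 : (0 <= A1)%R) (A20 : (0 <= A2)%R).
Hypothesis masses : (mass mu + mass sm = mass sp)%R.
Hypothesis sp_neq0 : sp setT != 0.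
Hypothesis sp_log : \int[sp]_x (logmod x)%:E < +oo.
Hypothesis sp_energy : \int[sp]_x kpot sp x < +oo.
Hypothesis mu_energy : \int[mu]_x kpot mu x < +oo.
Let u1 x : \bar R := kpot mu x + kpot sm x + A1%:E.
Let u2 x : \bar R := kpot sp x + A2%:E.
Hypothesis u21 : {ae sp, forall x, u2 x <= u1 x}.
Hypothesis u12 : {ae mu, forall x, u1 x = u2 x /\ u2 x < +oo}.

Let A10' : 0 <= A1%:E. Proof. rewrite lee_fin; exact: A10. Qed.
Let A20' : 0 <= A2%:E. Proof. rewrite lee_fin; exact: A20. Qed.

Let u10 x : 0 <= u1 x.
Proof. by apply: adde_ge0 A10'; apply: adde_ge0; exact: kpot_ge0. Qed.

Let u20 x : 0 <= u2 x.
Proof. by apply: adde_ge0 A20'; exact: kpot_ge0. Qed.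

Let mu1 : measurable_fun setT u1.
Proof.
by apply: emeasurable_funD => //; apply: emeasurable_funD; exact: measurable_kpot.
Qed.

Let mu2 : measurable_fun setT u2.
Proof. by apply: emeasurable_funD => //; exact: measurable_kpot. Qed.

Let u1E l x : (0 < l)%R ->
  l%:E * Rop l u1 x + ((2 * pi)%:E * U l mu x + (2 * pi)%:E * U l sm x) +
    (mass sp * logmod x)%:E = u1 x + (mass sp * meanlog l x)%:E.
Proof.
move=> l0; rewrite -masses !(mulrDl (mass mu)) !(EFinD (mass mu * _)).
have -> : u1 = (fun x => kpot mu x + (kpot sm x + A1%:E)).
  by apply/funext => z; rewrite /u1 addeA.
have c0 := A10'.
have s0 z : 0 <= kpot sm z + A1%:E by rewrite adde_ge0 ?kpot_ge0.
have ms : measurable_fun setT (fun z => kpot sm z + A1%:E).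
  by apply: emeasurable_funD => //; exact: measurable_kpot.
rewrite (RopD l x (kpot_ge0 mu) s0 (measurable_kpot mu) ms).
rewrite (ge0_muleDr _ (Rop_ge0 l x (kpot_ge0 mu)) (Rop_ge0 l x s0)).
rewrite [X in X + (_ + _) = _]addeACA [LHS]addeACA [RHS]addeACA -(kpot_resolvent mu x l0) -(kpot_cst_resolvent sm x l0 A10).
by [].
Qed.

Let u2E l x : (0 < l)%R ->
  l%:E * Rop l u2 x + (2 * pi)%:E * U l sp x + (mass sp * logmod x)%:E =
  u2 x + (mass sp * meanlog l x)%:E.
Proof. by move=> l0; exact: kpot_cst_resolvent. Qed.

Let lsc_u1 x : lsc u1 x.
Proof.
apply: lscD => [z|z||]; [by apply: adde_ge0; exact: kpot_ge0|exact: A10'| |].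
- by apply: lscD; [exact: kpot_ge0|exact: kpot_ge0|exact: lsc_kpot|exact: lsc_kpot].
- by apply: lsc_EFin; exact: cvg_cst.
Qed.

Let lsc_u2 x : lsc u2 x.
Proof.
apply: lscD => [z|z||]; [exact: kpot_ge0|exact: A20'|exact: lsc_kpot|].
by apply: lsc_EFin; exact: cvg_cst.
Qed.

(** The averages of the positive part of u2 - u1 vanish sp-almost everywhere because
kpot is lower semicontinuous, and the two sides have the same mass. *)
Lemma kpot_domination : {ae leb2, forall x, u2 x <= u1 x}.
Proof.
have sp_fin : {ae sp, forall x, kpot sp x < +oo}.
  have : {ae sp, forall x, setT x -> kpot sp x \is a fin_num}.
    apply: integrable_ae => //; apply/integrableP; split; first exact: measurable_kpot.
    by under eq_integral do rewrite gee0_abs ?kpot_ge0//.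
  by apply: filterS => x /(_ I); rewrite ge0_fin_numE// kpot_ge0.
pose d1 x := maxe (u2 x - u1 x) 0.
pose h x := mine (u2 x) (u1 x).
have d10 x : 0 <= d1 x by rewrite le_max lexx orbT.
have h0 x : 0 <= h x by rewrite le_min u10 u20.
have md1 : measurable_fun setT d1.
  by apply: measurable_maxe => //; exact: emeasurable_funB.
have mh : measurable_fun setT h by exact: measurable_mine.
have d1h z : d1 z + h z = u2 z by exact: maxe_subDmine.
have d1_lim : {ae sp, forall x, (fun n => n%:R%:E * Rop n%:R d1 x) @ \oo --> 0}.
  apply: filterS2 sp_fin u21 => x xfin x21.
  apply: (@scaled_resolvent_cvg0 _ _ _ leb2 green green_ge0 measurable_green
    u2 d1 h x d10 h0 md1 mh d1h).
  - by rewrite /h min_l.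
  - by rewrite /u2 lte_add_pinfty// ltry.
  - by apply: lsc_approached => //; exact: lsc_min.
  - exact: not_exceeded_kpot.
apply: (@logarithmic_domination _ _ _ leb2 green green_ge0 measurable_green greenC
  integral_green green_resolvent sp (2 * pi) u1 u2
  (fun l x => (2 * pi)%:E * U l mu x + (2 * pi)%:E * U l sm x)
  (fun x => mass sp * logmod x)%R (fun l x => mass sp * meanlog l x)%R
  (ltW pi20) u10 u20 mu1 mu2 _ u1E u2E _ d1_lim (@green_recurrent R) sp_neq0 _ (@green_gt0 R)).
- by move=> l x; rewrite adde_ge0// mule_ge0// lee_fin ltW.
- exact: integral_U_lty.
- by apply: filterS sp_fin => x xfin; exact: kpot_small_rate.
Qed.

(** At a point where u1 = u2, the two resolvent identities and u2 <= u1 almost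
everywhere give U mu + U sm <= U sp. In particular U mu <= U sp mu-almost everywhere,
and the domination principle applies to mu. *)
Lemma U_domination l : (0 < l)%R -> {ae leb2, forall x, U l mu x <= U l sp x}.
Proof.
move=> l0.
apply: (@potential_domination _ _ _ leb2 green green_ge0 measurable_green greenC
  integral_green green_resolvent mu sp l (integral_U_lty mu_energy) l0).
  move=> x; apply: lsc_approached.
  - by move=> z; rewrite le_min !U_ge0.
  - exact: measurable_mine.
  - by apply: lsc_min; exact: lsc_U.
have R21 x : Rop l u2 x <= Rop l u1 x.
  exact: (@ae_le_resolvent _ _ _ leb2 green green_ge0 measurable_green l u2 u1 x u20 u10
    mu2 mu1 kpot_domination).
apply: filterS u12 => x [E u2fin].
have l00 : 0 <= l%:E by rewrite lee_fin ltW.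
have := u1E x l0; rewrite E => E1.
apply: (equal_values_algebra pi20 _ _ _ _ _ _ _ E1 (u2E x l0)) => //.
- by apply: mule_ge0 => //; rewrite lee_fin ltW.
- by apply: mule_ge0 => //; exact: Rop_ge0.
- by apply: mule_ge0 => //; exact: Rop_ge0.
- by rewrite ge0_fin_numE.
- exact: lee_wpmul2l.
Qed.

End comparison_of_measures.

(** * Borel measures of the plane *)

Section plane_topology.
Context {R : realType}.
Implicit Types (A B C F G O : set (plane R)) (e : R) (n : nat).

(** The balls with rational centres and radii 1 / (n + 1) form a base. *)
Lemma open_plane_measurable O : open O -> measurable O.
Proof.
move=> oO.
pose b (i : rat * rat * nat) : set (plane R) :=
  ball ((ratr i.1.1, ratr i.1.2) : plane R) (i.2.+1%:R^-1)%R.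
pose H i := if `[< b i `<=` O >] then b i else set0.
have mb i : measurable (b i).
  rewrite (_ : b i = (ball (ratr i.1.1 : R) (i.2.+1%:R^-1)%R) `*`
                     (ball (ratr i.1.2 : R) (i.2.+1%:R^-1)%R)).
    by apply: measurableX; apply: open_measurable; exact: ball_open.
  by apply/seteqP; split.
have -> : O = \bigcup_i H i.
  apply/seteqP; split => [z Oz|z [i _]]; last first.
    by rewrite /H; case: asboolP => // sub; exact: sub.
  have /nbhs_ballP[e /= e0 eO] : nbhs z O by exact: open_nbhs_nbhs.
  pose n := Num.truncn (2 / e).
  have ne : (n.+1%:R^-1 < e / 2)%R.
    rewrite -[ltRHS]invrK ltf_pV2 ?posrE ?invr_gt0 ?divr_gt0// invf_div.
    exact: truncnS_gt.
  have r0 : (0 < n.+1%:R^-1 :> R)%R by rewrite invr_gt0.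
  have rat_near (t r : R) : (0 < r)%R -> exists q : rat, ball (ratr q : R) r t.
    move=> rp; have : (t - r < t + r)%R by lra.
    move=> /rat_in_itvoo[q]; rewrite in_itv/= => /andP[q1 q2]; exists q.
    by rewrite /ball/= ltr_distlC; apply/andP; split; lra.
  have [q1 hq1] := rat_near z.1 _ r0; have [q2 hq2] := rat_near z.2 _ r0.
  have bz : b ((q1, q2), n) z by split.
  exists ((q1, q2), n) => //; rewrite /H; case: asboolP => // -[] w bw.
  apply: eO; apply: (@ball_split R (plane R) (ratr q1, ratr q2)).
    by apply: ball_sym; apply: le_ball bz; exact: ltW.
  by apply: le_ball bw; exact: ltW.
apply: countable_bigcupT_measurable; first exact: countableP.
by move=> i; rewrite /H; case: asboolP.
Qed.

Lemma closed_plane_measurable C : closed C -> measurable C.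
Proof.
move=> cC; rewrite -(setCK C); apply: measurableC; apply: open_plane_measurable.
exact: closed_openC.
Qed.

(** Take the points at distance at least 1 / (n + 1) from the complement. *)
Lemma open_exhaustion O : open O -> exists F : nat -> set (plane R),
  [/\ forall n, closed (F n), nondecreasing_seq F & O = \bigcup_n F n].
Proof.
move=> oO; pose d : plane R -> \bar R := edist_inf (~` O).
exists (fun n => [set z | (n.+1%:R^-1)%:E <= d z]); split.
- move=> n; apply: (@closed_comp _ _ d [set t | (n.+1%:R^-1)%:E <= t]).
    by move=> z _; exact: edist_inf_continuous.
  exact: closed_ereal_le_ereal.
- move=> n m nm; rewrite subsetEset => z /=; apply: le_trans.
  by rewrite lee_fin lef_pV2 ?posrE// ler_nat.
apply/seteqP; split => [z Oz|z [n _ /= nd]]; last first.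
  apply: contrapT => Oz; move: nd; rewrite /d edist_inf0// leNgt lte_fin.
  by rewrite invr_gt0 ltr0Sn.
have /nbhs_ballP[e /= e0 eO] : nbhs z O by exact: open_nbhs_nbhs.
have de : e%:E <= d z.
  apply: le_ereal_inf_tmp => _ [y nOy <-]; rewrite leNgt; apply/negP => /edist_lt_ball.
  by move=> /eO.
exists (Num.truncn e^-1) => //=; apply: le_trans de.
rewrite lee_fin -[leRHS]invrK lef_pV2 ?posrE ?invr_gt0//.
exact: ltW (truncnS_gt _).
Qed.

Section regularity.
Variable a : {finite_measure set (plane R) -> \bar R}.

Definition closed_open_approximable A := forall e, (0 < e)%R ->
  exists F O, [/\ closed F, open O, F `<=` A, A `<=` O & a (O `\` F) <= e%:E].

Let vanishing (D : nat -> set (plane R)) e : (forall n, measurable (D n)) ->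
  nonincreasing_seq D -> (a (\bigcap_n D n) < e%:E) -> exists n, a (D n) <= e%:E.
Proof.
move=> mD nD De; apply: contrapT => nn.
have D0 : a (D 0%N) < +oo by rewrite ltey_eq fin_num_measure.
have cv := nonincreasing_cvg_mu D0 mD (bigcapT_measurable mD) nD.
have : e%:E <= a (\bigcap_n D n).
  apply: (cvge_to_ge cv); apply: nearW => n /=; rewrite leNgt; apply/negP => /ltW h.
  by apply: nn; exists n.
by rewrite leNgt De.
Qed.

Lemma open_approximable O : open O -> closed_open_approximable O.
Proof.
move=> oO e e0; have [F [cF ndF OF]] := open_exhaustion oO.
have mO := open_plane_measurable oO.
have mF n := closed_plane_measurable (cF n).
have [n nF] : exists n, a (O `\` F n) <= e%:E.
  apply: vanishing => [n|n m nm|]; first exact: measurableD.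
    rewrite subsetEset; apply: setDS; rewrite -subsetEset; exact: ndF.
  rewrite (_ : \bigcap_n _ = set0) ?measure0 ?lte_fin//.
  apply/seteqP; split => // z zF; have [Oz _] := zF 0%N I.
  by move: Oz; rewrite OF => -[n _ Fnz]; have [_] := zF n I.
exists (F n), O; split => //; rewrite OF; exact: bigcup_sup.
Qed.

Lemma approximableC A : closed_open_approximable A -> closed_open_approximable (~` A).
Proof.
move=> rA e e0; have [F [ O [cF oO FA AO aOF]]] := rA e e0; exists (~` O), (~` F); split.
- exact: open_closedC.
- exact: closed_openC.
- exact: subsetC.
- exact: subsetC.
- by rewrite setDE setCK setIC -setDE.
Qed.

Lemma approximableI A B : closed_open_approximable A -> closed_open_approximable B ->
  closed_open_approximable (A `&` B).
Proof.
move=> rA rB e e0; have e20 : (0 < e / 2)%R by rewrite divr_gt0.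
have [F [ O [cF oO FA AO aOF]]] := rA _ e20.
have [G [V [cG oV GB BV aVG]]] := rB _ e20.
exists (F `&` G), (O `&` V); split.
- exact: closedI.
- exact: openI.
- exact: setISS.
- exact: setISS.
have mO := open_plane_measurable oO; have mV := open_plane_measurable oV.
have mF := closed_plane_measurable cF; have mG := closed_plane_measurable cG.
rewrite [e]splitr EFinD; apply: le_trans (leeD aOF aVG).
apply: (@le_trans _ _ (a ((O `\` F) `|` (V `\` G)))).
  apply: le_measure; rewrite ?inE.
  - by apply: measurableD; exact: measurableI.
  - by apply: measurableU; exact: measurableD.
  - move=> z [[Oz Vz] FGz]; have [Fz|Fz] := pselect (F z); last by left.
    by right; split => // Gz; exact: FGz.
by apply: measureU2; exact: measurableD.
Qed.

Lemma approximable_bigcup (A : nat -> set (plane R)) :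
  (forall n, closed_open_approximable (A n)) -> closed_open_approximable (\bigcup_n A n).
Proof.
move=> rA e e0; have e20 : (0 < e / 2)%R by rewrite divr_gt0.
have e2n n : (0 < e / 2 / (2 ^ n.+1)%:R / 2)%R by rewrite !divr_gt0// ltr0n expn_gt0.
have H n : exists FO : set (plane R) * set (plane R), [/\ closed FO.1, open FO.2, FO.1 `<=` A n,
    A n `<=` FO.2 & a (FO.2 `\` FO.1) <= (e / 2 / (2 ^ n.+1)%:R / 2)%:E].
  by have [F [ O FO]] := rA n _ (e2n n); exists (F, O).
have {H}[FO HFO] := choice H.
pose F n := (FO n).1; pose O n := (FO n).2.
have cF n : closed (F n) by have [] := HFO n.
have oO n : open (O n) by have [] := HFO n.
have FA n : F n `<=` A n by have [] := HFO n.
have AO n : A n `<=` O n by have [] := HFO n.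
have aOF n : a (O n `\` F n) <= (e / 2 / (2 ^ n.+1)%:R / 2)%:E by have [] := HFO n.
have mF n := closed_plane_measurable (cF n).
have mO n := open_plane_measurable (oO n).
pose V := \bigcup_n O n; have oV : open V by exact: bigcup_open.
have mV : measurable V by exact: open_plane_measurable.
pose G n := \bigcup_(i < n.+1) F i.
have cG n : closed (G n) by apply: closed_bigcup => // i _; exact: cF.
have mG n := closed_plane_measurable (cG n).
have [n nV] : exists n, a (V `\` G n) <= e%:E.
  apply: vanishing => [n|n m nm|]; first exact: measurableD.
    rewrite subsetEset; apply: setDS; apply: bigcup_subset => i /= /leq_trans; exact.
  have sub : \bigcap_n (V `\` G n) `<=` \bigcup_n (O n `\` F n).
    move=> z zV; have [[i _ Oz] _] := zV 0%N I; exists i => //; split => // Fz.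
    by have [_] := zV i I; apply; exists i => /=.
  have := measure_sigma_subadditive a (fun n => measurableD (mO n) (mF n))
    (bigcapT_measurable (fun n => measurableD mV (mG n))) sub.
  move=> /le_lt_trans; apply.
  apply: (@le_lt_trans _ _ (\sum_(0 <= i <oo) (e / 2 / (2 ^ i.+1)%:R)%:E)).
    apply: lee_nneseries => [i _ _|i _]; first exact: measure_ge0.
    apply: (le_trans (aOF i)); rewrite lee_fin ler_pdivrMr// ler_peMr//; last by rewrite ler1n.
    by rewrite !divr_ge0// ltW.
  by apply: (le_lt_trans (epsilon_trick0 _ (ltW e20))); rewrite lte_fin; lra.
exists (G n), V; split => //.
- by move=> z [i _ Fz]; exists i => //; exact: FA.
- by move=> z [i _ Az]; exists i => //; exact: AO.
Qed.

(** The sets with this property form a sigma-algebra, and open sets have it. *)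
Lemma measurable_approximable A : measurable A -> closed_open_approximable A.
Proof.
have approxT : closed_open_approximable setT by apply: open_approximable; exact: openT.
have sigma (p : set R -> set (plane R)) : (forall D, p (~` D) = ~` p D) ->
    (forall D : nat -> set R, p (\bigcup_n D n) = \bigcup_n p (D n)) ->
    (forall D, open D -> open (p D)) ->
    forall D : set R, measurable D -> closed_open_approximable (p D).
  move=> pC pU pO D mD.
  have : (@RGenOpens.G R).-sigma.-measurable D by rewrite -RGenOpens.measurableE; exact: mD.
  suff sub : <<s @RGenOpens.G R >> `<=` [set D | closed_open_approximable (p D)] by exact: sub.
  move=> {D mD}; apply: smallest_sub; last first.
    by move=> _ [x [y ->]]; apply: open_approximable; apply: pO; exact: interval_open.
  split.
  - rewrite /= -setCT pC; apply: approximableC; apply: open_approximable.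
    by apply: pO; exact: openT.
  - by move=> D rD; rewrite /= setTD pC; exact: approximableC.
  - by move=> D rD; rewrite /= pU; exact: approximable_bigcup.
rewrite measurable_prod_measurableType => mA.
suff : <<s [set B `*` C | B in measurable & C in measurable] >> `<=` closed_open_approximable by apply.
move=> {A mA}; apply: smallest_sub.
  split.
  - by rewrite -setCT; exact: approximableC.
  - by move=> B rB; rewrite setTD; exact: approximableC.
  - by move=> B rB; exact: approximable_bigcup.
move=> _ [D1 mD1 [D2 mD2 <-]].
rewrite (_ : D1 `*` D2 = (fst @^-1` D1) `&` (snd @^-1` D2))//.
apply: approximableI.
- apply: (sigma (fun D => fst @^-1` D)) mD1 => // D oD.
  by apply: open_comp => // z _; exact: cvg_fst.
- apply: (sigma (fun D => snd @^-1` D)) mD2 => // D oD.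
  by apply: open_comp => // z _; exact: cvg_snd.
Qed.

End regularity.

Lemma closed_inner_regular (a : {finite_measure set (plane R) -> \bar R}) A e :
  measurable A -> (0 < e)%R -> exists F, [/\ closed F, F `<=` A & a A <= a F + e%:E].
Proof.
move=> mA e0; have [F [ O [cF oO FA AO aOF]]] := measurable_approximable a mA e0.
exists F; split => //; have mF := closed_plane_measurable cF.
have mO := open_plane_measurable oO.
apply: (@le_trans _ _ (a (F `|` (O `\` F)))).
  apply: le_measure; rewrite ?inE//.
    by apply: measurableU => //; exact: measurableD.
  by move=> z Az; have [Fz|Fz] := pselect (F z); [left|right; split => //; exact: AO].
apply: (@le_trans _ _ (a F + a (O `\` F))); last exact: leeD2l.
by apply: measureU2 => //; exact: measurableD.
Qed.

Lemma open_outer_regular (a : {finite_measure set (plane R) -> \bar R}) A e :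
  measurable A -> (0 < e)%R -> exists O, [/\ open O, A `<=` O & a O <= a A + e%:E].
Proof.
move=> mA e0; have [F [ O [cF oO FA AO aOF]]] := measurable_approximable a mA e0.
exists O; split => //; have mF := closed_plane_measurable cF.
have mO := open_plane_measurable oO.
apply: (@le_trans _ _ (a (A `|` (O `\` F)))).
  apply: le_measure; rewrite ?inE//.
    by apply: measurableU => //; exact: measurableD.
  by move=> z Oz; have [Fz|Fz] := pselect (F z); [left; exact: FA|right].
apply: (@le_trans _ _ (a A + a (O `\` F))); last exact: leeD2l.
by apply: measureU2 => //; exact: measurableD.
Qed.

End plane_topology.

(** * From potentials to measures *)

Section measures_from_potentials.
Context {R : realType}.
Implicit Types (c e l s : R) (x y z : plane R).
Local Notation U := (@resolvent_potential _ (plane R) R (@green R)).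

Variable phi : plane R -> R.
Hypothesis cphi : continuous phi.
Hypothesis phi01 : forall z, (0 <= phi z <= 1)%R.

Let phi0 z : 0 <= (phi z)%:E.
Proof. by rewrite lee_fin; have /andP[] := phi01 z. Qed.

Let phi1 z : 0 <= (1 - phi z)%:E.
Proof. by rewrite lee_fin subr_ge0; have /andP[] := phi01 z. Qed.

Let mphiR : measurable_fun setT phi.
Proof.
apply: measurability; first exact: RGenOpens.measurableE.
move=> _ [_ [a [b ->] <-]]; rewrite setTI; apply: open_plane_measurable.
by apply: open_comp; [move=> z _; exact: cphi|exact: interval_open].
Qed.

Let mphi : measurable_fun setT (fun z => (phi z)%:E).
Proof. exact/measurable_EFinP. Qed.

Let mphi1 : measurable_fun setT (fun z => (1 - phi z)%:E).
Proof. by apply/measurable_EFinP; exact: measurable_funB. Qed.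

Let splits n x : n.+1%:R%:E * Rop n.+1%:R (fun z => (phi z)%:E) x +
  n.+1%:R%:E * Rop n.+1%:R (fun z => (1 - phi z)%:E) x = 1.
Proof.
rewrite -(ge0_muleDr _ (Rop_ge0 _ x phi0) (Rop_ge0 _ x phi1)).
rewrite -(RopD _ x phi0 phi1 mphi mphi1).
rewrite (_ : (fun z => _ + _) = cst 1); last first.
  by apply/funext => z; rewrite -EFinD addrC subrK.
by rewrite Rop_cst// -EFinM mul1r divff.
Qed.

(** Both phi and 1 - phi are lower semicontinuous, and their averages add up to 1. *)
Lemma resolvent_approximation x :
  (fun n => n.+1%:R%:E * Rop n.+1%:R (fun z => (phi z)%:E) x) @ \oo --> (phi x)%:E.
Proof.
have low (f : plane R -> R) : continuous f -> (forall z, 0 <= (f z)%:E) ->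
    measurable_fun setT (fun z => (f z)%:E) -> forall c, (c < f x)%R ->
    \forall n \near \oo, c%:E < n.+1%:R%:E * Rop n.+1%:R (fun z => (f z)%:E) x.
  move=> cf f0 mf c cfx.
  have cfx' : c%:E < (f x)%:E by rewrite lte_fin.
  have [N _ HN] := lsc_approached f0 mf (lsc_EFin (cf x)) cfx'.
  exists N; first exact: I.
  move=> n Nn; have Nn1 : (N <= n.+1)%N by exact: leqW.
  exact: (HN n.+1 Nn1).
have c1phi : continuous (fun z => 1 - phi z)%R.
  by move=> z; apply: cvgB; [exact: cvg_cst|exact: cphi].
pose u n := n.+1%:R%:E * Rop n.+1%:R (fun z => (phi z)%:E) x.
have u0 n : 0 <= u n by apply: mule_ge0; [rewrite lee_fin|exact: Rop_ge0].
have v0 n : 0 <= n.+1%:R%:E * Rop n.+1%:R (fun z => (1 - phi z)%:E) x.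
  by apply: mule_ge0; [rewrite lee_fin|exact: Rop_ge0].
have ufin n : u n \is a fin_num.
  rewrite ge0_fin_numE//; apply: (@le_lt_trans _ _ 1); last exact: ltry.
  by rewrite -(splits n x) leeDl.
apply/fine_cvgP; split; first by apply: nearW => n; exact: ufin.
apply/cvgrPdist_lt => e e0.
have L1 := low phi cphi phi0 mphi (phi x - e)%R; have L2 := low _ c1phi phi1 mphi1 (1 - phi x - e)%R.
have h1 : (phi x - e < phi x)%R by rewrite ltrBlDr ltrDl.
have h2 : (1 - phi x - e < 1 - phi x)%R by rewrite ltrBlDr ltrDl.
apply: filterS2 (L1 h1) (L2 h2) => n.
have := splits n x; rewrite -/(u n) -(fineK (ufin n)) /=.
case: (n.+1%:R%:E * Rop _ (fun z => (1 - phi z)%:E) x) => [v| |]//.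
rewrite -EFinD => -[E]; rewrite !lte_fin => A B.
by rewrite ltr_norml; apply/andP; split; lra.
Qed.

(** The integral of n R_n phi with respect to a measure a is that of n phi U_n a with
respect to Lebesgue measure, which is monotone in U_n a; it tends to the integral of
phi. *)
Lemma le_integral_continuous (mu sp : {finite_measure set (plane R) -> \bar R}) :
  (forall l, (0 < l)%R -> {ae leb2, forall x, U l mu x <= U l sp x}) ->
  \int[mu]_x (phi x)%:E <= \int[sp]_x (phi x)%:E.
Proof.
move=> dom.
pose u n x := n.+1%:R%:E * Rop n.+1%:R (fun z => (phi z)%:E) x.
have u0 n x : 0 <= u n x by apply: mule_ge0; [rewrite lee_fin|exact: Rop_ge0].
have mR n : measurable_fun setT (Rop n.+1%:R (fun z => (phi z)%:E)).
  exact: (@measurable_resolvent _ _ _ leb2 green green_ge0 measurable_green _ _ phi0 mphi).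
have mu_ n : measurable_fun setT (u n) by exact: emeasurable_funM.
have u1 n x : `|u n x| <= 1.
  rewrite gee0_abs// -(splits n x) leeDl//.
  by apply: mule_ge0; [rewrite lee_fin|exact: Rop_ge0].
have cv (a : {finite_measure set (plane R) -> \bar R}) :
    (fun n => \int[a]_x u n x) @ \oo --> \int[a]_x (phi x)%:E.
  have [_ _ /= c] : [/\ a.-integrable setT (fun x => (phi x)%:E),
     [sequence (\int[a]_x `|u n x - (phi x)%:E|)%E]_n @ \oo --> 0 &
     [sequence (\int[a]_x (u n x))%E]_n @ \oo --> \int[a]_x (phi x)%:E].
    apply: (@dominated_convergence _ _ _ a setT measurableT u _ (cst 1)) => //.
    - by apply: aeW => x _; exact: resolvent_approximation.
    - by apply: finite_measure_integrable_cst.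
    - by apply: aeW => x n _; exact: u1.
  exact: c.
have le n : \int[mu]_x u n x <= \int[sp]_x u n x.
  have n0 : (0 < n.+1%:R :> R)%R by [].
  have E (a : {finite_measure set (plane R) -> \bar R}) :
      \int[a]_x u n x = n.+1%:R%:E * \int[leb2]_x ((phi x)%:E * U n.+1%:R a x).
    rewrite ge0_integralZl_EFin//; last by move=> x _; exact: Rop_ge0.
    congr (_ * _); apply/esym.
    exact: (@integral_resolvent_potential _ _ _ leb2 green green_ge0 measurable_green greenC a _ _ phi0 mphi).
  have mUa (a : {finite_measure set (plane R) -> \bar R}) :
      measurable_fun setT (fun x => (phi x)%:E * U n.+1%:R a x).
    apply: emeasurable_funM => //.
    exact: (@measurable_resolvent_potential _ _ _ green green_ge0 measurable_green a _).
  have Ua0 (a : {finite_measure set (plane R) -> \bar R}) x : 0 <= (phi x)%:E * U n.+1%:R a x.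
    by apply: mule_ge0 => //; exact: (@resolvent_potential_ge0 _ _ _ green green_ge0 a).
  rewrite !E lee_wpmul2l//; apply: ae_ge0_le_integral => //.
  by apply: filterS (dom _ n0) => x Ux _; exact: lee_wpmul2l.
rewrite -(cvg_lim (@ereal_hausdorff R) (cv mu)) -(cvg_lim (@ereal_hausdorff R) (cv sp)).
apply: lee_lim; [exact: cvgP (cv mu)|exact: cvgP (cv sp)|exact: nearW].
Qed.

End measures_from_potentials.

Section le_measures.
Context {R : realType}.
Local Notation U := (@resolvent_potential _ (plane R) R (@green R)).
Variables mu sp : {finite_measure set (plane R) -> \bar R}.
Hypothesis dom : forall l, (0 < l)%R -> {ae leb2, forall x, U l mu x <= U l sp x}.

(** Integrate a continuous function that separates F from the complement of O. *)
Let closed_open F O : closed F -> open O -> F `<=` O -> mu F <= sp O.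
Proof.
move=> cF oO FO; have cO : closed (~` O) by exact: open_closedC.
have disj : (~` O) `&` F = set0.
  by apply/seteqP; split => // z [nOz /FO].
have [phi [cphi phi01 phiO phiF]] := (@uniform_separatorP (plane R) R (~` O) F).1
  ((@normal_separatorP R (plane R)).1 (@pseudometric_normal R (plane R)) _ _ cO cF disj).
have phi01' z : (0 <= phi z <= 1)%R.
  have : range phi (phi z) by exists z.
  by move=> /phi01; rewrite /= in_itv.
have mphi : measurable_fun setT (fun z => (phi z)%:E).
  apply/measurable_EFinP; apply: measurability; first exact: RGenOpens.measurableE.
  move=> _ [_ [a [b ->] <-]]; rewrite setTI; apply: open_plane_measurable.
  by apply: open_comp; [move=> z _; exact: cphi|exact: interval_open].
have mF := closed_plane_measurable cF; have mO := open_plane_measurable oO.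
have phi0 z : 0 <= (phi z)%:E by rewrite lee_fin; have /andP[] := phi01' z.
apply: (@le_trans _ _ (\int[mu]_x (phi x)%:E)).
  rewrite -[leLHS]mul1e -integral_cst//.
  apply: (@le_trans _ _ (\int[mu]_(x in F) (phi x)%:E)).
    apply: ge0_le_integral => //; first exact: measurable_funTS.
    move=> x Fx; rewrite lee_fin.
    by have /phiF -> : (phi @` F) (phi x) by exists x.
  by apply: ge0_subset_integral.
apply: (le_trans (le_integral_continuous cphi phi01' dom)).
rewrite -[leRHS]mul1e -integral_cst//.
rewrite (_ : \int[sp]_x _ = \int[sp]_(x in O) (phi x)%:E).
  apply: ge0_le_integral => //; first exact: measurable_funTS.
  by move=> x Ox; rewrite lee_fin; have /andP[] := phi01' x.
rewrite [RHS]integral_mkcond; apply: eq_integral => x _; rewrite patchE.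
case: ifPn => // /negP; rewrite inE => Ox.
by have /phiO -> : (phi @` (~` O)) (phi x) by exists x.
Qed.

Lemma le_measure_of_potentials A : measurable A -> mu A <= sp A.
Proof.
move=> mA; apply/lee_addgt0Pr => e e0; have e20 : (0 < e / 2)%R by rewrite divr_gt0.
have [F [cF FA muF]] := closed_inner_regular mu mA e20.
have [ O [oO AO spO]] := open_outer_regular sp mA e20.
have -> : e%:E = (e / 2)%:E + (e / 2)%:E by rewrite -EFinD -splitr.
apply: (le_trans muF); rewrite addeA; apply: leeD2r.
by apply: le_trans spO; apply: closed_open => //; exact: subset_trans AO.
Qed.

End le_measures.

(** * Operations on finite measures *)

Section restriction_integral.
Context d (T : measurableType d) (R : realType).
Variables (m : {measure set T -> \bar R}) (D : set T) (mD : measurable D).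

Lemma ge0_integral_mrestr (f : T -> \bar R) : (forall x, 0 <= f x) ->
  measurable_fun setT f -> \int[mrestr m mD]_x f x = \int[m]_(x in D) f x.
Proof.
move=> f0 mf; rewrite -(setUv D) ge0_integral_setU//; first last.
- by rewrite disj_set2E setICr.
- exact: measurable_funTS.
- exact: measurableC.
rewrite [X in _ + X = _](_ : _ = 0) ?adde0.
  by apply: eq_measure_integral => A mA AD /=; rewrite /mrestr setIidl.
transitivity (\int[@mzero _ T R]_(x in ~` D) f x); last exact: integral_measure_zero.
apply: eq_measure_integral => A mA AD /=.
transitivity (m set0); last exact: measure0.
by rewrite /mrestr; congr (m _); apply/seteqP; split => // x [/AD].
Qed.

End restriction_integral.

Section normalized_restriction.
Context d (T : measurableType d) (R : realType).
Variables (a : {finite_measure set T -> \bar R}) (D : set T).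
Hypotheses (mD : measurable D) (aD : 0 < a D).

Let c : R := (fine (a D))^-1.

Let c0 : (0 <= c)%R. Proof. by rewrite invr_ge0 fine_ge0. Qed.

Definition normalized_restriction : set T -> \bar R := mscale (NngNum c0) (mrestr a mD).
HB.instance Definition _ := Measure.on normalized_restriction.

Let total1 : normalized_restriction setT = 1.
Proof.
rewrite /normalized_restriction /mscale/= /mrestr setTI -(fineK (fin_num_measure a _ mD)).
rewrite -EFinM mulVf// gt_eqF// -lte_fin fineK//; exact: fin_num_measure.
Qed.

HB.instance Definition _ :=
  Measure_isProbability.Build _ _ _ normalized_restriction total1.

Lemma exists_normalized_restriction : exists t : probability T R,
  [/\ forall B, t B = ((fine (a D))^-1)%:E * a (B `&` D) &
    forall f : T -> \bar R, (forall x, 0 <= f x) -> measurable_fun setT f ->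
    \int[t]_x f x = ((fine (a D))^-1)%:E * \int[a]_(x in D) f x].
Proof.
exists normalized_restriction; split => // f f0 mf.
rewrite -(ge0_integral_mrestr a mD f0 mf).
exact: (ge0_integral_mscale _ measurableT (NngNum c0) mf (fun x _ => f0 x)).
Qed.

End normalized_restriction.

Section mixture.
Context d (T : measurableType d) (R : realType).
Variables (m1 m2 : probability T R) (t : R).
Hypothesis t01 : (0 <= t <= 1)%R.

Let t0 : (0 <= t)%R. Proof. by case/andP: t01. Qed.
Let t1 : (0 <= 1 - t)%R. Proof. by rewrite subr_ge0; case/andP: t01. Qed.

Definition mixture : set T -> \bar R :=
  measure_add (mscale (NngNum t1) m1) (mscale (NngNum t0) m2).
HB.instance Definition _ := Measure.on mixture.

Let total1 : mixture setT = 1.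
Proof.
rewrite /mixture measure_addE.
transitivity ((1 - t)%:E * m1 setT + t%:E * m2 setT); first by [].
by rewrite !probability_setT !mule1 -EFinD subrK.
Qed.

HB.instance Definition _ := Measure_isProbability.Build _ _ _ mixture total1.

Lemma exists_mixture : exists m : probability T R,
  [/\ forall B, m B = (1 - t)%:E * m1 B + t%:E * m2 B &
    forall f : T -> \bar R, (forall x, 0 <= f x) -> measurable_fun setT f ->
    \int[m]_x f x = (1 - t)%:E * \int[m1]_x f x + t%:E * \int[m2]_x f x].
Proof.
exists mixture; split => [B|f f0 mf]; first by rewrite /= /mixture measure_addE.
rewrite /= /mixture ge0_integral_measure_add//.
by congr (_ + _); exact: (ge0_integral_mscale _ measurableT _ mf (fun x _ => f0 x)).
Qed.

End mixture.

Lemma integral_lty d (T : measurableType d) (R : realType)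
    (m : {measure set T -> \bar R}) (f : T -> \bar R) :
  \int[m]_x (f ^\+ x) < +oo -> \int[m]_x f x < +oo.
Proof.
move=> foo; rewrite integralE.
have n0 : 0 <= \int[m]_x (f ^\- x) by apply: integral_ge0 => x _; exact: funeneg_ge0.
move: foo n0; case: (\int[m]_x f ^\+ x) => [u| |]//; case: (\int[m]_x f ^\- x) => [v| |]//.
by move=> _ _; exact: ltry.
Qed.

Lemma integral_fin_num_parts d (T : measurableType d) (R : realType)
    (m : {measure set T -> \bar R}) (f : T -> \bar R) : \int[m]_x f x \is a fin_num ->
  \int[m]_x maxe (f x) 0 < +oo /\ \int[m]_x maxe (- f x) 0 < +oo.
Proof.
have -> : (fun x => maxe (f x) 0) = f ^\+ by apply/funext => x; rewrite funeposE.
have -> : (fun x => maxe (- f x) 0) = f ^\- by apply/funext => x; rewrite funenegE.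
rewrite integralE; have := @integral_ge0 _ _ _ m setT (f ^\-) (fun x _ => funeneg_ge0 f x).
have := @integral_ge0 _ _ _ m setT (f ^\+) (fun x _ => funepos_ge0 f x).
case: (\int[m]_x f ^\+ x) => [u| |]//; case: (\int[m]_x f ^\- x) => [v| |]// _ _ _.
by rewrite !ltry.
Qed.

Section integral_facts.
Context d (T : measurableType d) (R : realType).
Variable m : {finite_measure set T -> \bar R}.
Implicit Types f g : T -> \bar R.

(** No integrability is assumed: the negative part of f - c is at most c, so an infinite
integral of f comes from the positive part. *)
Lemma integral_subcst f (c : R) : (forall x, 0 <= f x) -> measurable_fun setT f -> (0 <= c)%R ->
  \int[m]_x (f x - c%:E) = \int[m]_x f x - (c * fine (m setT))%:E.
Proof.
move=> f0 mf c0.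
have mfin : m setT \is a fin_num by exact: fin_num_measure.
have intc : \int[m]_x c%:E = (c * fine (m setT))%:E.
  by rewrite integral_cst// EFinM fineK.
have [foo|] := ltP (\int[m]_x f x) +oo.
  rewrite -intc -integralB//.
  - by apply/integrableP; split => //; under eq_integral do rewrite gee0_abs//.
  - exact: finite_measure_integrable_cst.
rewrite leye_eq => /eqP foo; rewrite foo addye//.
pose g x := f x - c%:E.
have mg : measurable_fun setT g by exact: emeasurable_funB.
have gneg : \int[m]_x (g ^\- x) <= (c * fine (m setT))%:E.
  rewrite -intc; apply: ge0_le_integral => //.
  - by apply: measurable_funeneg.
  - move=> x _; rewrite funenegE /g ge_max lee_fin c0 andbT.
    by rewrite fin_num_oppeB// -[leRHS]add0e; apply: leeD2r; rewrite oppe_le0.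
have gpos : \int[m]_x (g ^\+ x) = +oo.
  apply/eqP; rewrite -leye_eq; have : +oo <= \int[m]_x (g ^\+ x) + (c * fine (m setT))%:E.
    rewrite -intc -ge0_integralD//; last exact: measurable_funepos.
    rewrite -[leLHS]foo; apply: ge0_le_integral => //.
    + by apply: emeasurable_funD => //; exact: measurable_funepos.
    + move=> x _; by rewrite -leeBlDr// funeposE le_max lexx.
  by case: (\int[m]_x (g ^\+ x)).
rewrite integralE gpos; move: gneg; case: (\int[m]_x (g ^\- x)) => [v| |]//.
Qed.

End integral_facts.

(** * The external field *)

Section external_field.
Context {R : realType}.
Implicit Types (c r : R) (x y z : plane R) (K : set (plane R)).

Lemma lsc_measurable (h : plane R -> \bar R) : (forall x, lsc h x) -> measurable_fun setT h.
Proof.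
move=> lh; apply: (measurability _ (ErealGenOInfty.measurableE R)).
move=> /= _ [_ [a ->]] <-; rewrite setTI; apply: open_plane_measurable.
rewrite openE => x /=; rewrite in_itv/= andbT => ax.
by apply: filterS (lh x a ax) => z /=; rewrite in_itv/= andbT.
Qed.

(** Otherwise h would tend to -oo along a sequence, and would not be lower
semicontinuous at its cluster points. *)
Lemma lsc_bounded_below (h : plane R -> \bar R) K : compact K ->
  (forall x, K x -> lsc h x) -> (forall x, K x -> -oo < h x) ->
  exists c, forall x, K x -> c%:E <= h x.
Proof.
move=> cK lh hNy; apply: contrapT => nc.
have H n : exists x, K x /\ h x < (- n%:R)%:E.
  apply: contrapT => nx; apply: nc; exists (- n%:R)%R => x Kx.
  by rewrite leNgt; apply/negP => hx; apply: nx; exists x.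
have [x Hx] := choice H.
have [p [Kp pcl]] : K `&` cluster (x @ \oo) !=set0.
  by apply: cK; exists 0%N => // n _; exact: (Hx n).1.
have [a [_ ap]] := real_between (hNy p Kp).
have [N Na] : exists N : nat, (- a <= N%:R)%R.
  by exists (Num.truncn (- a)).+1; exact: ltW (truncnS_gt _).
have [|z [[n /= Nn <-] az]] := pcl (x @` [set n | (N <= n)%N]) [set z | a%:E < h z] _ (lh p Kp a ap).
  by exists N => // n /= Nn; exists n.
move: (Hx n).2; rewrite ltNge => /negP; apply; apply: ltW; apply: le_lt_trans az.
rewrite lee_fin lerNl (le_trans Na)// ler_nat//.
Qed.

Lemma modulus_ball_compact r : compact [set z : plane R | (modulus z <= r)%R].
Proof.
have cm : continuous (@modulus R).
  move=> x; apply: (@continuous_comp _ _ _ (fun z : plane R => z.1 ^+ 2 + z.2 ^+ 2)%R Num.sqrt);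
    last exact: sqrt_continuous.
  by apply: cvgD; (apply: cvgM; by [exact: cvg_fst|exact: cvg_snd]).
apply: (@subclosed_compact _ _ (`[(- r)%R, r]%classic `*` `[(- r)%R, r]%classic)).
- apply: (@closed_comp _ _ (@modulus R) [set t | (t <= r)%R]); last exact: closed_le.
  by move=> z _; exact: cm.
- by apply: compact_setX; exact: segment_compact.
move=> z /= zr; have r0 : (0 <= r)%R by exact: le_trans (modulus_ge0 z) zr.
have zE : (z.1 ^+ 2 + z.2 ^+ 2 <= r ^+ 2)%R.
  by have := modulus_sqdist z 0%R; rewrite subr0 /sqdist/= !subr0 => <-; rewrite ler_pXn2r// nnegrE modulus_ge0.
have bound (t : R) : (t ^+ 2 <= r ^+ 2)%R -> t \in `[(- r)%R, r].
  by move=> tr; rewrite in_itv/= -ler_norml -(@ler_pXn2r _ 2)// ?nnegrE// real_normK ?num_real.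
split; apply: bound; apply: le_trans zE; first by rewrite lerDl sqr_ge0.
by rewrite lerDr sqr_ge0.
Qed.

Lemma modulus_le_norm x : (modulus x <= 2 * `|x|)%R.
Proof.
have n1 : (`|x.1| <= `|x|)%R by rewrite [leRHS]prod_normE le_max lexx.
have n2 : (`|x.2| <= `|x|)%R by rewrite [leRHS]prod_normE le_max lexx orbT.
rewrite -(@ler_pXn2r _ 2)// ?nnegrE ?modulus_ge0 ?mulr_ge0//.
have := modulus_sqdist x 0%R; rewrite subr0 /sqdist/= !subr0 => ->.
have h (t : R) : (`|t| <= `|x|)%R -> (t ^+ 2 <= `|x| ^+ 2)%R.
  by move=> tx; rewrite -[leLHS]real_normK ?num_real// ler_pXn2r// nnegrE.
have := h _ n1; have := h _ n2; rewrite exprMn.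
have := sqr_ge0 (`|x|)%R; move: (`|x| ^+ 2)%R => t; lra.
Qed.

Lemma logmod_le_ln x : (1 <= modulus x)%R -> (logmod x <= ln 2 + ln (modulus x))%R.
Proof.
move=> x1; have x0 : (0 < modulus x)%R by exact: lt_le_trans x1.
rewrite /logmod -lnM ?posrE// ler_ln ?posrE ?mulr_gt0//; last by rewrite ltr_wpDr// ltW.
by rewrite mulr2n mulrDl mul1r lerD2r.
Qed.

Variables (Sigma : set (plane R)) (Q : plane R -> \bar R).
Hypothesis cSigma : closed Sigma.
Hypothesis Qadm : weakly_admissible Sigma Q.

Definition extended_field z := if `[< Sigma z >] then Q z else +oo.

Lemma lsc_extended_field x : lsc extended_field x.
Proof.
move=> c; rewrite /extended_field; case: asboolP => [Sx|Sx] cx; last first.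
  have : \forall z \near x, (~` Sigma) z.
    by apply: open_nbhs_nbhs; split => //; exact: closed_openC.
  by apply: filterS => z /= Sz; case: asboolP => // _; rewrite ltry.
have [_ /(_ x c cx)[V nV VQ] _ _] := Qadm.
have W : within Sigma (nbhs x) V by rewrite nbhs_subspace_in.
have {}W : \forall z \near x, Sigma z -> V z by exact: W.
by apply: filterS W => z /= VS; case: asboolP => [Sz|_]; [apply: VQ; exact: VS|rewrite ltry].
Qed.

Let field_at_infinity : exists m M : R, (1 <= M)%R /\
  forall x, Sigma x -> (M < modulus x)%R -> (m + ln (modulus x))%:E <= Q x.
Proof.
have [QNy _ _ Qoo] := Qadm.
have [bS|nbS] := pselect (bounded_set Sigma).
  have [M [Mreal HM]] := bS.
  exists 0%R, (Num.max 1 (2 * (M + 1)))%R; split; first by rewrite le_max lexx.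
  move=> x Sx; rewrite gt_max => /andP[_ xM].
  have := HM (M + 1)%R; rewrite ltrDl ltr01 => /(_ isT) /(_ x Sx) /= nx.
  by exfalso; have := modulus_le_norm x; lra.
have [M [MNy ME]] := Qoo nbS; move: ME; rewrite limf_einfE => ME.
have : -oo < ereal_sup [set ereal_inf
    [set Q x - (ln (modulus x))%:E | x in V] | V in within Sigma at_infinity] by rewrite ME.
move=> /ereal_sup_gt[_ [V [r Vr] <-]] infV.
have [m [_ mV]] := real_between infV.
exists m, (Num.max 1 r)%R; split; first by rewrite le_max lexx.
move=> x Sx; rewrite gt_max => /andP[_ xr].
have Vx : V x by exact: Vr.
have : m%:E <= Q x - (ln (modulus x))%:E.
  apply: (le_trans (ltW mV)); apply: ereal_inf_lbound; by exists x.
by rewrite leeBrDr// -EFinD.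
Qed.

(** The field grows at least like the logarithm of the modulus, so that it can
be made nonnegative together with the logarithmic kernel. *)
Lemma normalized_field : exists (q : plane R -> \bar R) (c : R),
  [/\ (0 <= c)%R /\ (forall z, 0 <= q z), measurable_fun setT q,
      forall z, ~ Sigma z -> q z = +oo &
      forall z, Sigma z -> Q z = q z + (logmod z - c)%:E].
Proof.
have [QNy _ _ _] := Qadm.
have [m [M [M1 Qinf]]] := field_at_infinity.
have cK : compact (Sigma `&` [set z | (modulus z <= M)%R]).
  by rewrite setIC; apply: compact_closedI => //; exact: modulus_ball_compact.
have [b Qb] : exists b, forall x, (Sigma `&` [set z | (modulus z <= M)%R]) x -> b%:E <= extended_field x.
  apply: lsc_bounded_below => // [x _|x [Sx _]]; first exact: lsc_extended_field.
  by rewrite /extended_field; case: asboolP => // _; exact: QNy.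
have lM0 : (0 <= ln (1 + M) :> R)%R by rewrite ln_ge0// lerDl (le_trans ler01).
have l20 : (0 <= ln 2 :> R)%R by rewrite ln_ge0// ler1n.
pose c := (`|b| + ln (1 + M) + (`|m| + ln 2))%R.
have nb := ler_norm (- b)%R; rewrite normrN in nb.
have nm := ler_norm (- m)%R; rewrite normrN in nm.
have nb0 := normr_ge0 b; have nm0 := normr_ge0 m.
have c0 : (0 <= c)%R by rewrite /c; lra.
have low z : (logmod z - c)%:E <= extended_field z.
  rewrite /extended_field; case: asboolP => [Sz|_]; last by rewrite leey.
  have [zM|zM] := leP (modulus z) M.
    have := Qb z (conj Sz zM); rewrite /extended_field; case: asboolP => // _.
    apply: le_trans; rewrite lee_fin.
    have : (logmod z <= ln (1 + M))%R.
      by rewrite ler_ln ?posrE ?lerD2l// ltr_wpDr ?modulus_ge0// (le_trans ler01).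
    by rewrite /c; lra.
  apply: le_trans (Qinf z Sz zM); rewrite lee_fin.
  by have := logmod_le_ln (le_trans M1 (ltW zM)); rewrite /c; lra.
exists (fun z => extended_field z - (logmod z - c)%:E), c; split.
- by split => // z; rewrite leeBrDr// add0e.
- apply: emeasurable_funB; first by apply: lsc_measurable => z; exact: lsc_extended_field.
  by apply/measurable_EFinP; apply: measurable_funB => //; exact: measurable_logmod.
- by move=> z Sz; rewrite /extended_field; case: asboolP.
- by move=> z Sz; rewrite /extended_field; case: asboolP => // _; rewrite subeK.
Qed.

End external_field.

(** * The equilibrium problem *)

Section kernel_energy.
Context {R : realType}.
Implicit Types (x y z : plane R) (K D : set (plane R)).
Implicit Types a : {finite_measure set (plane R) -> \bar R}.

Lemma plane_hausdorff : hausdorff_space (plane R).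
Proof.
move=> [p1 p2] [q1 q2] pq; congr (_, _); apply: (@Rhausdorff R) => A B nA nB.
- have [|z [zA zB]] := pq (fst @^-1` A) (fst @^-1` B) _ (cvg_fst nB); first exact: cvg_fst.
  by exists z.1.
- have [|z [zA zB]] := pq (snd @^-1` A) (snd @^-1` B) _ (cvg_snd nB); first exact: cvg_snd.
  by exists z.2.
Qed.

Definition kenergy (a : set (plane R) -> \bar R) : \bar R := \int[a]_x kpot a x.

Lemma kenergy_ge0 a : 0 <= kenergy a.
Proof. by apply: integral_ge0 => x _; exact: kpot_ge0. Qed.

Lemma exists_measure_gt0 a (F : nat -> set (plane R)) : (forall n, measurable (F n)) ->
  0 < a (\bigcup_n F n) -> exists n, 0 < a (F n).
Proof.
move=> mF aF; apply: contrapT => nn; move: aF; apply/negP; rewrite -leNgt.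
have H := measure_sigma_subadditive a mF (bigcupT_measurable _ mF) (@subset_refl _ (\bigcup_n F n)).
apply: (le_trans H); rewrite eseries0// => n _ _; apply/eqP; rewrite eq_le measure_ge0 andbT leNgt.
by apply/negP => an; apply: nn; exists n.
Qed.

Lemma kenergy_restriction a (t : {finite_measure set (plane R) -> \bar R}) D (k : R) :
  measurable D -> (0 <= k)%R ->
  (forall f : plane R -> \bar R, (forall x, 0 <= f x) -> measurable_fun setT f ->
    \int[t]_x f x = k%:E * \int[a]_(x in D) f x) ->
  kenergy a < +oo -> kenergy t < +oo.
Proof.
move=> mD k0 tE aoo.
have le_T (f : plane R -> \bar R) : (forall x, 0 <= f x) -> measurable_fun setT f ->
    \int[t]_x f x <= k%:E * \int[a]_x f x.
  move=> f0 mf; rewrite tE//; apply: lee_wpmul2l; first by rewrite lee_fin.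
  exact: ge0_subset_integral.
have kt x : kpot t x <= k%:E * kpot a x.
  by apply: le_T; [exact: kern_ge0|exact: measurable_kernr].
apply: (le_lt_trans (le_T _ (kpot_ge0 t) (measurable_kpot t))).
apply: (@le_lt_trans _ _ (k%:E * (k%:E * kenergy a))); last first.
  by rewrite muleA -EFinM lte_mul_pinfty// lee_fin mulr_ge0.
apply: lee_wpmul2l; first by rewrite lee_fin.
rewrite -ge0_integralZl_EFin//; first last.
- exact: measurable_kpot.
- by move=> x _; exact: kpot_ge0.
apply: ge0_le_integral => //.
- by move=> x _; exact: kpot_ge0.
- exact: measurable_kpot.
- by apply: emeasurable_funM => //; exact: measurable_kpot.
Qed.

Lemma log_kernel_kern x y : log_kernel x y = kern x y - (logmod x + logmod y)%:E.
Proof. by rewrite kernE addeK. Qed.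

Lemma measurable_log_kernel :
  measurable_fun setT (fun p : plane R * plane R => log_kernel p.1 p.2).
Proof.
under eq_fun do rewrite log_kernelE.
apply: emeasurable_funB; first exact: measurable_log_pos.
by apply/measurable_EFinP; exact: measurable_far.
Qed.

Lemma kenergyE a : \int[a \x a]_p kern p.1 p.2 = kenergy a.
Proof. exact: (tonelli_prod kern measurable_kern kern_ge0). Qed.

Lemma product_supported (t : probability (plane R) R) D : measurable D -> t (~` D) = 0 ->
  {ae t \x t, forall p, (D `*` D) p}.
Proof.
move=> mD tD; exists (~` (D `*` D)); split => //.
  by apply: measurableC; exact: measurableX.
have tD1 : t D = 1.
  by have := probability_setC t (measurableC mD); rewrite setCK tD sube0.
have m1 : (t \x t)%E (D `*` D) = 1 by rewrite product_measure1E// [X in X * _]tD1 mul1e.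
have H : (t \x t)%E (~` (D `*` D)) = 1 - (t \x t)%E (D `*` D).
  exact: (@probability_setC _ _ _ (t \x t)%E _ (measurableX mD mD)).
by rewrite H m1 subee.
Qed.

(** The two kernels differ by a bounded function on a compact set; the weight logmod is
truncated at a bound on this set to keep the integrand nonnegative elsewhere. *)
Lemma compact_kenergy (t : probability (plane R) R) K : compact K -> t (~` K) = 0 ->
  energy t < +oo -> kenergy t < +oo.
Proof.
move=> cK tK too.
have mK : measurable K.
  by apply: closed_plane_measurable; apply: compact_closed cK; exact: plane_hausdorff.
have [b Kb] : exists b : R, forall x, K x -> b%:E <= (- logmod x)%:E.
  apply: lsc_bounded_below => // x _; last by rewrite ltNyr.
  by apply: lsc_EFin; apply: cvgN; exact: continuous_logmod.
pose L := `|b|%R; have L0 : (0 <= L)%R by exact: normr_ge0.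
have KL x : K x -> (logmod x <= L)%R.
  by move=> /Kb; rewrite lee_fin /L; have := ler_norm (- b)%R; rewrite normrN; lra.
pose m x := Num.min (logmod x) L.
pose f p : \bar R := kern p.1 p.2 + (2 * L - (m p.1 + m p.2))%:E.
have mL x : (m x <= L)%R by rewrite ge_min lexx orbT.
have g0 x y : 0 <= (2 * L - (m x + m y))%:E by rewrite lee_fin; have := mL x; have := mL y; lra.
have f0 p : 0 <= f p by rewrite adde_ge0// kern_ge0.
have mm : measurable_fun setT m by apply: measurable_minr => //; exact: measurable_logmod.
have mf : measurable_fun setT f.
  apply: emeasurable_funD; first exact: measurable_kern.
  apply/measurable_EFinP; apply: measurable_funB => //; apply: measurable_funD.
    exact: measurableT_comp mm measurable_fst.
  exact: measurableT_comp mm measurable_snd.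
have E : energy t = \int[t \x t]_p f p - (2 * L)%:E.
  transitivity (\int[t \x t]_p (f p - (2 * L)%:E)); last first.
    pose tt : probability (plane R * plane R)%type R := (t \x t)%E.
    have L20 : (0 <= 2 * L)%R by rewrite mulr_ge0.
    have tt1 : fine (tt setT) = 1%R by rewrite probability_setT.
    apply: (etrans (integral_subcst tt f0 mf L20)).
    by rewrite [fine _](tt1 : _ = 1%R) mulr1.
  apply: ae_eq_integral => //; first exact: measurable_log_kernel.
    exact: emeasurable_funB.
  apply: filterS (product_supported mK tK) => -[x y] [/= Kx Ky] _.
  rewrite log_kernel_kern /f /m /= !min_l ?KL// -[RHS]addeA; congr (_ + _).
  have e : (- (logmod x + logmod y) = 2 * L - (logmod x + logmod y) - 2 * L)%R by lra.
  exact: (congr1 (@EFin R) e).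
have foo : \int[t \x t]_p f p < +oo.
  by move: too; rewrite E; case: (\int[t \x t]_p f p) => [v| |]; rewrite ?ltry ?ltNyr.
rewrite -kenergyE; apply: le_lt_trans foo; apply: ge0_le_integral => //.
- by move=> p _; exact: kern_ge0.
- exact: measurable_kern.
- by move=> p _; rewrite leeDl.
Qed.

End kernel_energy.

(** The difference of the two sides is a polynomial in t without constant term, which
is nonnegative for small positive t: its linear coefficient is nonnegative. *)
Lemma variation_algebra (R : realType) (kmm kx ktt qm qt : R) :
  (forall t, 0 < t <= 1 -> kmm + (qm + qm) <=
    (1 - t) * ((1 - t) * kmm + t * kx) + t * ((1 - t) * kx + t * ktt) +
    (((1 - t) * qm + t * qt) + ((1 - t) * qm + t * qt)))%R ->
  (kmm + qm <= kx + qt)%R.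
Proof.
move=> H; rewrite leNgt; apply/negP => D0.
pose D := (kmm + qm - (kx + qt))%R; have Dp : (0 < D)%R by rewrite subr_gt0.
pose B := (kmm - 2 * kx + ktt)%R.
have B1 : (0 < `|B| + 1)%R by rewrite ltr_wpDl.
(* small enough for t * B to stay below the linear coefficient *)
pose t := Num.min 1%R (D / (`|B| + 1))%R.
have t0 : (0 < t)%R by rewrite lt_min ltr01 divr_gt0.
have t1 : (t <= 1)%R by rewrite ge_min lexx.
have tD : (t * (`|B| + 1) <= D)%R by rewrite -ler_pdivlMr// ge_min lexx orbT.
have := H t; rewrite t0 t1 => /(_ isT).
rewrite -subr_ge0 (_ : _ - _ = t * (t * B - 2 * D))%R; last by rewrite /B /D; ring.
rewrite pmulr_rge0// subr_ge0 => h.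
have tB : (t * B <= t * `|B|)%R by rewrite ler_pM2l// ler_norm.
by move: tD; rewrite mulrDr mulr1 => tD; lra.
Qed.

Section equilibrium.
Context {R : realType}.
Implicit Types (x y z : plane R).
Implicit Types a : {finite_measure set (plane R) -> \bar R}.
Variables (S : set (plane R)) (Q q : plane R -> \bar R) (c : R).
Hypothesis mS : measurable S.
Hypothesis c0 : (0 <= c)%R.
Hypothesis q0 : forall z, 0 <= q z.
Hypothesis mq : measurable_fun setT q.
Hypothesis q_out : forall z, ~ S z -> q z = +oo.
Hypothesis q_in : forall z, S z -> Q z = q z + (logmod z - c)%:E.

Definition total_energy a : \bar R := kenergy a + (\int[a]_x q x + \int[a]_x q x).

Lemma weighted_kernel_algebra (k p r : \bar R) (u v : R) : 0 <= k -> 0 <= p -> 0 <= r ->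
  k - (u + v)%:E + (p + (u - c)%:E) + (r + (v - c)%:E) = k + (p + r) - (2 * c)%:E.
Proof.
case: k => [k| |]//; case: p => [p| |]//; case: r => [r| |]//= _ _ _.
by congr _%:E; ring.
Qed.

(** The weights logmod of the kernel and of the field cancel. *)
Lemma weighted_energyE (t : probability (plane R) R) : t (~` S) = 0 ->
  weighted_energy S Q t = total_energy t - (2 * c)%:E.
Proof.
move=> tS; pose f (p : plane R * plane R) : \bar R := kern p.1 p.2 + (q p.1 + q p.2).
have mq1 : measurable_fun setT (fun p : plane R * plane R => q p.1).
  exact: measurableT_comp mq measurable_fst.
have mq2 : measurable_fun setT (fun p : plane R * plane R => q p.2).
  exact: measurableT_comp mq measurable_snd.
have qq0 (p : plane R * plane R) : 0 <= q p.1 + q p.2 by exact: adde_ge0.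
have f0 p : 0 <= f p by apply: adde_ge0 => //; exact: kern_ge0.
have mqq : measurable_fun setT (fun p : plane R * plane R => q p.1 + q p.2).
  exact: emeasurable_funD.
have mf : measurable_fun setT f by apply: emeasurable_funD => //; exact: measurable_kern.
pose tt : probability (plane R * plane R)%type R := (t \x t)%E.
have tt1 : fine (tt setT) = 1%R by rewrite probability_setT.
have mSS : measurable (S `*` S) by exact: measurableX.
have E1 : weighted_energy S Q t = \int[tt]_p (f p - (2 * c)%:E).
  transitivity (\int[tt]_(p in S `*` S) (f p - (2 * c)%:E)).
    apply: eq_integral => -[x y]; rewrite inE => -[/= Sx Sy].
    rewrite log_kernel_kern (q_in Sx) (q_in Sy); exact: weighted_kernel_algebra (kern_ge0 _ _) _ _.
  rewrite integral_mkcond; apply: ae_eq_integral => //.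
  - by apply/measurable_restrict => //; apply: measurable_funTS; exact: emeasurable_funB.
  - exact: emeasurable_funB.
  - by apply: filterS (product_supported mS tS) => p Sp _; rewrite patchE mem_set.
have c20 : (0 <= 2 * c)%R by rewrite mulr_ge0.
rewrite E1; apply: (etrans (integral_subcst tt f0 mf c20)).
rewrite [fine _](tt1 : _ = 1%R) mulr1; congr (_ - _).
have D1 : \int[tt]_p f p = \int[tt]_p kern p.1 p.2 + \int[tt]_p (q p.1 + q p.2).
  exact: (ge0_integralD tt measurableT (fun p _ => kern_ge0 p.1 p.2) measurable_kern
    (fun p _ => qq0 p) mqq).
have D2 : \int[tt]_p (q p.1 + q p.2) = \int[tt]_p q p.1 + \int[tt]_p q p.2.
  exact: (ge0_integralD tt measurableT (fun p _ => q0 p.1) mq1 (fun p _ => q0 p.2) mq2).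
have t1 : t setT = 1 by exact: probability_setT.
have E2 : \int[tt]_p q p.1 = \int[t]_x q x.
  rewrite (tonelli_prod (m1 := t) (m2 := t) (fun x _ => q x) mq1 (fun x _ => q0 x)).
  by apply: eq_integral => x _; rewrite integral_cst// [X in _ * X](t1 : _ = 1) mule1.
have E3 : \int[tt]_p q p.2 = \int[t]_x q x.
  rewrite (tonelli_prod (m1 := t) (m2 := t) (fun _ y => q y) mq2 (fun _ y => q0 y)).
  by rewrite integral_cst// [X in _ * X](t1 : _ = 1) mule1.
by rewrite D1 D2 E2 E3; congr (_ + _); exact: kenergyE.
Qed.

(** A measure of finite energy on a set of positive capacity where Q is finite charges
one of the sets where q is bounded; restrict it to such a set. *)
Lemma exists_finite_energy : 0 < log_capacity [set z | S z /\ Q z < +oo] ->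
  exists t : probability (plane R) R, t (~` S) = 0 /\ total_energy t < +oo.
Proof.
rewrite /log_capacity; set E := [set energy _ | _ in _] => cap.
have : ereal_inf E < +oo.
  rewrite ltey; apply/eqP => infE.
  by move: cap; rewrite infE/= ltxx.
move=> /ereal_inf_lt[_ [t0 [K [cK KS tK]] <-] t0oo].
have kt0 := compact_kenergy cK tK t0oo.
have mK : measurable K.
  by apply: closed_plane_measurable; apply: compact_closed cK; exact: plane_hausdorff.
pose A n := [set z | q z <= n%:R%:E].
have mA n : measurable (A n).
  rewrite (_ : A n = setT `&` q @^-1` `]-oo, n%:R%:E]).
    exact: (mq measurableT (emeasurable_itv _)).
  by apply/seteqP; split => z; rewrite /A/= in_itv/=; [split|case].
have tA : 0 < t0 (\bigcup_n A n).
  have t1 : t0 K = 1.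
    by have := probability_setC t0 (measurableC mK); rewrite setCK tK sube0.
  apply: (@lt_le_trans _ _ (t0 K)); first by rewrite t1.
  apply: le_measure; rewrite ?inE//; first exact: bigcupT_measurable.
  move=> z /KS[Sz Qz]; have : q z < +oo.
    by move: Qz; rewrite (q_in Sz); case: (q z) => [v| |]; rewrite ?ltry.
  rewrite -ge0_fin_numE// => qfin.
  exists (Num.truncn (fine (q z))).+1 => //; rewrite /A/= -(fineK qfin) lee_fin.
  exact: ltW (truncnS_gt _).
have [n tn] := exists_measure_gt0 mA tA.
have [t [tE tint]] := exists_normalized_restriction (mA n) tn.
have k0 : (0 <= (fine (t0 (A n)))^-1)%R by rewrite invr_ge0 fine_ge0.
exists t; split.
  rewrite tE (_ : ~` S `&` A n = set0) ?measure0 ?mule0//.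
  apply/seteqP; split => // z [/q_out qz]; by rewrite /A/= qz leye_eq.
have qt : \int[t]_x q x < +oo.
  rewrite tint//; apply: lte_mul_pinfty => //.
  apply: (@le_lt_trans _ _ (\int[t0]_(x in A n) n%:R%:E)).
    by apply: ge0_le_integral => //; exact: measurable_funTS.
  rewrite integral_cst//; apply: lte_mul_pinfty => //.
  by rewrite ltey_eq fin_num_measure.
apply: lte_add_pinfty; last exact: lte_add_pinfty.
exact: (kenergy_restriction (mA n) k0 tint kt0).
Qed.

Variable mu : probability (plane R) R.
Hypothesis mu_eq : equilibrium_measure S Q mu.
Hypothesis cap : 0 < log_capacity [set z | S z /\ Q z < +oo].

Lemma equilibrium_le (t : probability (plane R) R) : t (~` S) = 0 ->
  total_energy mu <= total_energy t.
Proof.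
move=> tS; have [muS mu_min] := mu_eq.
by have := mu_min t tS; rewrite !weighted_energyE// leeD2rE.
Qed.

Lemma equilibrium_finite : kenergy mu < +oo /\ \int[mu]_x q x < +oo.
Proof.
have [t [tS too]] := exists_finite_energy cap.
have := le_lt_trans (equilibrium_le tS) too; rewrite /total_energy.
have : 0 <= \int[mu]_x q x by exact: integral_ge0.
have := kenergy_ge0 mu.
by case: (kenergy mu) => [u| |]//; case: (\int[mu]_x q x) => [v| |]//; rewrite !ltry.
Qed.

(** The constant of the Frostman inequalities. *)
Definition robin_constant : R := (fine (kenergy mu) + fine (\int[mu]_x q x))%R.

Lemma kpot_symmetric (a b : {finite_measure set (plane R) -> \bar R}) : \int[a]_x kpot b x = \int[b]_x kpot a x.
Proof.
rewrite (tonelli (m1 := a) (m2 := b) kern measurable_kern kern_ge0).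
by apply: eq_integral => y _; apply: eq_integral => x _; rewrite kernC.
Qed.

(** Compare mu with the mixtures (1 - s) mu + s t for small s. *)
Lemma first_variation (t : probability (plane R) R) : t (~` S) = 0 ->
  kenergy t < +oo -> \int[t]_x q x < +oo ->
  robin_constant%:E <= \int[t]_x (kpot mu x + q x).
Proof.
move=> tS ktoo qtoo; have [kmoo qmoo] := equilibrium_finite.
have km_fin : kenergy mu \is a fin_num by rewrite ge0_fin_numE// kenergy_ge0.
have kt_fin : kenergy t \is a fin_num by rewrite ge0_fin_numE// kenergy_ge0.
have qm_fin : \int[mu]_x q x \is a fin_num by rewrite ge0_fin_numE// integral_ge0.
have qt_fin : \int[t]_x q x \is a fin_num by rewrite ge0_fin_numE// integral_ge0.
have -> : \int[t]_x (kpot mu x + q x) = \int[t]_x kpot mu x + \int[t]_x q x.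
  exact: (ge0_integralD t measurableT (fun x _ => kpot_ge0 mu x) (measurable_kpot mu)
    (fun x _ => q0 x) mq).
have [kxoo|] := ltP (\int[t]_x kpot mu x) +oo; last first.
  rewrite leye_eq => /eqP ->; rewrite addye ?leey//.
  by rewrite -ltNye (lt_le_trans (ltNyr 0%R))// integral_ge0.
have kx_fin : \int[t]_x kpot mu x \is a fin_num.
  by rewrite ge0_fin_numE// integral_ge0// => x _; exact: kpot_ge0.
rewrite -(fineK kx_fin) -(fineK qt_fin) -EFinD lee_fin /robin_constant.
apply: (@variation_algebra _ _ _ (fine (kenergy t))) => s /andP[s0 s1].
have s01 : (0 <= s <= 1)%R by rewrite (ltW s0).
have s0' : 0 <= s%:E by rewrite lee_fin ltW.
have s1' : 0 <= (1 - s)%:E by rewrite lee_fin subr_ge0.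
have [n [nE nint]] := exists_mixture mu t s01.
have nS : n (~` S) = 0 by rewrite nE tS (proj1 mu_eq) !mule0 adde0.
have kn x : kpot n x = (1 - s)%:E * kpot mu x + s%:E * kpot t x.
  by apply: nint; [exact: kern_ge0|exact: measurable_kernr].
have Dn a : \int[a]_x kpot n x = (1 - s)%:E * \int[a]_x kpot mu x + s%:E * \int[a]_x kpot t x.
  rewrite -!ge0_integralZl_EFin ?subr_ge0 ?(ltW s0)//; first last.
  - exact: measurable_kpot.
  - by move=> x _; exact: kpot_ge0.
  - exact: measurable_kpot.
  - by move=> x _; exact: kpot_ge0.
  rewrite -ge0_integralD//.
  - by apply: eq_integral => x _; exact: kn.
  - by move=> x _; rewrite mule_ge0// kpot_ge0.
  - by apply: emeasurable_funM => //; exact: measurable_kpot.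
  - by move=> x _; rewrite mule_ge0// kpot_ge0.
  - by apply: emeasurable_funM => //; exact: measurable_kpot.
have kn2 : kenergy n = (1 - s)%:E * ((1 - s)%:E * kenergy mu + s%:E * \int[t]_x kpot mu x) +
    s%:E * ((1 - s)%:E * \int[t]_x kpot mu x + s%:E * kenergy t).
  rewrite {1}/kenergy nint; [|exact: kpot_ge0|exact: measurable_kpot].
  by rewrite !Dn (kpot_symmetric mu t).
have := equilibrium_le nS; rewrite /total_energy kn2 (nint q q0 mq).
rewrite -(fineK km_fin) -(fineK kt_fin) -(fineK qm_fin) -(fineK qt_fin) -(fineK kx_fin).
exact.
Qed.

End equilibrium.

(** * Frostman inequalities *)

Section frostman.
Context {R : realType}.
Implicit Types (x y z : plane R).
Implicit Types a : {finite_measure set (plane R) -> \bar R}.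

(** By regularity a charged set contains a charged compact set, and the normalized
restriction to the latter has finite energy. *)
Lemma capacity0_null a (E : set (plane R)) : measurable E -> kenergy a < +oo ->
  log_capacity E = 0 -> a E = 0.
Proof.
move=> mE aoo capE; apply/eqP; rewrite eq_le measure_ge0 andbT leNgt; apply/negP => aE.
have aEfin : a E \is a fin_num by exact: fin_num_measure.
have e0 : (0 < fine (a E) / 2)%R by rewrite divr_gt0// -lte_fin fineK.
have [F [cF FE aF]] := closed_inner_regular a mE e0.
have aF0 : 0 < a F.
  have mF := closed_plane_measurable cF.
  have aFfin : a F \is a fin_num by exact: fin_num_measure.
  move: aF; rewrite -(fineK aFfin) -{1}(fineK aEfin) -EFinD lee_fin lte_fin.
  by move: e0; lra.
pose K n := F `&` [set z : plane R | (modulus z <= n%:R)%R].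
have cK n : compact (K n).
  by rewrite /K setIC; apply: compact_closedI => //; exact: modulus_ball_compact.
have mK n : measurable (K n).
  by apply: closed_plane_measurable; apply: compact_closed (cK n); exact: plane_hausdorff.
have FK : F = \bigcup_n K n.
  apply/seteqP; split => [z Fz|z [n _ []//]].
  exists (Num.truncn (modulus z)).+1 => //; split => //=.
  exact: ltW (truncnS_gt _).
have [n an] : exists n, 0 < a (K n) by apply: exists_measure_gt0 => //; rewrite -FK.
have [t [tE tint]] := exists_normalized_restriction (mK n) an.
have k0 : (0 <= (fine (a (K n)))^-1)%R by rewrite invr_ge0 fine_ge0.
have ktoo := kenergy_restriction (mK n) k0 tint aoo.
have too : energy t < +oo.
  have pos_le : \int[t \x t]_p ((fun p => log_kernel p.1 p.2) ^\+ p) <= kenergy t.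
    rewrite -kenergyE; apply: ge0_le_integral => //.
    - by apply: measurable_funepos; exact: measurable_log_kernel.
    - exact: measurable_kern.
    - move=> p _; rewrite funeposE ge_max kern_ge0 andbT log_kernel_kern leeBlDr// leeDl//.
      by rewrite lee_fin addr_ge0// logmod_ge0.
  exact: integral_lty (le_lt_trans pos_le ktoo).
have : ereal_inf [set energy m | m in [set m : probability (plane R) R |
    exists C, [/\ compact C, C `<=` E & m (~` C) = 0]]] < +oo.
  apply: le_lt_trans too; apply: ereal_inf_lbound; exists t => //.
  exists (K n); split => //; first by move=> z [/FE].
  by rewrite tE setICl measure0 mule0.
move: capE; rewrite /log_capacity; case: (ereal_inf _) => [u| |]//=.
by move=> [] /eqP; rewrite gt_eqF// expR_gt0.
Qed.

Variables (S : set (plane R)) (q : plane R -> \bar R).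
Hypothesis q0 : forall z, 0 <= q z.
Hypothesis mq : measurable_fun setT q.
Hypothesis q_out : forall z, ~ S z -> q z = +oo.
Variables (mu : probability (plane R) R) (F : R).
Hypothesis variation : forall t : probability (plane R) R, t (~` S) = 0 ->
  kenergy t < +oo -> \int[t]_x q x < +oo -> F%:E <= \int[t]_x (kpot mu x + q x).

Let g x := kpot mu x + q x.
Let g0 x : 0 <= g x. Proof. by apply: adde_ge0 => //; exact: kpot_ge0. Qed.
Let mg : measurable_fun setT g.
Proof. by apply: emeasurable_funD => //; exact: measurable_kpot. Qed.

(** If the inequality failed on a set of positive measure, the normalized
restriction of the measure to this set would violate the first variation. *)
Lemma frostman_ge a : kenergy a < +oo -> {ae a, forall x, F%:E <= kpot mu x + q x}.
Proof.
move=> aoo; pose A n := [set z | g z <= (F - n.+1%:R^-1)%:E].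
have mA n : measurable (A n).
  rewrite (_ : A n = setT `&` g @^-1` `]-oo, (F - n.+1%:R^-1)%:E]).
    exact: (mg measurableT (emeasurable_itv _)).
  by apply/seteqP; split => z; rewrite /A/= in_itv/=; [split|case].
exists (\bigcup_n A n); split; first exact: bigcupT_measurable.
- apply/eqP; rewrite eq_le measure_ge0 andbT leNgt; apply/negP => /(exists_measure_gt0 mA)[n an].
  have [t [tE tint]] := exists_normalized_restriction (mA n) an.
  have k0 : (0 <= (fine (a (A n)))^-1)%R by rewrite invr_ge0 fine_ge0.
  have inv1 : ((fine (a (A n)))^-1)%:E * a (A n) = 1.
    rewrite -[X in _ * X](fineK (fin_num_measure a _ (mA n))) -EFinM mulVf// gt_eqF//.
    by rewrite -lte_fin fineK//; exact: fin_num_measure.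
  have gt : \int[t]_x g x <= (F - n.+1%:R^-1)%:E.
    have -> : (F - n.+1%:R^-1)%:E = ((fine (a (A n)))^-1)%:E *
        \int[a]_(x in A n) (F - n.+1%:R^-1)%:E.
      by rewrite integral_cst// muleCA inv1 mule1.
    rewrite tint//; apply: lee_wpmul2l; first by rewrite lee_fin.
    have [Fn|Fn] := leP 0%R (F - n.+1%:R^-1)%R.
      by apply: ge0_le_integral => //; exact: measurable_funTS.
    have : A n = set0.
      apply/seteqP; split => // z; rewrite /A/= => /(le_trans (g0 z)).
      by rewrite lee_fin leNgt Fn.
    by move=> ->; rewrite !integral_set0.
  have tS : t (~` S) = 0.
    rewrite tE (_ : ~` S `&` A n = set0) ?measure0 ?mule0//.
    apply/seteqP; split => // z [/q_out qz]; rewrite /A/= /g qz addey ?leye_eq//.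
    by rewrite -ltNye (lt_le_trans (ltNyr 0%R))// kpot_ge0.
  have ktoo := kenergy_restriction (mA n) k0 tint aoo.
  have qt : \int[t]_x q x < +oo.
    apply: (@le_lt_trans _ _ (\int[t]_x g x)); last exact: le_lt_trans gt (ltry _).
    by apply: ge0_le_integral => // x _; rewrite /g leeDr// kpot_ge0.
  have := le_trans (variation tS ktoo qt) gt.
  by rewrite lee_fin leNgt ltrBlDr ltrDl invr_gt0 ltr0Sn.
- move=> z /= nF; have gF : g z < F%:E by rewrite ltNge; apply/negP.
  have gfin : g z \is a fin_num by rewrite ge0_fin_numE// (lt_trans gF) ?ltry.
  move: gF; rewrite -(fineK gfin) lte_fin => gF.
  exists (Num.truncn (F - fine (g z))^-1) => //; rewrite /A/= -(fineK gfin) lee_fin.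
  rewrite lerBrDr -lerBrDl -[leRHS]invrK lef_pV2 ?posrE ?invr_gt0 ?subr_gt0//.
  exact: ltW (truncnS_gt _).
Qed.

Hypothesis mu_fin : kenergy mu < +oo.
Hypothesis F_mu : \int[mu]_x (kpot mu x + q x) = F%:E.

(** The inequality frostman_ge is an equality on average, hence almost everywhere. *)
Lemma frostman_eq : {ae mu, forall x, kpot mu x + q x = F%:E}.
Proof.
have ge := frostman_ge mu_fin.
have F0 : 0 <= F%:E by rewrite -F_mu; apply: integral_ge0 => x _; exact: g0.
pose h x := maxe (g x - F%:E) 0.
have h0 x : 0 <= h x by rewrite le_max lexx orbT.
have mh : measurable_fun setT h by apply: measurable_maxe => //; exact: emeasurable_funB.
have hg : {ae mu, forall x, h x + F%:E = g x}.
  apply: filterS ge => x gF.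
  rewrite /h max_l; first by rewrite subeK.
  by rewrite leeBrDr// add0e.
have int_h : \int[mu]_x h x = 0.
  have : \int[mu]_x h x + F%:E = 0 + F%:E.
    have E : \int[mu]_x F%:E = F%:E.
      by rewrite integral_cst// [X in _ * X](probability_setT mu : _ = 1) mule1.
    rewrite add0e -[RHS]F_mu -{1}E -ge0_integralD//; apply: ae_eq_integral => //.
    - exact: emeasurable_funD.
    - by apply: filterS hg => x hx _.
  by rewrite add0e => /(congr1 (fun u => u - F%:E)); rewrite addeK// subee.
have : \int[mu]_x `|h x| = 0.
  by rewrite -[RHS]int_h; apply: eq_integral => x _; rewrite gee0_abs.
move/ae_eq_integral_abs => /(_ measurableT mh) hae.
apply: filterS2 hg hae => x hx /(_ I) h00.
by rewrite -[LHS]hx h00 add0e.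
Qed.

End frostman.

(** * Logarithmic potentials and the nonnegative kernel *)

Section logarithmic_potential.
Context {R : realType}.
Implicit Types (x y z : plane R).
Variable a : {finite_measure set (plane R) -> \bar R}.

Let pos z : \bar R := \int[a]_y log_pos z y.
Let neg z : \bar R := \int[a]_y (far z y)%:E.

Let pos0 z : 0 <= pos z. Proof. by apply: integral_ge0 => y _; exact: log_pos_ge0. Qed.

Lemma log_kernel_pos x y : maxe (log_kernel x y) 0 = log_pos x y.
Proof.
rewrite log_kernelE; have [D1|D1] := leP (sqdist x y) 1%R.
  have -> : far x y = 0%R by rewrite /far max_r// ln1 mul0r.
  by rewrite sube0 max_l// log_pos_ge0.
by rewrite /log_pos LGpos_eq0 ?(ltW D1)// sub0e max_r// lee_fin oppr_le0 far_ge0.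
Qed.

Lemma log_kernel_neg x y : maxe (- log_kernel x y) 0 = (far x y)%:E.
Proof.
rewrite log_kernelE; have [D1|D1] := leP (sqdist x y) 1%R.
  have -> : far x y = 0%R by rewrite /far max_r// ln1 mul0r.
  by rewrite sube0 max_r// oppe_le0 log_pos_ge0.
rewrite /log_pos LGpos_eq0 ?(ltW D1)// sub0e oppeK max_l//.
by rewrite lee_fin far_ge0.
Qed.

Lemma potentialE z : potential a z = pos z - neg z.
Proof.
rewrite /potential integralE; congr (_ - _); apply: eq_integral => y _.
  by rewrite funeposE log_kernel_pos.
by rewrite funenegE log_kernel_neg.
Qed.

Let measurable_pos : measurable_fun setT pos.
Proof. exact: (measurable_integral1 (m2 := a) log_pos measurable_log_pos log_pos_ge0). Qed.

Let mfar : measurable_fun setT (fun p : plane R * plane R => (far p.1 p.2)%:E).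
Proof. by apply/measurable_EFinP; exact: measurable_far. Qed.

Let measurable_neg : measurable_fun setT neg.
Proof.
apply: (measurable_integral1 (m2 := a) (fun x y => (far x y)%:E) mfar).
by move=> x y; rewrite lee_fin far_ge0.
Qed.

Lemma measurable_potential : measurable_fun setT (potential a).
Proof. by rewrite (funext potentialE); exact: emeasurable_funB. Qed.

Let mlog : measurable_fun setT (fun y : plane R => (logmod y)%:E).
Proof. by apply/measurable_EFinP; exact: measurable_logmod. Qed.

Let log0 y : 0 <= (logmod y : R)%:E. Proof. by rewrite lee_fin logmod_ge0. Qed.

Let parts_fin z : potential a z \is a fin_num -> pos z \is a fin_num /\ neg z \is a fin_num.
Proof. by rewrite potentialE; case: (pos z) => [u| |]; case: (neg z). Qed.

(** For fixed z, log |z - y| grows like logmod y, so that finiteness of the potential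
at one point bounds the logarithmic moment. *)
Lemma integral_logmod_lty z : potential a z \is a fin_num -> \int[a]_y (logmod y)%:E < +oo.
Proof.
move=> /parts_fin[_ nfin].
have k0 : (0 <= logmod z + ln 2)%R by rewrite addr_ge0 ?logmod_ge0// ln_ge0// ler1n.
have mf : measurable_fun setT (fun y => (far z y)%:E).
  exact: (measurable_section1 (f := fun x y => (far x y)%:E) mfar z).
have f0 y : 0 <= (far z y)%:E by rewrite lee_fin far_ge0.
apply: (@le_lt_trans _ _ (\int[a]_y ((logmod z + ln 2)%:E + (far z y)%:E))).
  apply: ge0_le_integral => //; first exact: emeasurable_funD.
  by move=> y _; rewrite -EFinD lee_fin farC logmod_le_far.
rewrite ge0_integralD//.
have -> : \int[a]_x (far z x)%:E = (fine (neg z))%:E by rewrite fineK.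
by rewrite (integral_cst_mass a k0) -EFinD ltry.
Qed.

Lemma kpot_potential z : potential a z \is a fin_num -> \int[a]_y (logmod y)%:E < +oo ->
  kpot a z = potential a z + (mass a * logmod z)%:E + \int[a]_y (logmod y)%:E.
Proof.
move=> vfin loo; have [pfin nfin] := parts_fin vfin.
have lfin : \int[a]_y (logmod y)%:E \is a fin_num.
  by rewrite ge0_fin_numE// integral_ge0.
have mf : measurable_fun setT (fun y => (far z y)%:E).
  exact: (measurable_section1 (f := fun x y => (far x y)%:E) mfar z).
have f0 y : 0 <= (far z y)%:E by rewrite lee_fin far_ge0.
have mp : measurable_fun setT (log_pos z).
  exact: (measurable_section1 (f := log_pos) measurable_log_pos z).
have lz0 := log0 z.
have E : kpot a z + neg z = pos z + ((mass a * logmod z)%:E + \int[a]_y (logmod y)%:E).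
  rewrite -(integral_cst_mass a (logmod_ge0 z)).
  have D1 : \int[a]_y ((logmod z)%:E + (logmod y)%:E) =
      \int[a]_y (logmod z)%:E + \int[a]_y (logmod y)%:E.
    exact: (ge0_integralD a measurableT (fun y _ => lz0) (measurable_cst _) (fun y _ => log0 y) mlog).
  have D2 : \int[a]_y (log_pos z y + ((logmod z)%:E + (logmod y)%:E)) =
      pos z + \int[a]_y ((logmod z)%:E + (logmod y)%:E).
    exact: (ge0_integralD a measurableT (fun y _ => log_pos_ge0 z y) mp
      (fun y _ => adde_ge0 lz0 (log0 y)) (emeasurable_funD (measurable_cst _) mlog)).
  have D3 : \int[a]_y (kern z y + (far z y)%:E) = kpot a z + neg z.
    exact: (ge0_integralD a measurableT (fun y _ => kern_ge0 z y) (measurable_kernr z)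
      (fun y _ => f0 y) mf).
  rewrite -D1 -D2 -D3; apply: eq_integral => y _.
  by rewrite /kern -addeA -EFinD subrK.
rewrite potentialE -[LHS](addeK (kpot a z) nfin) E.
rewrite -[in RHS]addeA [RHS]addeAC; congr (_ - _); exact: erefl.
Qed.

(** The kernel exceeds the positive part of the logarithmic kernel by at most
logmod x + logmod y. *)
Lemma finite_kenergy : energy a \is a fin_num -> \int[a]_y (logmod y)%:E < +oo ->
  kenergy a < +oo.
Proof.
move=> efin loo; have [posoo _] := integral_fin_num_parts efin.
have posE : \int[a \x a]_p log_pos p.1 p.2 < +oo.
  apply: le_lt_trans posoo; rewrite le_eqVlt; apply/orP; left; apply/eqP.
  by apply: eq_integral => p _; rewrite log_kernel_pos.
have ml1 : measurable_fun setT (fun p : plane R * plane R => (logmod p.1)%:E).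
  exact: measurableT_comp mlog measurable_fst.
have ml2 : measurable_fun setT (fun p : plane R * plane R => (logmod p.2)%:E).
  exact: measurableT_comp mlog measurable_snd.
have moo : \int[a]_x \int[a]_y (logmod y)%:E < +oo.
  have lfin : \int[a]_y (logmod y)%:E \is a fin_num.
    by rewrite ge0_fin_numE// integral_ge0.
  by rewrite -(fineK lfin) integral_cst_mass ?ltry// fine_ge0// integral_ge0.
have E1 : \int[a \x a]_p (logmod p.1)%:E < +oo.
  rewrite (tonelli_prod (m1 := a) (m2 := a) (fun x _ => (logmod x)%:E) ml1 (fun x _ => log0 x)).
  by rewrite (tonelli (m1 := a) (m2 := a) (fun x _ => (logmod x)%:E) ml1 (fun x _ => log0 x)).
have E2 : \int[a \x a]_p (logmod p.2)%:E < +oo.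
  by rewrite (tonelli_prod (m1 := a) (m2 := a) (fun _ y => (logmod y)%:E) ml2 (fun _ y => log0 y)).
rewrite -kenergyE.
apply: (@le_lt_trans _ _ (\int[a \x a]_p (log_pos p.1 p.2 + ((logmod p.1)%:E + (logmod p.2)%:E)))).
  apply: ge0_le_integral => //.
  - by move=> p _; exact: kern_ge0.
  - exact: measurable_kern.
  - by apply: emeasurable_funD; [exact: measurable_log_pos|exact: emeasurable_funD].
  - move=> p _; rewrite /kern leeD2l// -EFinD lee_fin gerBl; exact: far_ge0.
rewrite ge0_integralD//; first last.
- exact: emeasurable_funD.
- by move=> p _; rewrite adde_ge0.
- exact: measurable_log_pos.
- by move=> p _; exact: log_pos_ge0.
by rewrite lte_add_pinfty// ge0_integralD// lte_add_pinfty.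
Qed.

End logarithmic_potential.

(** * Comparison with a signed measure *)

Section comparison_with_signed_measure.
Context {R : realType}.
Implicit Types (x y z : plane R).

(** In sums of extended reals -oo is absorbing, so a real value forces all terms to be
real. *)
Lemma fin_num_sum (u v w : \bar R) (C : R) : u - v + w = C%:E ->
  [/\ u \is a fin_num, v \is a fin_num & w \is a fin_num].
Proof. by case: u => [u| |]; case: v => [v| |]; case: w => [w| |]. Qed.

Lemma shifted_potential_algebra (u v w q : \bar R) (C c l m n L M : R) :
  u - v + w = C%:E -> w = q + (l - c)%:E -> m = (1 + n)%R ->
  u + (m * l)%:E + L%:E + q = v + (n * l)%:E + M%:E + (C + c + L - M)%:E.
Proof.
move=> E; have [] := fin_num_sum E; move: E.
case: u => [u| |]//; case: v => [v| |]//; case: w => [w| |]//; case: q => [q| |]//.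
move=> [E] _ _ _ [F] ->; congr _%:E; move: E; rewrite F => <-; ring.
Qed.

(** The two constants differ by F - D and are nonnegative, as the functions compared in
U_domination have to be. *)
Lemma transfer_le (p n k q : \bar R) (F D : R) : 0 <= k -> 0 <= q ->
  q \is a fin_num -> n \is a fin_num -> p + q = n + D%:E -> F%:E <= k + q ->
  p + (Num.max (F - D) 0)%:E <= k + n + (Num.max (D - F) 0)%:E.
Proof.
case: q => [q| |]//; case: n => [n| |]//; case: p => [p| |]//; case: k => [k| |]//.
  2: by move=> *; rewrite !addye// leey.
move=> _ _ _ _ [E]; rewrite -!EFinD !lee_fin => Fk.
by have [H|H] := leP (F - D)%R 0%R; have [H'|H'] := leP (D - F)%R 0%R; lra.
Qed.

Lemma transfer_eq (p n k q : \bar R) (F D : R) :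
  q \is a fin_num -> n \is a fin_num -> p + q = n + D%:E -> k + q = F%:E ->
  k + n + (Num.max (D - F) 0)%:E = p + (Num.max (F - D) 0)%:E /\
  p + (Num.max (F - D) 0)%:E < +oo.
Proof.
case: q => [q| |]//; case: n => [n| |]//; case: p => [p| |]//; case: k => [k| |]//.
move=> _ _ [E] [Fk]; split; last by rewrite -EFinD ltry.
rewrite -!EFinD; congr _%:E.
by have [H|H] := leP (F - D)%R 0%R; have [H'|H'] := leP (D - F)%R 0%R; lra.
Qed.

Variables (Sigma : set (plane R)) (Q : plane R -> \bar R).
Variable mu : probability (plane R) R.
Variables sp sm : {finite_measure set (plane R) -> \bar R}.
Variable C : R.
Hypothesis cSigma : closed Sigma.
Hypothesis Qadm : weakly_admissible Sigma Q.
Hypothesis mu_eq : equilibrium_measure Sigma Q mu.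
Hypothesis sp_out : sp (~` Sigma) = 0.
Hypothesis masses : (mass sp = 1 + mass sm)%R.
Hypotheses (sp_fin : energy sp \is a fin_num) (sm_fin : energy sm \is a fin_num).
Hypothesis qe : quasi_everywhere Sigma (fun z => potential sp z - potential sm z + Q z = C%:E).

(** The exceptional set is measurable and has capacity zero. *)
Lemma ae_quasi_everywhere (a : {finite_measure set (plane R) -> \bar R}) :
  a (~` Sigma) = 0 -> kenergy a < +oo ->
  {ae a, forall z, Sigma z /\ potential sp z - potential sm z + Q z = C%:E}.
Proof.
move=> aS aoo; have [q [c [_ mq _ q_in]]] := normalized_field cSigma Qadm.
have mS := closed_plane_measurable cSigma.
pose W z := potential sp z - potential sm z + (q z + (logmod z - c)%:E).
have mW : measurable_fun setT W.
  apply: emeasurable_funD.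
    by apply: emeasurable_funB; exact: measurable_potential.
  apply: emeasurable_funD => //; apply/measurable_EFinP.
  by apply: measurable_funB => //; exact: measurable_logmod.
pose E := [set z | Sigma z /\ ~ (potential sp z - potential sm z + Q z = C%:E)].
have EE : E = Sigma `&` ~` (W @^-1` [set C%:E]).
  by apply/seteqP; split => z [Sz]; rewrite /W/= => H; split => // H'; apply: H;
    rewrite -H' q_in.
have mE : measurable E.
  rewrite EE; apply: measurableI => //; apply: measurableC.
  by rewrite -[X in measurable X]setTI; apply: mW => //; exact: emeasurable_set1.
exists (E `|` ~` Sigma); split.
- by apply: measurableU => //; exact: measurableC.
- apply/eqP; rewrite eq_le measure_ge0 andbT.
  have := measureU2 a mE (measurableC mS).
  by rewrite [X in _ + X](aS : _ = 0) [X in X + _](capacity0_null mE aoo qe : _ = 0) adde0.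
- move=> z /= nz; have [Sz|nSz] := pselect (Sigma z); last by right.
  by left; split => // H; apply: nz.
Qed.

(** The equation between the potentials holds at some point, mu-almost every point in
fact, and there both potentials are finite: sp and sm have logarithmic moments, which
turns the finiteness of their energies into that of the nonnegative kernel. The
equation becomes kpot sp + q = kpot sm + D, to be compared with the Frostman
inequalities. *)
Lemma equilibrium_le_positive_part A : measurable A -> mu A <= sp A.
Proof.
have [q [c [[c0 q0] mq q_out q_in]]] := normalized_field cSigma Qadm.
have mS := closed_plane_measurable cSigma.
have [_ _ cap _] := Qadm; have [mu_out _] := mu_eq.
have [mu_oo q_oo] := equilibrium_finite mS c0 q0 mq q_out q_in mu_eq cap.
have ae_mu := ae_quasi_everywhere mu_out mu_oo.
have nonempty (P : plane R -> Prop) : {ae mu, forall z, P z} -> exists z, P z.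
  move=> [B [mB B0 nP]]; apply: contrapT => noP; move: B0.
  rewrite (_ : B = setT) ?(probability_setT mu : _ = 1)//.
    by move/eqP; rewrite onee_eq0.
  by apply/seteqP; split => // z _; apply: nP => Pz; apply: noP; exists z.
have [z0 [_ /fin_num_sum[p0 n0 _]]] := nonempty _ ae_mu.
have sp_log := integral_logmod_lty p0; have sm_log := integral_logmod_lty n0.
have sp_oo := finite_kenergy sp_fin sp_log; have sm_oo := finite_kenergy sm_fin sm_log.
have ae_sp := ae_quasi_everywhere sp_out sp_oo.
pose F := robin_constant q mu.
have var := first_variation mS c0 q0 mq q_out q_in mu_eq cap.
have F_mu : \int[mu]_x (kpot mu x + q x) = F%:E.
  rewrite /F /robin_constant EFinD !fineK ?ge0_fin_numE ?kenergy_ge0 ?integral_ge0//.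
  exact: (ge0_integralD mu measurableT (fun x _ => kpot_ge0 mu x) (measurable_kpot mu)
    (fun x _ => q0 x) mq).
have F_sp := frostman_ge q0 mq q_out var sp_oo.
have F_eq := frostman_eq q0 mq q_out var mu_oo F_mu.
pose Lp := fine (\int[sp]_y (logmod y)%:E); pose Lm := fine (\int[sm]_y (logmod y)%:E).
have LpE : \int[sp]_y (logmod y)%:E = Lp%:E.
  by rewrite fineK// ge0_fin_numE// integral_ge0// => y _; rewrite lee_fin logmod_ge0.
have LmE : \int[sm]_y (logmod y)%:E = Lm%:E.
  by rewrite fineK// ge0_fin_numE// integral_ge0// => y _; rewrite lee_fin logmod_ge0.
pose D := (C + c + Lp - Lm)%R.
have good z : Sigma z /\ potential sp z - potential sm z + Q z = C%:E ->
    [/\ q z \is a fin_num, kpot sm z \is a fin_num & kpot sp z + q z = kpot sm z + D%:E].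
  move=> [Sz E]; have [pf nf Qf] := fin_num_sum E; have QE := q_in z Sz.
  rewrite (kpot_potential pf sp_log) (kpot_potential nf sm_log) LpE LmE; split.
  - by move: Qf; rewrite QE; case: (q z).
  - by move: nf; case: (potential sm z).
  - exact: shifted_potential_algebra E QE masses.
have A10 : (0 <= Num.max (D - F) 0)%R by rewrite le_max lexx orbT.
have A20 : (0 <= Num.max (F - D) 0)%R by rewrite le_max lexx orbT.
have mass1 : (mass mu + mass sm = mass sp)%R.
  by rewrite masses; congr (_ + _)%R; apply: EFin_inj; rewrite massE; exact: (probability_setT mu).
have sp_neq0 : sp setT != 0.
  by rewrite -massE eqe masses gt_eqF// ltr_pwDl// mass_ge0.
apply: (le_measure_of_potentials (mu := mu) (sp := sp)) => l l0.
apply: (U_domination A10 A20 mass1 sp_neq0 sp_log sp_oo mu_oo _ _ l0).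
- apply: filterS2 ae_sp F_sp => z /good[qf nf E] Fz.
  exact: transfer_le (kpot_ge0 _ _) (q0 z) qf nf E Fz.
- apply: filterS2 ae_mu F_eq => z /good[qf nf E] Fz.
  exact: transfer_eq qf nf E Fz.
Qed.

End comparison_with_signed_measure.

Theorem proposition4p11 (R : realType) (Sigma : set (plane R))
    (Q : plane R -> \bar R) (muQ : probability (plane R) R)
    (sigma : {charge set (plane R) -> \bar R}) (P N : set (plane R))
    (sigmaPN : hahn_decomposition sigma P N) :
  closed Sigma -> Sigma <> setT ->
  weakly_admissible Sigma Q ->
  equilibrium_measure Sigma Q muQ ->
  charge_variation sigmaPN (~` Sigma) = 0 ->
  jordan_pos sigmaPN setT - jordan_neg sigmaPN setT = 1 ->
  energy (jordan_pos sigmaPN) \is a fin_num ->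
  energy (jordan_neg sigmaPN) \is a fin_num ->
  (forall z, supp (charge_variation sigmaPN) z ->
    potential (jordan_pos sigmaPN) z \is a fin_num /\
    potential (jordan_neg sigmaPN) z \is a fin_num) ->
  (exists C : R, quasi_everywhere Sigma
    (fun z => signed_potential sigmaPN z + Q z = C%:E)) ->
  (forall A, measurable A -> muQ A <= jordan_pos sigmaPN A) /\
  supp muQ `<=` supp (jordan_pos sigmaPN).
Proof.
move=> cSigma _ Qadm mu_eq var0 mass1 sp_fin sm_fin _ [C qe].
pose sp : {finite_measure set (plane R) -> \bar R} := jordan_pos sigmaPN.
pose sm : {finite_measure set (plane R) -> \bar R} := jordan_neg sigmaPN.
have /eqP : sp (~` Sigma) + sm (~` Sigma) = 0 by exact: var0.
rewrite padde_eq0 ?measure_ge0// => /andP[/eqP sp_out _].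
have masses : (mass sp = 1 + mass sm)%R.
  have : (mass sp)%:E - (mass sm)%:E = 1 by rewrite !massE; exact: mass1.
  by move=> [] <-; rewrite subrK.
have mu_le A : measurable A -> muQ A <= jordan_pos sigmaPN A.
  move=> mA.
  exact: (equilibrium_le_positive_part cSigma Qadm mu_eq sp_out masses sp_fin sm_fin qe mA).
split => // z muz U oU Uz; apply: lt_le_trans (muz U oU Uz) _.
exact: mu_le (open_plane_measurable oU).
Qed.
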